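(* Let $(u_k,w_k,L_k)$ be a sequence generated by the iterative scheme described in the context, and let $\bar u\in U$ and $\bar w\in W$ be the weak limits in $U$ and $W$ of $(u_{k_n})$ and $(w_{k_n})$, respectively, along a subsequence $(k_n)$. Then there are $\bar\lambda\in W^*$ and $\bar\mu^1,\bar\mu^2\in U$ such that $$f'(\bar u)v+\alpha(\bar u,v)_U+\beta(\bar w,z)_W+\gamma\langle\bar\lambda,z\rangle_W+(\bar\mu^1,z-v)_U+(\bar\mu^2,z+v)_U=0\quad\forall(v,z)\in U\times W$$ and $$\langle\bar\lambda,\bar w\rangle_W\ge p\int_\Omega|\bar w|^p\,dx .$$ Moreover, $\bar\mu^1\in\partial I_C(\bar w-\bar u)$ and $\bar\mu^2\in\partial I_C(\bar w+\bar u)$.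
   Context: Setting. $\Omega\subset\mathbb{R}^d$ is a bounded Lipschitz domain, $I=(0,T)$ with $T>0$, and $U:=L^2(I\times\Omega)$, identified with its dual. All functions are real valued. A function $w$ on $\Omega$ is extended to $I\times\Omega$ by $w(t,x):=w(x)$ when needed; e.g. $(\mu,z-v)_U=\int_\Omega\int_I\mu(t,x)(z(x)-v(t,x))\,dt\,dx$. The space $W$ is one of the Hilbert spaces $H^s(\Omega)$, $H^s_0(\Omega)$, $\tilde H^s(\Omega)$, $\mathbb{H}^s(\Omega)$ for some $s\in(0,1)$, where: (1) $H^s(\Omega)$ is the set of $w\in L^2(\Omega)$ with $\int_\Omega\int_\Omega \frac{|w(x)-w(y)|^2}{|x-y|^{d+2s}}\,dy\,dx<\infty$, with inner product $(u,w)_{H^s(\Omega)}=\int_\Omega uw\,dx+\frac{c_{d,s}}{2}\int_\Omega\int_\Omega\frac{(u(x)-u(y))(w(x)-w(y))}{|x-y|^{d+2s}}\,dy\,dx$, $c_{d,s}=\frac{s2^{2s}\Gamma(s+d/2)}{\pi^{d/2}\Gamma(1-s)}$; (2) $H^s_0(\Omega)$ is the closure of $C_c^\infty(\Omega)$ in $H^s(\Omega)$, with the $H^s(\Omega)$-inner product; (3) $\tilde H^s(\Omega)=\{w\in H^s(\mathbb{R}^d): w=0 \text{ on } \mathbb{R}^d\setminus\Omega\}$, with the $H^s(\mathbb{R}^d)$-inner product (same formula as in (1) with $\mathbb{R}^d$ in place of $\Omega$); (4) $\mathbb{H}^s(\Omega)=\{w=\sum_n w_n\phi_n\in L^2(\Omega):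 \|w\|^2_{\mathbb{H}^s}=\sum_n\lambda_n^s w_n^2<\infty\}$, where $w_n=\int_\Omega w\phi_n\,dx$ and $(\phi_n,\lambda_n)$ are the ($L^2$-orthonormal) eigenfunctions and eigenvalues of the Laplacian with zero Dirichlet boundary conditions, with inner product $\sum_n\lambda_n^s u_nw_n$. $\langle\cdot,\cdot\rangle_W$ is the duality pairing of $W^*$ and $W$. The admissible set is $K:=\{(u,w)\in U\times W: |u(t,x)|\le w(x) \text{ for a.a. } (t,x)\in I\times\Omega\}$. $C:=\{v\in U: v\ge0\}$ and $I_C$ is its indicator function; for $\bar v\in C$, $\mu\in U$ belongs to $\partial I_C(\bar v)$ iff $(\mu,v-\bar v)_U\le0$ for all $v\in C$. Standing assumptions. $f:U\to\mathbb{R}$ is weakly lower semicontinuous, bounded from below by an affine function (there are $g\in U^*$, $c\in\mathbb{R}$ with $f(u)\ge g(u)+c$ for all $u\in U$), and continuously Fréchet differentiable; $f'$ is completely continuous ($u_k\rightharpoonup \bar u$ in $U$ implies $f'(u_k)\to f'(\bar u)$ in $U$) and Lipschitz continuous on bounded sets. $\alpha,\beta,\gamma>0$ and $p\in(0,1)$. Smoothing. For $\epsilon>0$: $\psi_\epsilon(t)=\frac p2\frac{t}{\epsilon^{2-p}}+(1-\frac p2)\epsilon^p$ for $t\in[0,\epsilon^2)$ and $\psi_\epsilon(t)=t^{p/2}$ for $t\ge\epsilon^2$; then $\psi_\epsilon'(t)=\frac p2\min(\epsilon^{p-2},t^{(p-2)/2})$. Iterative scheme. Choose $b>1$, $L>0$,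 a monotonically decreasing sequence $(\epsilon_k)$ of positive numbers with $\epsilon_k\searrow0$, and $(u_0,w_0)\in K$. For $k=0,1,2,\dots$: let $L_k$ be the smallest number from $\{Lb^l: l=0,1,2,\dots\}$ such that the solution $(u_{k+1},w_{k+1})$ of $$\min_{(u,w)\in K}\ \varphi_k(u,w):=f'(u_k)(u-u_k)+\frac\alpha2\|u\|_U^2+\frac\beta2\|w\|_W^2+\gamma\int_\Omega\psi_{\epsilon_k}'(w_k^2)(w^2-w_k^2)\,dx+\frac{L_k}{2}\|u-u_k\|_U^2$$ satisfies $f(u_{k+1})\le f(u_k)+f'(u_k)(u_{k+1}-u_k)+L_k\|u_{k+1}-u_k\|_U^2$. *)

(* Defs.v *)
From HB Require Import structures.
From mathcomp Require Import all_boot all_order all_algebra.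
From mathcomp Require Import all_classical all_reals all_analysis.
From mathcomp Require Import measurable_realfun ring.

Set Implicit Arguments.
Unset Strict Implicit.
Unset Printing Implicit Defensive.

Import Order.TTheory GRing.Theory Num.Theory.
Import numFieldNormedType.Exports.

Local Open Scope classical_set_scope.
Local Open Scope ring_scope.

Definition rV_display : measure_display.
Proof. exact: default_measure_display. Qed.

(* The sigma-algebra generated by the coordinates, i.e. the Borel one. *)
Section measurable_rV.
Context (R : realType) (d : nat).

Let coord (i : 'I_d) (x : 'rV[R]_d) : measurableTypeR R := x ord0 i.

Let rV_set0 : g_sigma_preimage coord set0.
Proof. exact: sigma_algebra0. Qed.

Let rV_setC A : g_sigma_preimage coord A -> g_sigma_preimage coord (~` A).
Proof. exact: sigma_algebraC. Qed.

Let rV_bigcup (F : (set 'rV[R]_d)^nat) :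
  (forall i, g_sigma_preimage coord (F i)) ->
  g_sigma_preimage coord (\bigcup_i (F i)).
Proof. exact: sigma_algebra_bigcup. Qed.

HB.instance Definition _ := @isMeasurable.Build rV_display 'rV[R]_d
  (g_sigma_preimage coord) rV_set0 rV_setC rV_bigcup.

Lemma measurable_coord_rV (i : 'I_d) :
  measurable_fun [set: 'rV[R]_d] (fun x => x ord0 i : measurableTypeR R).
Proof.
move=> _ Y mY; rewrite setTI; apply: sub_sigma_algebra => /=.
rewrite -bigcup_seq/=; exists i => /=; first by rewrite mem_index_enum.
by exists Y => //; rewrite setTI.
Qed.

Lemma measurable_fun_rVP d1 (T1 : measurableType d1) (f : T1 -> 'rV[R]_d) :
  measurable_fun [set: T1] f <->
  forall i, measurable_fun [set: T1]
    (fun x => f x ord0 i : measurableTypeR R).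
Proof.
split=> [mf i|mf].
  exact: (measurableT_comp (measurable_coord_rV i) mf).
suff : g_sigma_preimage (fun i => coord i \o f) `<=` measurable.
  rewrite g_sigma_preimage_comp => prefS _ A mA.
  by apply: prefS; exists A.
apply: smallest_sub; first exact: sigma_algebra_measurable.
rewrite -bigcup_seq => A [i _] [B mB <-]; exact: mf.
Qed.

End measurable_rV.

Section open_measurable_rV.
Context (R : realType) (d : nat).

Lemma measurable_ball_rV (x : 'rV[R]_d) (e : R) : measurable (ball x e).
Proof.
have [e0|e0] := ltP 0 e; last first.
  rewrite (_ : ball x e = set0)//; apply/seteqP; split=> // y [].
  by rewrite ltNge e0.
rewrite (_ : ball x e = \bigcap_(i in [set: 'I_d])
    ((fun y : 'rV[R]_d => y ord0 i : measurableTypeR R) @^-1` ball (x ord0 i) e)).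
  apply: fin_bigcap_measurable => [|i _]; first exact: finite_finset.
  rewrite -[X in measurable X]setTI; apply: measurable_coord_rV => //.
  exact: measurable_ball.
apply/seteqP; split => [y [_ xy] i _|y xy]; first exact: xy.
by split=> // i j; rewrite !ord1; exact: xy.
Qed.

Lemma open_measurable_rV (A : set 'rV[R]_d) : open A -> measurable A.
Proof.
move=> oA.
pose B (q : 'rV[rat]_d * nat) : set 'rV[R]_d :=
  ball (map_mx ratr q.1 : 'rV[R]_d) (q.2.+1%:R^-1 : R).
rewrite (_ : A = \bigcup_(q in [set q | B q `<=` A]) B q); last first.
  apply/seteqP; split => [x Ax|x [q]]; last exact.
  have /nbhs_ballP[e /= e0 xeA] : nbhs x A by exact: open_nbhs_nbhs.
  have [n ne] : exists n, (n.+1%:R^-1 : R) < e / 2.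
    have := near_infty_natSinv_lt (PosNum (divr_gt0 e0 (ltr0n R 2))).
    by case=> n _ /(_ n (leqnn n)) ?; exists n.
  have rq (i : 'I_d) : exists q : rat, `|x ord0 i - ratr q| < (n.+1%:R^-1 : R).
    have [q] := @rat_in_itvoo R (x ord0 i - n.+1%:R^-1) (x ord0 i + n.+1%:R^-1)
      ltac:(by rewrite ltrBlDr -addrA ltrDl addr_gt0// invr_gt0).
    rewrite in_itv/= => /andP[q1 q2]; exists q.
    by rewrite distrC ltr_distl q1 q2.
  have [q qP] := choice rq.
  pose Q : 'rV[rat]_d := \row_i q i.
  exists (Q, n) => [y /= [_ Qy]|]; last first.
    split=> [|i j]; first by rewrite invr_gt0.
    by rewrite !ord1 !mxE /ball /= distrC.
  apply: xeA; split=> // i j; rewrite !ord1.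
  have := Qy ord0 j; rewrite !mxE /ball /= => Qyj.
  rewrite (le_lt_trans (ler_distD (ratr (q j)) _ _))// (splitr e).
  by rewrite ltrD// (lt_trans _ ne).
rewrite bigcup_mkcond; apply: countable_bigcupT_measurable => [|q].
  exact: countableP.
by case: ifPn => _ //; exact: measurable_ball_rV.
Qed.
End open_measurable_rV.

Section lebesgue_rV.
Context (R : realType).

Section step.
Context (d : nat) (m : {sigma_finite_measure set 'rV[R]_d -> \bar R}).

Definition cons_rV (p : measurableTypeR R * 'rV[R]_d) : 'rV[R]_d.+1 :=
  row_mx (const_mx p.1 : 'rV[R]_1) p.2.

Definition uncons_rV (x : 'rV[R]_d.+1) : measurableTypeR R * 'rV[R]_d :=
  (x ord0 ord0, \row_i x ord0 (lift ord0 i)).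

Lemma cons_rV0 p : cons_rV p ord0 ord0 = p.1.
Proof.
rewrite /cons_rV; have := row_mxEl (const_mx p.1 : 'rV_1) p.2 ord0 ord0.
by rewrite [lshift _ _](_ : _ = ord0) ?mxE//; exact: val_inj.
Qed.

Lemma cons_rVS p i : cons_rV p ord0 (lift ord0 i) = p.2 ord0 i.
Proof.
by rewrite -rshift1; exact: (row_mxEr (const_mx p.1 : 'rV_1) p.2 ord0 i).
Qed.

Lemma cons_rVK : cancel cons_rV uncons_rV.
Proof.
case=> a v; rewrite /uncons_rV cons_rV0; congr pair.
by apply/rowP => i; rewrite mxE cons_rVS.
Qed.

Lemma measurable_cons_rV : measurable_fun setT cons_rV.
Proof.
apply/measurable_fun_rVP => i; case: (unliftP ord0 i) => [j ->|->].
  under eq_fun do rewrite cons_rVS.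
  exact: (measurableT_comp (measurable_coord_rV j)).
under eq_fun do rewrite cons_rV0.
exact: measurable_fst.
Qed.

Lemma measurable_uncons_rV : measurable_fun setT uncons_rV.
Proof.
apply/measurable_fun_pairP; split; first exact: measurable_coord_rV.
apply/measurable_fun_rVP => i.
rewrite /=; under eq_fun do rewrite mxE.
exact: measurable_coord_rV.
Qed.

Definition lebesgue_rVS : set 'rV[R]_d.+1 -> \bar R :=
  pushforward (@lebesgue_measure R \x m)%E cons_rV.

Let mpush : {measure set 'rV[R]_d.+1 -> \bar R} :=
  measure_function_pushforward__canonical__measure_function_Measure
    (@lebesgue_measure R \x m)%E measurable_cons_rV.

HB.instance Definition _ := isMeasure.Build _ _ _ lebesgue_rVS
  (measure0 mpush) (measure_ge0 mpush)
  (@measure_semi_sigma_additive _ _ _ mpush).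

Let sigma_finite_lebesgue_rVS : sigma_finite setT lebesgue_rVS.
Proof.
have /sigma_finiteP[F [TF ndF Foo]] := sigma_finiteT (@lebesgue_measure R).
have /sigma_finiteP[G [TG ndG Goo]] := sigma_finiteT m.
exists (fun k => uncons_rV @^-1` (F k `*` G k)) => [|k].
  rewrite -preimage_bigcup (_ : \bigcup_k _ = setT) ?preimage_setT//.
  rewrite -setXTT TF TG predeqE => -[x y]; split.
    by move=> [n _ []/= ? ?]; split; exists n.
  move=> [/= [n _ Fnx] [k _ Gky]]; exists (maxn n k) => //; split.
  - by move: x Fnx; exact/subsetPset/ndF/leq_maxl.
  - by move: y Gky; exact/subsetPset/ndG/leq_maxr.
have [mF Fk] := Foo k; have [mG Gk] := Goo k; split.
  rewrite -[X in measurable X]setTI; apply: measurable_uncons_rV => //.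
  exact: measurableX.
rewrite /lebesgue_rVS /pushforward -comp_preimage.
rewrite (_ : uncons_rV \o cons_rV = id); last first.
  by apply/funext => p /=; rewrite cons_rVK.
by rewrite preimage_id product_measure1E// lte_mul_pinfty// ge0_fin_numE.
Qed.

HB.instance Definition _ :=
  Measure_isSigmaFinite.Build _ _ _ lebesgue_rVS sigma_finite_lebesgue_rVS.

End step.

Fixpoint lebesgue_rV d : {sigma_finite_measure set 'rV[R]_d -> \bar R} :=
  if d is d'.+1 then lebesgue_rVS (lebesgue_rV d')
  else @dirac _ 'rV[R]_0 0 R.

Lemma lebesgue_rV_box d (A : 'I_d -> set (measurableTypeR R)) :
  (forall i, measurable (A i)) ->
  lebesgue_rV d [set x | forall i, A i (x ord0 i)] =
  (\prod_(i < d) lebesgue_measure (A i))%E.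
Proof.
elim: d A => [|d ih] A mA /=.
  by rewrite big_ord0 diracE mem_set//= => -[].
have mB : measurable [set x : 'rV[R]_d | forall i, A (lift ord0 i) (x ord0 i)].
  rewrite [X in measurable X](_ : _ = \bigcap_(i in [set: 'I_d])
      ((fun x : 'rV[R]_d => x ord0 i : measurableTypeR R) @^-1`
        A (lift ord0 i))).
    apply: fin_bigcap_measurable => [|i _]; first exact: finite_finset.
    rewrite -[X in measurable X]setTI; exact: measurable_coord_rV.
  by apply/seteqP; split => x /= Ax i; [move=> _|]; exact: Ax.
rewrite big_ord_recl -ih// /lebesgue_rVS /pushforward.
rewrite (_ : _ @^-1` _ = A ord0 `*`
    [set x : 'rV[R]_d | forall i, A (lift ord0 i) (x ord0 i)]).
  by rewrite product_measure1E.
apply/seteqP; split => p /=.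
  by move=> Ap; split=> [|i]; [rewrite -cons_rV0|rewrite -cons_rVS]; exact: Ap.
move=> [A0 Ap] i.
by case: (unliftP ord0 i) => [j ->|->]; rewrite ?cons_rV0 ?cons_rVS.
Qed.

End lebesgue_rV.

Section euclidean.
Context (R : realType) (d : nat).

Definition enorm (x : 'rV[R]_d) : R := Num.sqrt (\sum_i x ord0 i ^+ 2).

(* Near each boundary point, after an orthogonal change of coordinates, [Omega]
   lies strictly above the graph of a Lipschitz function of the coordinates
   other than the [j]-th one. *)
Definition lipschitz_boundary (Omega : set 'rV[R]_d) :=
  forall x0, (closure Omega `\` Omega°) x0 ->
  exists (r : R) (j : 'I_d) (Q : 'M[R]_d) (g : 'rV[R]_d.-1 -> R),
    [/\ 0 < r, Q *m Q^T = 1%:M, lipschitz g &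
      forall x, enorm (x - x0) < r ->
        Omega x <-> g (col' j (x *m Q)) < (x *m Q) ord0 j].

Record lipschitz_domain := LipschitzDomain {
  dom :> set 'rV[R]_d ;
  dom_nonempty : dom !=set0 ;
  dom_open : open dom ;
  dom_connected : connected dom ;
  dom_bounded : bounded_set dom ;
  dom_lipschitz : lipschitz_boundary dom }.

Lemma measurable_dom (Omega : lipschitz_domain) : measurable Omega.
Proof. by apply: open_measurable_rV; exact: dom_open. Qed.

Definition partial (i : 'I_d) (f : 'rV[R]_d -> R) : 'rV[R]_d -> R :=
  fun x => 'D_(delta_mx ord0 i) f x.

(* All iterated partial derivatives exist and are continuous. *)
Definition smooth (f : 'rV[R]_d -> R) := forall s : seq 'I_d,
  continuous (foldr partial f s) /\
  forall i x, derivable (foldr partial f s) x (delta_mx ord0 i).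

Definition test_fun (Omega : set 'rV[R]_d) (f : 'rV[R]_d -> R) :=
  [/\ smooth f, compact (closure [set x | f x != 0]) &
      closure [set x | f x != 0] `<=` Omega].

End euclidean.

Section smoothing.
Context (R : realType) (p : R).

(* Extended affinely to t < 0, so that the one-sided derivative at 0 becomes
   a two-sided one. *)
Definition psi (eps t : R) : R :=
  if t < eps ^+ 2 then p / 2 * (t / eps `^ (2 - p)) + (1 - p / 2) * eps `^ p
  else t `^ (p / 2).

(* The test [t == 0] encodes t^((p-2)/2) = +oo at t = 0: [0 `^ a] is 0 for
   every nonzero [a], including negative ones. *)
Definition dpsi (eps t : R) : R :=
  p / 2 * (if t == 0 then eps `^ (p - 2)
           else Num.min (eps `^ (p - 2)) (t `^ ((p - 2) / 2))).

Lemma is_derive_glue (f f1 f2 : R -> R) (a l : R) :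
  (forall x, f x = f1 x \/ f x = f2 x) -> f1 a = f a -> f2 a = f a ->
  is_derive a 1 f1 l -> is_derive a 1 f2 l -> is_derive a 1 f l.
Proof.
move=> ff f1a f2a [/cvg_ex[l1 /= c1] e1] [/cvg_ex[l2 /= c2] e2].
have {}e1 : l1 = l by rewrite -e1; apply/esym/cvg_lim.
have {}e2 : l2 = l by rewrite -e2; apply/esym/cvg_lim.
subst l1 l2.
have c : h^-1 *: (f (h *: 1 + a) - f a) @[h --> 0^'] --> l.
  apply/cvgrPdist_le => e e0.
  move/cvgrPdist_le : c1 => /(_ _ e0) c1.
  move/cvgrPdist_le : c2 => /(_ _ e0) c2.
  near=> h.
  have [->|->] := ff (h *: 1 + a).
    by rewrite -f1a; near: h; exact: c1.
  by rewrite -f2a; near: h; exact: c2.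
split; first by apply/cvg_ex; exists l.
exact/cvg_lim.
Unshelve. all: by end_near. Qed.

Lemma dpsiE (eps t : R) : 0 < eps -> p < 2 -> 0 <= t -> dpsi eps t =
  p / 2 * (if t < eps ^+ 2 then eps `^ (p - 2) else t `^ ((p - 2) / 2)).
Proof.
move=> e0 p2 t0; rewrite /dpsi; congr (_ * _).
have e2 : 0 < eps ^+ 2 by rewrite exprn_gt0.
have [->|tN0] := eqVneq t 0; first by rewrite e2.
have {}t0 : 0 < t by rewrite lt_neqAle eq_sym tN0.
have <- : (eps ^+ 2) `^ ((p - 2) / 2) = eps `^ (p - 2).
  by rewrite -powR_mulrn ?(ltW e0)// -powRrM; congr (_ `^ _); field.
have h (x y : R) : 0 < x -> x <= y -> y `^ ((p - 2) / 2) <= x `^ ((p - 2) / 2).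
  move=> x0 xy; rewrite -(opprK ((p - 2) / 2)) !(powRN _ (- _)).
  have y0 : 0 < y by exact: lt_le_trans xy.
  rewrite lef_pV2 ?posrE ?powR_gt0//.
  rewrite ge0_ler_powR ?nnegrE ?(ltW x0) ?(ltW y0)//.
  by rewrite oppr_ge0 pmulr_lle0 ?invr_gt0// subr_le0 ltW.
by have [te|te] := ltP t; [rewrite min_l// h// ltW|rewrite min_r// h].
Qed.

Lemma is_derive_psi (eps t : R) : 0 < eps -> p < 2 -> 0 <= t ->
  is_derive t 1 (psi eps) (dpsi eps t).
Proof.
move=> e0 p2 t0; rewrite dpsiE//.
have e2 : 0 < eps ^+ 2 by rewrite exprn_gt0.
pose f1 x : R := p / 2 * (x / eps `^ (2 - p)) + (1 - p / 2) * eps `^ p.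
have df1 : is_derive t 1 f1 (p / 2 * eps `^ (p - 2)).
  have -> : eps `^ (p - 2) = (eps `^ (2 - p))^-1 by rewrite -powRN opprB.
  rewrite /f1; apply: is_derive_eq.
  by rewrite /= !scaler0 ?addr0 ?add0r ?scale0r ?addr0 /GRing.scale /=; ring.
pose f2 (x : R) : R := x `^ (p / 2).
have df2 : 0 < t -> is_derive t 1 f2 (p / 2 * t `^ ((p - 2) / 2)).
  move=> t1; rewrite (_ : (p - 2) / 2 = p / 2 - 1); last by field.
  exact: is_derive1_powR.
have [te|] := ltP t (eps ^+ 2).
  apply: near_eq_is_derive df1; near=> x; rewrite /psi ifT//.
  by near: x; exact: lt_nbhsl.
rewrite le_eqVlt => /predU1P[te|te]; last first.
  apply: near_eq_is_derive (df2 (lt_trans e2 te)); near=> x.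
  rewrite /psi ifF//; apply/negbTE; rewrite -leNgt ltW//.
  by near: x; exact: lt_nbhsr.
have t1 : 0 < t by rewrite -te.
apply: (@is_derive_glue _ f1 f2) => [x| | | |]; last exact: df2.
- by rewrite /psi; case: ifP => _; [left|right].
- have -> : psi eps t = eps `^ p.
    rewrite /psi -te ltxx -powR_mulrn ?(ltW e0)// -powRrM.
    by congr (_ `^ _); field.
  have E : eps ^+ 2 = eps `^ p * eps `^ (2 - p).
    rewrite -powRD; last by rewrite (gt_eqF e0) implybT.
    by rewrite addrC subrK powR_mulrn// ltW.
  rewrite /f1 -te E mulfK ?gt_eqF ?powR_gt0//; ring.
- by rewrite /psi -te ltxx.
- rewrite (_ : t `^ _ = eps `^ (p - 2))//.
  by rewrite -te -powR_mulrn ?(ltW e0)// -powRrM; congr (_ `^ _); field.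
Unshelve. all: by end_near. Qed.

End smoothing.

(* An element of [L2 mu] is a square-integrable function, not a class modulo
   a.e. equality. Every notion below is stable under changes on null sets; for a
   functional on [L2 mu] this is forced by [frechet_derivative] or [in_dual], whose
   bounds vanish along functions that are 0 a.e. *)
Notation L2 mu := (LfunType mu (lee1n 2)).

(* A Hilbert space sitting inside an ambient vector space of functions; [hip] is
   only meaningful on [hcar]. *)
Record hspace (R : realType) (V : lmodType R) := HSpace {
  hcar : set V ;
  hip : V -> V -> R }.

Section hspace_theory.
Context (R : realType) (V : lmodType R) (H : hspace V).

Definition hnorm (x : V) : R := Num.sqrt (hip H x x).

Definition in_dual (l : V -> R) :=
  (forall a x y, hcar H x -> hcar H y -> l (a *: x + y) = a * l x + l y) /\
  (exists M : R, forall x, hcar H x -> `|l x| <= M * hnorm x).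

Definition weak_cvg (x_ : nat -> V) (x : V) :=
  forall l, in_dual l -> l (x_ n) @[n --> \oo] --> l x.

End hspace_theory.

Section L2_space.
Context (R : realType) disp (X : measurableType disp).
Variable mu : {measure set X -> \bar R}.

Definition L2ip (u v : X -> R) : R := \int[mu]_x (u x * v x).

Definition L2norm (u : X -> R) : R := Num.sqrt (L2ip u u).

Definition L2_hspace : hspace (L2 mu) :=
  @HSpace R (L2 mu) setT (fun u v : L2 mu => L2ip u v).

(* The dual of L2 is identified with L2: [f' u] is the Riesz representative of
   the derivative of [f] at [u]. *)
Definition frechet_derivative (f : L2 mu -> R) (f' : L2 mu -> L2 mu) :=
  forall (u : L2 mu) (e : R), 0 < e -> exists2 delta : R, 0 < delta &
    forall h : L2 mu, L2norm h <= delta ->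
      `|f (u + h) - f u - L2ip (f' u) h| <= e * L2norm h.

Definition L2_continuous (f' : L2 mu -> L2 mu) :=
  forall (u : L2 mu) (e : R), 0 < e -> exists2 delta : R, 0 < delta &
    forall v : L2 mu, L2norm (v - u) <= delta -> L2norm (f' v - f' u) <= e.

Definition weakly_lsc (f : L2 mu -> R) :=
  forall (u_ : nat -> L2 mu) (u : L2 mu), weak_cvg L2_hspace u_ u ->
    ((f u)%:E <= limn_einf (fun n => (f (u_ n))%:E))%E.

Definition affinely_bounded_below (f : L2 mu -> R) :=
  exists (g : L2 mu -> R) (c : R), in_dual L2_hspace g /\ forall u, g u + c <= f u.

Definition completely_continuous (f' : L2 mu -> L2 mu) :=
  forall (u_ : nat -> L2 mu) (u : L2 mu), weak_cvg L2_hspace u_ u ->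
    L2norm (f' (u_ n) - f' u) @[n --> \oo] --> (0 : R).

Definition lipschitz_on_bounded (f' : L2 mu -> L2 mu) :=
  forall r : R, exists M : R, forall u v : L2 mu,
    L2norm u <= r -> L2norm v <= r -> L2norm (f' u - f' v) <= M * L2norm (u - v).

Definition nonneg_cone : set (L2 mu) := [set v | {ae mu, forall x, 0 <= v x}].

Definition subdiff_indicator (C : set (L2 mu)) (v : L2 mu) : set (L2 mu) :=
  [set m | C v /\ forall z, C z -> L2ip m (z - v) <= 0].

End L2_space.

Section spaces.
Context (R : realType) (d : nat).
Implicit Types Omega : lipschitz_domain R d.

Definition dom_measure Omega : {measure set 'rV[R]_d -> \bar R} :=
  mrestr (lebesgue_rV R d) (measurable_dom Omega).

Local Notation L2O Omega := (L2 (dom_measure Omega)).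

Definition Gamma (z : R) : R :=
  \int[@lebesgue_measure R]_(t in `]0, +oo[) (t `^ (z - 1) * expR (- t)).

Definition c_ds (s : R) : R :=
  s * 2 `^ (2 * s) * Gamma (s + d%:R / 2) /
  (pi `^ (d%:R / 2) * Gamma (1 - s)).

(* [mu] is Lebesgue measure, possibly restricted to an open set. On the null set
   x = y the integrand is 0, because 0 `^ a = 0 for a != 0 and 0^-1 = 0. *)
Definition gagliardo_finite (mu : {measure set 'rV[R]_d -> \bar R}) (s : R)
    (w : 'rV[R]_d -> R) :=
  (\int[mu]_x \int[mu]_y
    (`|w x - w y| ^+ 2 / enorm (x - y) `^ (d%:R + 2 * s))%:E < +oo)%E.

Definition Hs_ip (mu : {measure set 'rV[R]_d -> \bar R}) (s : R)
    (u w : 'rV[R]_d -> R) : R :=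
  \int[mu]_x (u x * w x) +
  c_ds s / 2 * \int[mu]_x \int[mu]_y
    ((u x - u y) * (w x - w y) / enorm (x - y) `^ (d%:R + 2 * s)).

Definition Hs Omega (s : R) : hspace (L2O Omega) :=
  @HSpace R (L2O Omega)
    [set w : L2O Omega | gagliardo_finite (dom_measure Omega) s w]
    (fun u w : L2O Omega => Hs_ip (dom_measure Omega) s u w).

Definition Hs0 Omega (s : R) : hspace (L2O Omega) :=
  @HSpace R (L2O Omega)
    [set w : L2O Omega | hcar (Hs Omega s) w /\ forall e : R, 0 < e ->
      exists2 rho : L2O Omega,
        test_fun Omega rho & hnorm (Hs Omega s) (w - rho) < e]
    (hip (Hs Omega s)).

Definition zero_ext Omega (w : 'rV[R]_d -> R) : 'rV[R]_d -> R :=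
  patch (cst 0) Omega w.

(* A function of H^s(R^d) vanishing outside [Omega] is identified with its
   restriction to [Omega]. *)
Definition Hs_tilde Omega (s : R) : hspace (L2O Omega) :=
  @HSpace R (L2O Omega)
    [set w : L2O Omega |
      gagliardo_finite (lebesgue_rV R d) s (zero_ext Omega w)]
    (fun u w : L2O Omega =>
      Hs_ip (lebesgue_rV R d) s (zero_ext Omega u) (zero_ext Omega w)).

(* [w] belongs to H^1_0(Omega) and has weak gradient [g]. *)
Definition H10_gradient Omega (w : L2O Omega)
    (g : 'I_d -> L2O Omega) :=
  forall e : R, 0 < e -> exists2 rho : 'rV[R]_d -> R, test_fun Omega rho &
    L2norm (dom_measure Omega) (rho \- w) < e /\
    forall i, L2norm (dom_measure Omega) (partial i rho \- g i) < e.

Definition dirichlet_eigenpair Omega (phi : L2O Omega) (lam : R) :=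
  exists2 g, H10_gradient phi g &
    forall (v : L2O Omega) h, H10_gradient v h ->
      \sum_i L2ip (dom_measure Omega) (g i) (h i) =
      lam * L2ip (dom_measure Omega) phi v.

Definition dirichlet_eigensystem Omega (phi : nat -> L2O Omega)
    (lam : nat -> R) :=
  [/\ forall n, dirichlet_eigenpair (phi n) (lam n),
      forall m n, L2ip (dom_measure Omega) (phi m) (phi n) = (m == n)%:R &
      forall w : L2O Omega,
        L2norm (dom_measure Omega)
          (w - \sum_(i < n) L2ip (dom_measure Omega) w (phi i) *: phi i)
        @[n --> \oo] --> (0 : R)].

Definition Hs_spectral Omega (phi : nat -> L2O Omega) (lam : nat -> R)
    (s : R) : hspace (L2O Omega) :=
  let coef (w : L2O Omega) n := L2ip (dom_measure Omega) w (phi n) in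
  @HSpace R (L2O Omega)
    [set w : L2O Omega |
      (\sum_(0 <= n <oo) (lam n `^ s * coef w n ^+ 2)%:E < +oo)%E]
    (fun u w : L2O Omega =>
      limn (series (fun n => lam n `^ s * coef u n * coef w n))).

Definition admissible_space Omega (s : R) (W : hspace (L2O Omega)) :=
  [\/ W = Hs Omega s, W = Hs0 Omega s, W = Hs_tilde Omega s |
      exists phi lam, dirichlet_eigensystem phi lam /\ W = Hs_spectral phi lam s].

Definition cyl_measure (T : R) Omega :
    {measure set (measurableTypeR R * 'rV[R]_d) -> \bar R} :=
  mrestr (@lebesgue_measure R \x lebesgue_rV R d)%E
    (measurableX (measurable_itv `]0, T[) (measurable_dom Omega)).

Section time_extension.
Context (T : R) Omega (w : L2O Omega).

Definition time_ext_fun (x : measurableTypeR R * 'rV[R]_d) : R := w x.2.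

Lemma time_ext_Lfun : time_ext_fun \in Lfun (cyl_measure T Omega) 2%:E.
Proof.
have mw : measurable_fun setT (w : 'rV[R]_d -> R) by [].
have mext : measurable_fun setT time_ext_fun.
  by apply: (measurableT_comp mw); exact: measurable_snd.
rewrite inE; apply/andP; split; first by rewrite inE.
rewrite inE/= /finite_norm unlock poweR_lty//.
have [c cE] : exists c : {nonneg R},
    c%:num%:E = @lebesgue_measure R `]0, T[%classic.
  have h0 : 0 <= fine (@lebesgue_measure R `]0, T[%classic).
    by rewrite fine_ge0.
  exists (NngNum h0) => /=; rewrite fineK//.
  by rewrite lebesgue_measure_itv/=; case: ifP.
pose g (x : 'rV[R]_d) := (`|(w x)%:E| `^ 2)%E.
have mg : measurable_fun setT g.
  apply: (measurableT_comp (measurable_poweR 2)).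
  by apply/measurableT_comp => //; exact/measurable_EFinP.
have <- : (\int[pushforward (cyl_measure T Omega) snd]_x g x =
    \int[cyl_measure T Omega]_x `|(time_ext_fun x)%:E| `^ 2)%E.
  rewrite (ge0_integral_pushforward measurable_snd)//=.
  by move=> x _; exact: poweR_ge0.
rewrite (eq_measure_integral (mscale c (dom_measure Omega))); last first.
  move=> A mA _; rewrite /pushforward /cyl_measure /= /mrestr.
  transitivity ((@lebesgue_measure R \x lebesgue_rV R d)%E
      (`]0, T[%classic `*` (A `&` Omega))).
    rewrite /pushforward; congr (product_measure1 _ _ _); apply/seteqP.
    by split=> [[t x] /= [? [? ?]]|[t x] /= [? [? ?]]].
  have mAO : measurable (A `&` Omega).
    by apply: measurableI => //; exact: measurable_dom.
  by rewrite product_measure1E// /= /mscale /= cE.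
rewrite ge0_integral_mscale//; last by move=> x _; exact: poweR_ge0.
rewrite lte_mul_pinfty ?lee_fin//.
have := Lfunction_finite _ w; rewrite /finite_norm unlock => /lty_poweRy.
by apply; rewrite invr_neq0.
Qed.

Definition time_ext : L2 (cyl_measure T Omega) := Lfun_Sub (lee1n 2) time_ext_Lfun.

End time_extension.

End spaces.

Section scheme.
Context (R : realType) (d : nat) (Omega : lipschitz_domain R d) (T : R).
Variable W : hspace (L2 (dom_measure Omega)).
Variables (f : L2 (cyl_measure T Omega) -> R)
  (f' : L2 (cyl_measure T Omega) -> L2 (cyl_measure T Omega)).
Variables (alpha beta gamma p : R).

Local Notation U := (L2 (cyl_measure T Omega)).
Local Notation ipU := (L2ip (cyl_measure T Omega)).
Local Notation normU := (L2norm (cyl_measure T Omega)).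

Definition feasible (u : U) (w : L2 (dom_measure Omega)) :=
  hcar W w /\ {ae cyl_measure T Omega, forall x, `|u x| <= time_ext T w x}.

Definition model (eps L : R) (uk : U) (wk : L2 (dom_measure Omega))
    (u : U) (w : L2 (dom_measure Omega)) : R :=
  ipU (f' uk) (u - uk) + alpha / 2 * normU u ^+ 2 +
  beta / 2 * hnorm W w ^+ 2 +
  gamma * \int[dom_measure Omega]_x
    (dpsi p eps (wk x ^+ 2) * (w x ^+ 2 - wk x ^+ 2)) +
  L / 2 * normU (u - uk) ^+ 2.

Definition solves (eps L : R) (uk : U) (wk : L2 (dom_measure Omega))
    (u : U) (w : L2 (dom_measure Omega)) :=
  feasible u w /\
  forall u' w', feasible u' w' -> model eps L uk wk u w <= model eps L uk wk u' w'.

Definition descent (L : R) (uk u : U) :=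
  f u <= f uk + ipU (f' uk) (u - uk) + L * normU (u - uk) ^+ 2.

Definition generated (b L : R) (eps : nat -> R) (u : nat -> U)
    (w : nat -> L2 (dom_measure Omega)) (Lk : nat -> R) :=
  feasible (u 0%N) (w 0%N) /\
  forall k, solves (eps k) (Lk k) (u k) (w k) (u k.+1) (w k.+1) /\
    descent (Lk k) (u k) (u k.+1) /\
    exists l : nat, Lk k = L * b ^+ l /\
      forall m u' w', (m < l)%N ->
        solves (eps k) (L * b ^+ m) (u k) (w k) u' w' ->
        ~ descent (L * b ^+ m) (u k) u'.

End scheme.

(* Main.v *)
From HB Require Import structures.
Require Import Defs.
From mathcomp Require Import all_boot all_order all_algebra.
From mathcomp Require Import all_classical all_reals all_analysis.
From mathcomp Require Import measurable_realfun ring lra.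
Set Implicit Arguments.
Unset Strict Implicit.
Unset Printing Implicit Defensive.
Import Order.TTheory GRing.Theory Num.Theory.
Import numFieldNormedType.Exports.
Local Open Scope classical_set_scope.
Local Open Scope ring_scope.

(** Let G = f'(ubar) + alpha ubar. The multipliers can be written down explicitly once two facts
    about the weak limit are known: G ubar = -|G| wbar almost everywhere, and (G, ubar) + beta
    |wbar|_W^2 + gamma p int |wbar|^p <= 0. Take mu1 = min(G, 0) and mu2 = -max(G, 0), so that mu1 -
    mu2 = G and mu1 + mu2 = -|G|, and let the first equation define lambda. The first fact then
    gives the two subdifferential inclusions, and both facts together give the bound on lambda(wbar)
    ([limit_stationary]).

    Both facts come from the optimality conditions of the subproblems. The function t |-> t^(p/2) is
    concave and its smoothing is a minimum of tangents ([tangent_min]), so the linearised penalty of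
    a step majorises the change of the smoothed penalty, even when eps decreases. Combined with the
    strong convexity of the subproblem and the backtracking test, this makes a merit function
    decrease by a multiple of the squared step ([merit_descent]). Since f has an affine minorant,
    the merit function is coercive: the iterates are bounded and the steps tend to zero. A rejected
    trial constant lies below a Lipschitz constant of f' on a fixed ball, so the numbers L_k are
    bounded ([Lk_bounded]) and the proximal term disappears in the limit.

    The admissible set is a cone, so testing optimality with zero and with twice the solution gives
    an energy identity for every step ([solution_energy]). Its terms pass to the limit as follows
    ([limit_conditions]): f'(u_k) converges strongly, the squared norms are weakly lower
    semicontinuous, and the penalty is handled by Fatou's lemma. The identity for G follows by
    varying only the first component.

    The space W enters through [good_space]: a semi-inner product, an embedding into L2,
    completeness, and an almost everywhere convergent subsequence for bounded weakly convergent
    sequences. For Gagliardo norms the last property is proved by averaging over small cubes: the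
    value at a point is controlled by a local average, which tends to zero for weakly null
    sequences, and by an oscillation, which the Gagliardo energy makes uniformly small well inside
    Omega ([local_cvg], [gagliardo_compact]). The closure of the test functions inherits these
    properties once test functions are known to have finite energy ([test_fun_Hs]); this is a
    geometric sum over dyadic shells, each bounded through the gradient ([gradient_energy_le]). The
    same gradient bound, applied to Dirichlet eigenfunctions, shows that the eigenvalues are bounded
    away from zero and tend to infinity ([eigenvalue_gt0], [eigenvalue_unbounded]), which settles
    the spectral space. *)

Lemma cvg0_le (R : realType) (f g : nat -> R) :
  (forall n, `|f n| <= g n) -> g n @[n --> \oo] --> (0 : R) ->
  f n @[n --> \oo] --> (0 : R).
Proof.
move=> fg g0; have gN0 : - g n @[n --> \oo] --> (0 : R).
  by rewrite -[X in _ --> X]oppr0; exact: cvgN.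
by apply: squeeze_cvgr gN0 g0; near=> n; rewrite -ler_norml.
Unshelve. all: by end_near. Qed.

(** * Semi-inner-product spaces carried by a subset of a vector space *)

Section prehilbert.
Context (R : realType) (V : lmodType R).

(** Only semidefinite: the vectors are functions rather than classes, so nonzero vectors may have
    norm zero. *)
Record prehilbert (H : hspace V) : Prop := Prehilbert {
  ph0 : hcar H 0 ;
  ph_lin : forall a x y, hcar H x -> hcar H y -> hcar H (a *: x + y) ;
  phC : forall x y, hcar H x -> hcar H y -> hip H x y = hip H y x ;
  ph_linl : forall a x y z, hcar H x -> hcar H y -> hcar H z ->
    hip H (a *: x + y) z = a * hip H x z + hip H y z ;
  ph_ge0 : forall x, hcar H x -> 0 <= hip H x x }.

Context (H : hspace V) (pH : prehilbert H).
Local Notation ip := (hip H).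
Local Notation car := (hcar H).

Lemma phZ a x : car x -> car (a *: x).
Proof. by move=> cx; rewrite -[_ *: _]addr0; exact/ph_lin/(ph0 pH). Qed.

Lemma phD x y : car x -> car y -> car (x + y).
Proof. by move=> cx cy; rewrite -[x]scale1r; exact: ph_lin. Qed.

Lemma phN x : car x -> car (- x).
Proof. by move=> cx; rewrite -scaleN1r; exact: phZ. Qed.

Lemma phB x y : car x -> car y -> car (x - y).
Proof. by move=> cx cy; apply: phD => //; exact: phN. Qed.

Lemma phDl x y z : car x -> car y -> car z -> ip (x + y) z = ip x z + ip y z.
Proof.
move=> cx cy cz; rewrite -[x in LHS]scale1r ph_linl//; by rewrite mul1r.
Qed.

Lemma ph0l z : car z -> ip 0 z = 0.
Proof.
move=> cz; have := phDl (ph0 pH) (ph0 pH) cz.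
by rewrite addr0 => /eqP; rewrite -subr_eq0 opprD addrA subrr sub0r oppr_eq0 => /eqP.
Qed.

Lemma phZl a x z : car x -> car z -> ip (a *: x) z = a * ip x z.
Proof.
move=> cx cz; have := ph_linl pH a cx (ph0 pH) cz.
by rewrite addr0 ph0l// addr0.
Qed.

Lemma phNl x z : car x -> car z -> ip (- x) z = - ip x z.
Proof. by move=> cx cz; rewrite -scaleN1r phZl// mulN1r. Qed.

Lemma phBl x y z : car x -> car y -> car z -> ip (x - y) z = ip x z - ip y z.
Proof. by move=> cx cy cz; rewrite phDl ?phNl//; exact: phN. Qed.

Lemma phDr x y z : car x -> car y -> car z -> ip z (x + y) = ip z x + ip z y.
Proof. by move=> cx cy cz; rewrite phC ?phDl ?(phC pH _ cz)//; exact: phD. Qed.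

Lemma phZr a x z : car x -> car z -> ip z (a *: x) = a * ip z x.
Proof. by move=> cx cz; rewrite phC ?phZl ?(phC pH _ cz)//; exact: phZ. Qed.

Lemma phBr x y z : car x -> car y -> car z -> ip z (x - y) = ip z x - ip z y.
Proof. by move=> cx cy cz; rewrite phC ?phBl ?(phC pH _ cz)//; exact: phB. Qed.

Lemma ph_sqrD x y : car x -> car y ->
  ip (x + y) (x + y) = ip x x + 2 * ip x y + ip y y.
Proof.
move=> cx cy; have cxy := phD cx cy.
by rewrite phDl// !phDr// (phC pH cy cx); ring.
Qed.

Lemma ph_sqrB x y : car x -> car y ->
  ip (x - y) (x - y) = ip x x - 2 * ip x y + ip y y.
Proof.
move=> cx cy; have cxy := phB cx cy.
by rewrite phBl// !phBr// (phC pH cy cx); ring.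
Qed.

Lemma ph_norm_ge0 x : 0 <= hnorm H x.
Proof. exact: sqrtr_ge0. Qed.

Lemma ph_norm_sqr x : car x -> hnorm H x ^+ 2 = ip x x.
Proof. by move=> cx; rewrite sqr_sqrtr//; exact: ph_ge0. Qed.

Lemma ph_CS x y : car x -> car y -> `|ip x y| <= hnorm H x * hnorm H y.
Proof.
move=> cx cy; set a := hnorm H x; set b := hnorm H y.
have a0 : 0 <= a := ph_norm_ge0 x; have b0 : 0 <= b := ph_norm_ge0 y.
suff : ip x y ^+ 2 <= (a * b) ^+ 2.
  by rewrite -(@ler_sqr _ `|_|) ?nnegrE ?mulr_ge0// -normrX ger0_norm// sqr_ge0.
have key t : 0 <= a ^+ 2 - 2 * t * ip x y + t ^+ 2 * b ^+ 2.
  have := ph_ge0 pH (phB cx (phZ t cy)).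
  rewrite ph_sqrB ?phZr ?phZl//; try exact: phZ.
  by rewrite -!ph_norm_sqr// -/a -/b; congr (_ <= _); ring.
have [b0'|bN0] := eqVneq b 0.
  rewrite b0' mulr0 expr0n/=.
  (* A vector of norm zero need not vanish. The quadratic in [key] is then affine in t, and this t
     gives it the value -1 unless the product is zero. *)
  have := key ((a ^+ 2 + 1) / (2 * ip x y)).
  have [->|nz] := eqVneq (ip x y) 0; first by rewrite expr0n.
  rewrite b0' expr0n/= mulr0 addr0 (_ : 2 * _ * _ = a ^+ 2 + 1); last by field.
  by rewrite opprD addrA subrr sub0r oppr_ge0 ler10.
have bp : 0 < b ^+ 2 by rewrite exprn_gt0// lt_neqAle eq_sym bN0.
have := key (ip x y / b ^+ 2).
rewrite (_ : _ + _ = a ^+ 2 - ip x y ^+ 2 / b ^+ 2); last by field.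
by rewrite subr_ge0 ler_pdivrMr// exprMn.
Qed.

Lemma ph_normD x y : car x -> car y -> hnorm H (x + y) <= hnorm H x + hnorm H y.
Proof.
move=> cx cy.
rewrite -ler_sqr ?nnegrE ?addr_ge0 ?ph_norm_ge0// ph_norm_sqr ?ph_sqrD//; last exact: phD.
rewrite sqrrD !ph_norm_sqr// lerD2r lerD2l -[leRHS]mulr_natl ler_pM2l//.
exact: le_trans (ler_norm _) (ph_CS cx cy).
Qed.

Lemma ph_normZ a x : car x -> hnorm H (a *: x) = `|a| * hnorm H x.
Proof.
move=> cx; rewrite /hnorm phZl ?phZr//; last exact: phZ.
by rewrite mulrA -expr2 sqrtrM ?sqr_ge0// sqrtr_sqr.
Qed.

Lemma ph_normN x : car x -> hnorm H (- x) = hnorm H x.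
Proof. by move=> cx; rewrite -scaleN1r ph_normZ// normrN1 mul1r. Qed.

Lemma ph_normB x y : car x -> car y -> hnorm H (x - y) <= hnorm H x + hnorm H y.
Proof. by move=> cx cy; rewrite -(ph_normN cy); apply/ph_normD/phN. Qed.

Lemma ph_norm_distC x y : car x -> car y -> hnorm H (x - y) = hnorm H (y - x).
Proof. by move=> cx cy; rewrite -opprB ph_normN//; exact: phB. Qed.

Lemma in_dual_ip y : car y -> in_dual H (hip H y).
Proof.
move=> cy; split=> [a x z cx cz|].
  by rewrite phDr ?phZr//; exact: phZ.
by exists (hnorm H y) => x cx; exact: ph_CS.
Qed.

Lemma in_dual0 l : in_dual H l -> l 0 = 0.
Proof.
move=> [llin _]; have := llin 1 0 0 (ph0 pH) (ph0 pH).
by rewrite scale1r addr0 mul1r => /eqP; rewrite -subr_eq0 opprD addrA subrr sub0r oppr_eq0 => /eqP.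
Qed.

Lemma in_dualB l x y : in_dual H l -> car x -> car y -> l (x - y) = l x - l y.
Proof.
move=> [llin _] cx cy; rewrite -scaleN1r addrC llin// mulN1r addrC //.
Qed.

(* Weak limits survive a perturbation that tends to zero in norm. *)
Lemma dual_cvg_perturb l (x_ y_ : nat -> V) (c : R) : in_dual H l ->
  (forall n, car (x_ n)) -> (forall n, car (y_ n)) ->
  l (x_ n) @[n --> \oo] --> c -> hnorm H (y_ n - x_ n) @[n --> \oo] --> (0 : R) ->
  l (y_ n) @[n --> \oo] --> c.
Proof.
move=> ld cx cy xc yx0; have [llin [M lM]] := ld.
have : l (y_ n - x_ n) @[n --> \oo] --> (0 : R).
  have cM : M * hnorm H (y_ n - x_ n) @[n --> \oo] --> (0 : R).
    by rewrite -[X in _ --> X](mulr0 M); exact: cvgMl_tmp.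
  by apply: cvg0_le cM => n; rewrite lM//; exact: phB.
move=> h; rewrite -[c]add0r (_ : (fun n => l (y_ n)) =
    (fun n => l (y_ n - x_ n) + l (x_ n))); first exact: cvgD.
by apply/funext => n; rewrite (in_dualB ld)// subrK.
Qed.

End prehilbert.

(** * Lower limits of sequences of extended reals *)

Section limn_einf.
Context (R : realType).
Local Open Scope ereal_scope.

Lemma le_limn_einf (u v : (\bar R)^nat) : (forall n, u n <= v n) ->
  limn_einf u <= limn_einf v.
Proof.
move=> uv; rewrite !limn_einf_lim; apply: lee_lim.
- exact: is_cvg_einfs.
- exact: is_cvg_einfs.
near=> n; apply: le_ereal_inf_tmp => _ [k /= nk <-].
by apply: le_trans (uv k); apply: ereal_inf_lbound; exists k.
Unshelve. all: by end_near. Qed.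

Lemma measurable_fun_limn_einf d (T : measurableType d) (D : set T)
    (f : (T -> \bar R)^nat) :
  (forall n, measurable_fun D (f n)) ->
  measurable_fun D (fun x => limn_einf (f ^~ x)).
Proof.
move=> mf; rewrite (_ : (fun _ => _) =
    (fun x => - limn_esup (fun n => - f n x))); last first.
  apply/funext => x; rewrite -limn_einfN; congr limn_einf.
  by apply/funext => n /=; rewrite oppeK.
apply: measurableT_comp => //.
by apply: measurable_fun_limn_esup => n; exact: measurableT_comp.
Qed.

Lemma limn_einf_EFin (u : R^nat) (l : R) : u n @[n --> \oo] --> l ->
  limn_einf (fun n => (u n)%:E) = l%:E.
Proof.
move=> ul; apply: (cvg_limn_einf_sup _).1.
by apply/fine_cvgP; split => //; near=> n.
Unshelve. all: by end_near. Qed.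

End limn_einf.

(** * Square-integrable functions as a semi-inner-product space *)

Section sqr_integral.
Context (R : realType) disp (X : measurableType disp).
Variable mu : {measure set X -> \bar R}.
Implicit Types f g : X -> R.

(** The squared norm with values in the extended reals. Unlike [L2norm], whose integral is real
    valued, it tells an infinite norm from zero, so it can express membership in L2. *)
Definition sqint f : \bar R := (\int[mu]_x (f x ^+ 2)%:E)%E.

Lemma measurable_EFin_sqr f : measurable_fun setT f ->
  measurable_fun setT (fun x => (f x ^+ 2)%:E).
Proof. by move=> mf; apply/measurable_EFinP; exact: measurable_funX. Qed.

Lemma sqint_ge0 f : (0 <= sqint f)%E.
Proof. by apply: integral_ge0 => x _; rewrite lee_fin sqr_ge0. Qed.

Lemma Lfun2P f : f \in Lfun mu 2%:E <->
  measurable_fun setT f /\ (sqint f < +oo)%E.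
Proof.
split=> [fL|[mf foo]].
  have /integrableP[_ ifoo] := Lfun2_integrable_sqr fL; split.
    by move: fL; rewrite inE => /andP[]; rewrite inE.
  apply: le_lt_trans ifoo; rewrite /sqint.
  by under [leRHS]eq_integral => x _ do rewrite /= ger0_norm ?sqr_ge0//.
rewrite inE; apply/andP; split; first by rewrite inE.
rewrite inE/= /finite_norm unlock poweR_lty//.
rewrite (eq_integral (fun x => (f x ^+ 2)%:E))// => x _ /=.
by rewrite powR_mulrn// real_normK ?num_real.
Qed.

Lemma Lfun2_measurable f : f \in Lfun mu 2%:E -> measurable_fun setT f.
Proof. by move=> /Lfun2P[]. Qed.

Lemma le_sqint f g : measurable_fun setT f -> measurable_fun setT g ->
  (forall x, `|f x| <= `|g x|) -> (sqint f <= sqint g)%E.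
Proof.
move=> mf mg fg; apply: ge0_le_integral => //.
- by move=> x _; rewrite lee_fin sqr_ge0.
- exact: measurable_EFin_sqr.
- exact: measurable_EFin_sqr.
by move=> x _; rewrite lee_fin -(@real_normK _ (f x)) ?num_real// -(@real_normK _ (g x)) ?num_real// ler_sqr ?nnegrE.
Qed.

Lemma Lfun2_le f g : measurable_fun setT f -> g \in Lfun mu 2%:E ->
  (forall x, `|f x| <= `|g x|) -> f \in Lfun mu 2%:E.
Proof.
move=> mf /Lfun2P[mg goo] fg; apply/Lfun2P; split=> //.
exact: le_lt_trans (le_sqint mf mg fg) goo.
Qed.

Lemma Lfun2M_integrable f g : f \in Lfun mu 2%:E -> g \in Lfun mu 2%:E ->
  mu.-integrable setT (fun x => (f x * g x)%:E).
Proof. by move=> fL gL; have /Lfun1_integrable := Lfun2_mul_Lfun1 fL gL. Qed.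

Lemma L2ip_sqint f : f \in Lfun mu 2%:E -> (L2ip mu f f)%:E = sqint f.
Proof.
move=> /Lfun2P[mf foo]; rewrite /L2ip /Rintegral.
rewrite (_ : (\int[mu]_x (f x * f x)%:E)%E = sqint f).
  by rewrite fineK// ge0_fin_numE// sqint_ge0.
by apply: eq_integral => x _; rewrite -expr2.
Qed.

Lemma L2_prehilbert : prehilbert (L2_hspace mu).
Proof.
split => //=.
- by move=> x y _ _; apply: eq_Rintegral => t _; rewrite mulrC.
- move=> a x y z _ _ _; rewrite /L2ip.
  rewrite -RintegralZl//; last exact: (Lfun2M_integrable (LfunP x) (LfunP z)).
  rewrite -RintegralD//.
  + apply: eq_Rintegral => t _ /=.
    by transitivity ((a * x t + y t) * z t) => //; rewrite mulrDl mulrA.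
  + rewrite (_ : _ \o _ = (fun t => ((a *: x) t * z t)%:E)).
      exact: (Lfun2M_integrable (LfunP (a *: x)) (LfunP z)).
    by apply/funext => t /=; rewrite mulrA.
  + exact: (Lfun2M_integrable (LfunP y) (LfunP z)).
- by move=> x _; apply: Rintegral_ge0 => t _; rewrite -expr2 sqr_ge0.
Qed.

Lemma L2norm_sqr (u : L2 mu) : L2norm mu u ^+ 2 = L2ip mu u u.
Proof. exact: (ph_norm_sqr L2_prehilbert (x := u) I). Qed.

Section L2_algebra.
Implicit Types u v w : L2 mu.
Let pL := L2_prehilbert.

Lemma L2ipC u v : L2ip mu u v = L2ip mu v u.
Proof. exact: (phC pL (x := u) (y := v) I I). Qed.

Lemma L2ipDl u v w : L2ip mu (u + v) w = L2ip mu u w + L2ip mu v w.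
Proof. exact: (phDl pL (x := u) (y := v) (z := w) I I I). Qed.

Lemma L2ipBl u v w : L2ip mu (u - v) w = L2ip mu u w - L2ip mu v w.
Proof. exact: (phBl pL (x := u) (y := v) (z := w) I I I). Qed.

Lemma L2ipZl a u w : L2ip mu (a *: u) w = a * L2ip mu u w.
Proof. exact: (phZl pL a (x := u) (z := w) I I). Qed.

Lemma L2ipDr u v w : L2ip mu w (u + v) = L2ip mu w u + L2ip mu w v.
Proof. exact: (phDr pL (x := u) (y := v) (z := w) I I I). Qed.

Lemma L2ipBr u v w : L2ip mu w (u - v) = L2ip mu w u - L2ip mu w v.
Proof. exact: (phBr pL (x := u) (y := v) (z := w) I I I). Qed.

Lemma L2ipZr a u w : L2ip mu w (a *: u) = a * L2ip mu w u.
Proof. exact: (phZr pL a (x := u) (z := w) I I). Qed.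

Lemma L2_CS u v : `|L2ip mu u v| <= L2norm mu u * L2norm mu v.
Proof. exact: (ph_CS pL (x := u) (y := v) I I). Qed.

Lemma L2normD u v : L2norm mu (u + v) <= L2norm mu u + L2norm mu v.
Proof. exact: (ph_normD pL (x := u) (y := v) I I). Qed.

Lemma L2normB u v : L2norm mu (u - v) <= L2norm mu u + L2norm mu v.
Proof. exact: (ph_normB pL (x := u) (y := v) I I). Qed.

Lemma L2normZ a u : L2norm mu (a *: u) = `|a| * L2norm mu u.
Proof. exact: (ph_normZ pL a (x := u) I). Qed.

Lemma L2norm_distC u v : L2norm mu (u - v) = L2norm mu (v - u).
Proof. exact: (ph_norm_distC pL (x := u) (y := v) I I). Qed.

Lemma L2_sqrB u v : L2ip mu (u - v) (u - v) =
  L2ip mu u u - 2 * L2ip mu u v + L2ip mu v v.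
Proof. exact: (ph_sqrB pL (x := u) (y := v) I I). Qed.

Lemma L2_in_dual u : in_dual (L2_hspace mu) (L2ip mu u).
Proof. exact: (in_dual_ip pL (y := u) I). Qed.

End L2_algebra.

Lemma L2norm_sqint (u : L2 mu) : (L2norm mu u ^+ 2)%:E = sqint u.
Proof. by rewrite L2norm_sqr L2ip_sqint// LfunP. Qed.

Lemma L2norm_ge0 (f : X -> R) : 0 <= L2norm mu f.
Proof. exact: sqrtr_ge0. Qed.

Lemma sqint_leP (u : L2 mu) (c : R) : 0 <= c ->
  (sqint u <= (c ^+ 2)%:E)%E -> L2norm mu u <= c.
Proof.
by move=> c0; rewrite -L2norm_sqint lee_fin ler_sqr ?nnegrE ?L2norm_ge0.
Qed.

Lemma L2norm_le_sqint (u : L2 mu) (c : R) : L2norm mu u <= c ->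
  (sqint u <= (c ^+ 2)%:E)%E.
Proof.
move=> uc; rewrite -L2norm_sqint lee_fin ler_sqr ?nnegrE ?L2norm_ge0//.
exact: le_trans (L2norm_ge0 _) uc.
Qed.

(** Fatou's lemma for a convergent sequence of bounds: [G] agrees almost everywhere with the lower
    limit of the [F n]. *)
Lemma fatou_cvg (F : nat -> X -> R) (G : X -> R) (c_ : nat -> R) (c : R) :
  (forall n, measurable_fun setT (F n)) -> measurable_fun setT G ->
  (forall n x, 0 <= F n x) -> (forall x, 0 <= G x) ->
  {ae mu, forall x, F n x @[n --> \oo] --> G x} ->
  (forall n, (\int[mu]_x (F n x)%:E <= (c_ n)%:E)%E) ->
  c_ n @[n --> \oo] --> c -> (\int[mu]_x (G x)%:E <= c%:E)%E.
Proof.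
move=> mF mG F0 G0 FG Fc cc.
have -> : (\int[mu]_x (G x)%:E = \int[mu]_x limn_einf (fun n => (F n x)%:E))%E.
  apply: ge0_ae_eq_integral => //.
  - exact/measurable_EFinP.
  - by apply: measurable_fun_limn_einf => n; exact/measurable_EFinP.
  - by move=> x _; rewrite lee_fin.
  - move=> x _; rewrite -[leLHS](limn_einf_EFin (u := fun=> 0) (cvg_cst _)).
    by apply: le_limn_einf => n; rewrite lee_fin.
  - by apply: filterS FG => x Fx _; rewrite (limn_einf_EFin Fx).
apply: (le_trans (fatou mu measurableT _ _)).
- by move=> n; exact/measurable_EFinP.
- by move=> n x _; rewrite lee_fin.
by rewrite -(limn_einf_EFin cc); exact: le_limn_einf.
Qed.

End sqr_integral.

(** * Extraction of subsequences and almost everywhere convergence *)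

Lemma subseq_choice (P : nat -> nat -> Prop) :
  (forall k, exists N, forall n, (N <= n)%N -> P k n) ->
  exists2 s : nat -> nat, {homo s : m n / (m < n)%N} & forall k, P k (s k).
Proof.
move=> /choice[N PN].
pose s := fix s k := if k is k'.+1 then maxn (N k) (s k').+1 else N 0%N.
exists s => [|[|k]]; [|exact: PN|by apply: PN; rewrite leq_maxl].
by apply: homo_ltn; [exact: ltn_trans|move=> n /=; rewrite leq_maxr].
Qed.

Lemma homo_ltn_ge (s : nat -> nat) : {homo s : m n / (m < n)%N} ->
  forall n, (n <= s n)%N.
Proof. by move=> hs; elim=> // n ih; exact: leq_ltn_trans ih (hs _ _ (ltnSn n)). Qed.

Lemma cvg_subseq (T : topologicalType) (u : nat -> T) (l : T) (s : nat -> nat) :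
  {homo s : m n / (m < n)%N} -> u n @[n --> \oo] --> l ->
  u (s n) @[n --> \oo] --> l.
Proof.
move=> hs ul; apply: (cvg_comp s u _ ul) => A [N _ NA].
by exists N => // n /= Nn; apply: NA => /=; exact: leq_trans Nn (homo_ltn_ge hs n).
Qed.

Section ae_convergence.
Context (R : realType) disp (X : measurableType disp).
Variable mu : {measure set X -> \bar R}.

(** Summation and integration commute for nonnegative terms, so the sum of the squares has a finite
    integral and is finite almost everywhere. *)
Lemma ae_summable (f_ : nat -> X -> R) : (forall n, measurable_fun setT (f_ n)) ->
  (\sum_(0 <= n <oo) sqint mu (f_ n) < +oo)%E ->
  {ae mu, forall x, cvgn (series (fun n => f_ n x ^+ 2))}.
Proof.
move=> mf; rewrite -integral_nneseries//; last 2 first.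
- by move=> n; exact: measurable_EFin_sqr.
- by move=> n x _; rewrite lee_fin sqr_ge0.
move=> foo.
have mS : measurable_fun setT (fun x => \sum_(0 <= n <oo) (f_ n x ^+ 2)%:E)%E.
  apply: ge0_emeasurable_sum => //.
    by move=> n x _ _; rewrite lee_fin sqr_ge0.
  by move=> n _; exact: measurable_EFin_sqr.
have /(integrable_ae measurableT) : mu.-integrable setT
    (fun x => \sum_(0 <= n <oo) (f_ n x ^+ 2)%:E)%E.
  apply/integrableP; split => //; apply: le_lt_trans foo.
  apply: ge0_le_integral => //; first exact: measurableT_comp.
  move=> x _; rewrite gee0_abs//; apply: nneseries_ge0 => n _ _.
  by rewrite lee_fin sqr_ge0.
apply: filterS => x /(_ I); rewrite fin_numElt => /andP[_ xoo].
by apply: nnseries_is_cvg => // n; rewrite sqr_ge0.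
Qed.

Lemma ae_summable_cvg0 (f_ : nat -> X -> R) :
  (forall n, measurable_fun setT (f_ n)) ->
  (\sum_(0 <= n <oo) sqint mu (f_ n) < +oo)%E ->
  {ae mu, forall x, f_ n x @[n --> \oo] --> (0 : R)}.
Proof.
move=> mf /(ae_summable mf); apply: filterS => x /cvg_series_cvg_0 h.
apply/cvgr0Pnorm_lt => e e0; have e20 : 0 < e ^+ 2 by rewrite exprn_gt0.
move/cvgr0Pnorm_lt : h => /(_ _ e20); apply: filterS => n.
by rewrite normrX ltr_sqr ?nnegrE// ltW.
Qed.

(** Choose s k so that the squared norm of f_(s k) on K k is at most 2^-(k+1); these are summable,
    so the truncated functions tend to zero almost everywhere. At a point lying in every K k from
    some index on, the truncation eventually does nothing. *)
Lemma ae_subseq (f_ : nat -> X -> R) (K : nat -> set X) :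
  (forall n, measurable_fun setT (f_ n)) -> (forall m, measurable (K m)) ->
  (forall m (e : R), 0 < e -> exists N, forall n, (N <= n)%N ->
    (sqint mu (fun x => f_ n x * \1_(K m) x)%R <= e%:E)%E) ->
  exists2 s : nat -> nat, {homo s : m n / (m < n)%N} &
    {ae mu, forall x, (exists m, forall k, (m <= k)%N -> K k x) ->
      f_ (s k) x @[k --> \oo] --> (0 : R)}.
Proof.
move=> mf mK fK.
have [k|s hs sP] := @subseq_choice (fun k n =>
    (sqint mu (fun x => f_ n x * \1_(K k) x)%R
     <= (1 / (2 ^ k.+1)%:R)%:E)%E).
  by apply: fK; rewrite divr_gt0// ltr0n expn_gt0.
exists s => //.
have : {ae mu, forall x, f_ (s k) x * \1_(K k) x @[k --> \oo] --> (0 : R)}.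
  apply: ae_summable_cvg0 => [n|].
    by apply: measurable_funM => //; exact: measurable_indic.
  apply: (@le_lt_trans _ _ (\sum_(0 <= k <oo) (1 / (2 ^ k.+1)%:R)%:E)%E).
    by apply: lee_nneseries => k _; [move=> _; exact: sqint_ge0|exact: sP].
  by apply: le_lt_trans (epsilon_trick0 xpredT _) (ltry _).
apply: filterS => x fx [m mK'].
apply: cvg_trans fx; apply: near_eq_cvg; near=> k.
have mk : (m <= k)%N by near: k; exists m.
by rewrite indicE mem_set ?mulr1//; exact: mK'.
Unshelve. all: by end_near. Qed.

Lemma L2_cvg_ae_subseq (u_ : nat -> L2 mu) (u : L2 mu) :
  L2norm mu (u_ n - u) @[n --> \oo] --> (0 : R) ->
  exists2 s : nat -> nat, {homo s : m n / (m < n)%N} &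
    {ae mu, forall x, u_ (s k) x @[k --> \oo] --> u x}.
Proof.
move=> uu.
have [|||s hs sP] := @ae_subseq (fun n x => u_ n x - u x) (fun=> setT).
- by move=> n; exact: measurable_funB.
- by [].
- move=> _ e e0; have se0 : 0 < Num.sqrt e by rewrite sqrtr_gt0.
  move/cvgr0Pnorm_lt : uu => /(_ _ se0)[N _ NP]; exists N => n Nn.
  rewrite (_ : (fun x => _) = (u_ n - u : X -> R)); last first.
    by apply/funext => x; rewrite indicT mulr1.
  rewrite -[e]sqr_sqrtr ?(ltW e0)//; apply: L2norm_le_sqint.
  by have /ltW := NP n Nn; rewrite ger0_norm// L2norm_ge0.
exists s => //; apply: filterS sP => x sx; apply/subr_cvg0; apply: sx.
by exists 0%N.
Qed.

End ae_convergence.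

Lemma sqr_cvg0 (R : realType) (u : nat -> R) :
  u n ^+ 2 @[n --> \oo] --> (0 : R) -> u n @[n --> \oo] --> (0 : R).
Proof.
move=> h; apply/cvgr0Pnorm_lt => e e0; have e20 : 0 < e ^+ 2 by rewrite exprn_gt0.
move/cvgr0Pnorm_lt : h => /(_ _ e20); apply: filterS => n.
by rewrite normrX ltr_sqr ?nnegrE// ltW.
Qed.

(** * Positivity, dominated convergence and completeness in L2 *)

Section L2_convergence.
Context (R : realType) disp (X : measurableType disp).
Variable mu : {measure set X -> \bar R}.

Lemma ae_eq0_sqint (f : X -> R) : measurable_fun setT f -> sqint mu f = 0%E ->
  {ae mu, forall x, f x = 0}.
Proof.
move=> mf f0; have /(ae_eq_integral_abs mu measurableT) :
    measurable_fun setT (fun x => (f x ^+ 2)%:E) by exact: measurable_EFin_sqr.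
case=> + _; rewrite -[X in X = _ -> _](_ : sqint mu f = _); last first.
  by apply: eq_integral => x _; rewrite gee0_abs// lee_fin sqr_ge0.
move=> /(_ f0); apply: filterS => x /(_ I)/= [] /eqP.
by rewrite sqrf_eq0 => /eqP.
Qed.

Lemma ae_eq_sqint (f g : X -> R) : measurable_fun setT f -> measurable_fun setT g ->
  {ae mu, forall x, f x = g x} -> sqint mu f = sqint mu g.
Proof.
move=> mf mg fg; apply: ge0_ae_eq_integral => //.
- exact: measurable_EFin_sqr.
- exact: measurable_EFin_sqr.
- by move=> x _; rewrite lee_fin sqr_ge0.
- by move=> x _; rewrite lee_fin sqr_ge0.
by apply: filterS fg => x -> _.
Qed.

(** Test with the negative part of [u]: the pairing equals minus its squared norm, which therefore
    vanishes. *)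
Lemma L2ip_test_ge0 (u : L2 mu) :
  (forall h : L2 mu, (forall x, 0 <= h x) -> 0 <= L2ip mu u h) ->
  {ae mu, forall x, 0 <= u x}.
Proof.
move=> uh; pose f x := Num.max (- u x) 0.
have mf : measurable_fun setT f.
  by apply: measurable_maxr => //; exact: measurable_funN.
have fu x : `|f x| <= `|u x|.
  rewrite /f /Num.max; case: ifPn => [|]; first by rewrite normr0.
  by rewrite normrN.
have fL := Lfun2_le mf (LfunP u) fu.
have /uh : forall x, 0 <= (Lfun_Sub (lee1n 2) fL) x.
  by move=> x /=; rewrite le_max lexx orbT.
rewrite (_ : L2ip mu u _ = - L2ip mu f f); last first.
  rewrite /L2ip -mulN1r -RintegralZl//; last exact: Lfun2M_integrable.
  apply: eq_Rintegral => x _ /=; rewrite /f /Num.max.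
  by case: ifPn => _; rewrite ?mulr0//; ring.
rewrite oppr_ge0 -lee_fin (L2ip_sqint fL) => f0.
have {}f0 : sqint mu f = 0%E by apply/eqP; rewrite eq_le f0 sqint_ge0.
apply: filterS (ae_eq0_sqint mf f0) => x; rewrite /f /Num.max.
by case: ifPn => [|_ /eqP]; [rewrite oppr_lt0 => /ltW|rewrite oppr_eq0 => /eqP->].
Qed.

Lemma le_L2ip (u v h : L2 mu) : (forall x, 0 <= h x) ->
  {ae mu, forall x, u x <= v x} -> L2ip mu u h <= L2ip mu v h.
Proof.
move=> h0 uv; rewrite -subr_ge0 -L2ipBl.
pose F x := Num.max ((v - u) x * h x) 0.
rewrite /= (_ : L2ip mu _ _ = \int[mu]_x F x).
  by apply: Rintegral_ge0 => x _; rewrite le_max lexx orbT.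
congr fine; apply: ae_eq_integral => //.
- by apply/measurable_EFinP; exact: measurable_funM.
- apply/measurable_EFinP; apply: measurable_maxr => //.
  exact: measurable_funM.
apply: filterS uv => x uvx _ /=; rewrite /F max_l// mulr_ge0//.
by rewrite -[X in _ <= X]/(v x - u x) subr_ge0.
Qed.

(** Dominated convergence applied to the squared differences, with majorant 4 g^2. *)
Lemma L2_dominated (v_ : nat -> L2 mu) (v : L2 mu) (g : X -> R) :
  g \in Lfun mu 2%:E ->
  {ae mu, forall x, v_ n x @[n --> \oo] --> v x} ->
  {ae mu, forall x n, `|v_ n x| <= `|g x|} ->
  {ae mu, forall x, `|v x| <= `|g x|} ->
  L2norm mu (v_ n - v) @[n --> \oo] --> (0 : R).
Proof.
move=> gL vv vg v'g; apply: sqr_cvg0.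
pose G x := (4 * g x ^+ 2)%:E.
have iG : mu.-integrable setT G.
  exact: (integrableZl measurableT 4 (Lfun2_integrable_sqr gL)).
pose F n x := ((v_ n x - v x) ^+ 2)%:E.
have mF n : measurable_fun setT (F n).
  by apply: measurable_EFin_sqr; exact: measurable_funB.
have F0 : {ae mu, forall x, setT x -> F n x @[n --> \oo] --> cst 0%E x}.
  apply: filterS vv => x vx _; apply/fine_cvgP; split; first by near=> n.
  have /= h : v_ n x - v x @[n --> \oo] --> (0 : R) by apply/subr_cvg0.
  rewrite (_ : _ \o _ = (fun n => (v_ n x - v x) * (v_ n x - v x))).
    by have := cvgM h h; rewrite mulr0; apply.
  by apply/funext => n; rewrite /= expr2.
have FG : {ae mu, forall x n, setT x -> (`|F n x| <= G x)%E}.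
  apply: filterS (filterI vg v'g) => x [vx v'x] n _.
  rewrite /G/= lee_fin normrX (_ : 4 * _ = (2 * `|g x|) ^+ 2); last first.
    by rewrite exprMn real_normK ?num_real//; ring.
  rewrite ler_sqr ?nnegrE ?mulr_ge0// (le_trans (ler_normB _ _))//.
  by rewrite mulrDl mul1r lerD.
have [_ _] := dominated_convergence measurableT mF
  (measurable_cst _ : measurable_fun setT (cst 0%E)) F0 iG FG.
rewrite integral0 => /fine_cvgP[_] h; apply: cvg_trans h; apply: near_eq_cvg; near=> n.
transitivity (fine (sqint mu (v_ n - v : L2 mu))) => //.
by rewrite -L2norm_sqint.
Unshelve. all: by end_near. Qed.

(** Riesz-Fischer. Along a subsequence with increments d_k of norm at most 2^-k, the series of 2^k
    d_k^2 has a finite integral, and |d_k| <= 2^k d_k^2 + 2^-k, so the increments are absolutely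
    summable almost everywhere. Fatou's lemma turns the pointwise limit into a limit in norm. *)
Lemma L2_cauchy_cvg (u_ : nat -> L2 mu) :
  (forall e : R, 0 < e -> exists N, forall m n, (N <= m)%N -> (N <= n)%N ->
     L2norm mu (u_ m - u_ n) <= e) ->
  exists u : L2 mu, L2norm mu (u_ n - u) @[n --> \oo] --> (0 : R).
Proof.
move=> cu.
have [k|s hs sP] := @subseq_choice (fun k N => forall m n, (N <= m)%N -> (N <= n)%N ->
     L2norm mu (u_ m - u_ n) <= (2 ^+ k)^-1).
  have [|N NP] := cu (2 ^+ k)^-1; first by rewrite invr_gt0 exprn_gt0.
  by exists N => n Nn i j ni nj; apply: NP; exact: leq_trans Nn _.
pose d k : X -> R := u_ (s k.+1) - u_ (s k).
have aed : {ae mu, forall x, cvgn (fun k => u_ (s k) x)}.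
  have : {ae mu, forall x,
      cvgn (series (fun k => (Num.sqrt (2 ^+ k) * d k x) ^+ 2))}.
    apply: ae_summable => [k|]; first exact: measurable_funM.
    apply: (@le_lt_trans _ _ (\sum_(0 <= k <oo) (2 / (2 ^ k.+1)%:R)%:E)%E); last first.
      by apply: le_lt_trans (epsilon_trick0 xpredT _) (ltry _).
    apply: lee_nneseries => k _; first by move=> _; exact: sqint_ge0.
    rewrite -[X in sqint mu X](_ : (Num.sqrt (2 ^+ k) *: (u_ (s k.+1) - u_ (s k)) : L2 mu)
      = _ :> (X -> R))//.
    rewrite -L2norm_sqint L2normZ.
    rewrite lee_fin exprMn real_normK ?num_real// sqr_sqrtr ?exprn_ge0//.
    have h : L2norm mu (u_ (s k.+1) - u_ (s k)) ^+ 2 <= ((2 ^+ k)^-1) ^+ 2.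
      rewrite ler_sqr ?nnegrE ?L2norm_ge0 ?invr_ge0 ?exprn_ge0//.
      by apply: sP => //; exact/ltnW/hs.
    apply: le_trans (ler_wpM2l (exprn_ge0 k (ler0n R 2)) h) _.
    rewrite expr2 mulrA divff ?mul1r ?expf_neq0// expnS natrM natrX.
    by rewrite invfM mulrA divff ?mul1r.
  apply: filterS => x cx.
  have : cvgn (series (fun k => u_ (s k.+1) x - u_ (s k) x)).
    apply: normed_cvg; apply: series_le_cvg
      (_ : cvgn (series (fun k => (Num.sqrt (2 ^+ k) * d k x) ^+ 2 + geometric 1 2^-1 k))).
    - by move=> k; exact: normr_ge0.
    - by move=> k; rewrite addr_ge0 ?sqr_ge0// /geometric/= mulr_ge0// exprn_ge0.
    - move=> k; rewrite -[leLHS]/(`|d k x|) exprMn sqr_sqrtr ?exprn_ge0//.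
      rewrite /geometric/= mul1r exprVn.
      set a : R := 2 ^+ k; have a0 : 0 < a by rewrite exprn_gt0.
      have := sqr_ge0 (`|d k x| * a - 1 / 2).
      rewrite -(@pmulr_rge0 _ a^-1) ?invr_gt0// -(real_normK (num_real (d k x))).
      rewrite (_ : _ * _ = a * `|d k x| ^+ 2 - `|d k x| + 1 / 4 / a); last by field; rewrite gt_eqF.
      have : 0 < a^-1 by rewrite invr_gt0.
      by nra.
    - rewrite seriesD; apply: is_cvgD => //; apply: is_cvg_geometric_series.
      by rewrite ger0_norm ?invr_ge0// invf_lt1// ltr1n.
  move=> c; have : cvgn (fun k => u_ (s 0%N) x + series (fun k => u_ (s k.+1) x - u_ (s k) x) k).
    by apply: is_cvgD => //; exact: is_cvg_cst.
  by under eq_fun do rewrite seriesEnat/= telescope_sumr// subrKC.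
(* The upper limit is measurable everywhere and equals the limit wherever that exists. *)
pose v x := fine (limn_esup (fun k => (u_ (s k) x)%:E)).
have mv : measurable_fun setT v.
  apply: (measurableT_comp (fine_measurable _)) => //.
  apply: measurable_fun_limn_esup => n; exact/measurable_EFinP.
have uv : {ae mu, forall x, u_ (s k) x @[k --> \oo] --> v x}.
  apply: filterS aed => x /cvg_ex[l /= ul]; rewrite /v.
  rewrite (cvg_limn_einf_sup (_ : _ --> l%:E)).2//.
  by apply/fine_cvgP; split => //; near=> n.
(* Fatou in the second index of the Cauchy condition; the shift by N keeps that index beyond N. *)
have vbound (e : R) N : 0 <= e -> (forall m n, (N <= m)%N -> (N <= n)%N ->
     L2norm mu (u_ m - u_ n) <= e) ->
     forall n, (N <= n)%N -> (sqint mu (fun x => u_ n x - v x)%R <= (e ^+ 2)%:E)%E.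
  move=> e0 NP n Nn.
  apply: (@fatou_cvg _ _ _ mu (fun k x => (u_ n x - u_ (s (k + N)%N) x) ^+ 2)
    (fun x => (u_ n x - v x) ^+ 2) (fun=> e ^+ 2)).
  - by move=> k; apply/measurable_funX/measurable_funB.
  - by apply/measurable_funX/measurable_funB.
  - by move=> *; rewrite sqr_ge0.
  - by move=> *; rewrite sqr_ge0.
  - apply: filterS uv => x ux.
    have ux' : u_ (s (k + N)%N) x @[k --> \oo] --> v x by rewrite (cvg_shiftn N (fun k => u_ (s k) x)).
    have h : u_ n x - u_ (s (k + N)%N) x @[k --> \oo] --> u_ n x - v x.
      by apply: cvgB => //; exact: cvg_cst.
    rewrite expr2 (_ : (fun k => _) =
      (fun k => (u_ n x - u_ (s (k + N)%N) x) * (u_ n x - u_ (s (k + N)%N) x))).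
      exact: cvgM.
    by apply/funext => k; rewrite expr2.
  - move=> k; rewrite -[X in (X <= _)%E]/(sqint mu (u_ n - u_ (s (k + N)%N) : L2 mu)).
    apply: L2norm_le_sqint; apply: NP => //.
    by rewrite (leq_trans _ (homo_ltn_ge hs _))// leq_addl.
  - exact: cvg_cst.
have vL : v \in Lfun mu 2%:E.
  have [N NP] := cu 1 ltr01.
  have wL : (fun x => u_ N x - v x) \in Lfun mu 2%:E.
    apply/Lfun2P; split; first exact: measurable_funB.
    exact: le_lt_trans (vbound _ _ ler01 NP _ (leqnn N)) (ltry _).
  rewrite (_ : v = u_ N - (Lfun_Sub (lee1n 2) wL : L2 mu) :> (X -> R)) ?LfunP//.
  by apply/funext => x; rewrite -[RHS]/(u_ N x - (u_ N x - v x)) subKr.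
pose V : L2 mu := Lfun_Sub (lee1n 2) vL.
exists V; apply/cvgr0Pnorm_le => e e0.
have [N NP] := cu e e0; exists N => // n /= Nn.
rewrite ger0_norm ?L2norm_ge0//.
exact: (@sqint_leP _ _ _ mu (u_ n - V) e (ltW e0) (vbound _ _ (ltW e0) NP _ Nn)).
Unshelve. all: by end_near. Qed.

End L2_convergence.

(** * Quadratic functionals on convex sets *)

Section convex_minimization.
Context (R : realType) (V : lmodType R) (H : hspace V) (pH : prehilbert H).
Variables (K : set V) (l : V -> R).
Hypothesis K_car : K `<=` hcar H.
Hypothesis K_convex : forall x y t, K x -> K y -> 0 <= t <= 1 ->
  K (x + t *: (y - x)).
Hypothesis l_dual : in_dual H l.
Local Notation ip := (hip H).
Local Notation car := (hcar H).

Definition quadratic_fun (x : V) : R := ip x x / 2 + l x.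
Local Notation J := quadratic_fun.

Lemma quadratic_fun_expand x h : car x -> car h ->
  J (x + h) = J x + (ip x h + l h) + ip h h / 2.
Proof.
move=> cx ch; rewrite /J ph_sqrD//.
have [llin _] := l_dual.
have := llin 1 x h cx ch; rewrite scale1r mul1r => ->.
by field.
Qed.

Lemma in_dualZ a h : car h -> l (a *: h) = a * l h.
Proof.
move=> ch; have [llin _] := l_dual.
have := llin a h 0 ch (ph0 pH).
by rewrite addr0 (in_dual0 pH l_dual) addr0.
Qed.

Lemma first_order_condition x : K x -> (forall y, K y -> J x <= J y) ->
  forall y, K y -> 0 <= ip x (y - x) + l (y - x).
Proof.
move=> Kx xmin y Ky; have cx := K_car Kx; have cy := K_car Ky.
have ch := phB pH cy cx; set A := _ + _; rewrite leNgt; apply/negP => A0.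
set B := ip (y - x) (y - x); have B0 : 0 <= B := ph_ge0 pH ch.
have key t : 0 <= t <= 1 -> 0 <= t * A + t ^+ 2 * B / 2.
  move=> t01; have := xmin _ (K_convex Kx Ky t01).
  rewrite quadratic_fun_expand//; last exact: phZ.
  rewrite phZr// in_dualZ// phZl ?phZr//; last exact: phZ.
  by rewrite -addrA lerDl -mulrDr -/A -/B mulrA -expr2.
(* Dividing by B - A rather than B keeps t in [0, 1] and covers B = 0; the increment becomes -(A^2 /
   (B - A)^2) (B / 2 - A) < 0. *)
pose t := - A / (B - A).
have BA : 0 < B - A by rewrite subr_gt0 (lt_le_trans A0).
have := key t; rewrite /t.
have -> : 0 <= - A / (B - A) <= 1.
  by rewrite divr_ge0 ?oppr_ge0 ?(ltW A0) ?(ltW BA)//= ler_pdivrMr// mul1r lerDr.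
move=> /(_ isT); rewrite (_ : _ + _ = - (A ^+ 2 / (B - A) ^+ 2) * (B / 2 - A)); last first.
  by field; rewrite gt_eqF.
apply/negP; rewrite -ltNge mulNr oppr_lt0 mulr_gt0//.
  by apply: divr_gt0; [rewrite exprn_even_gt0//= lt_eqF|exact: exprn_gt0].
by rewrite subr_gt0 (lt_le_trans A0)// divr_ge0.
Qed.

(** The second-order expansion at the minimiser is exact, and its linear term is nonnegative. This
    quadratic gap is the source of the sufficient decrease of the scheme. *)
Lemma minimizer_gap x : K x -> (forall y, K y -> J x <= J y) ->
  forall y, K y -> J x + ip (y - x) (y - x) / 2 <= J y.
Proof.
move=> Kx xmin y Ky; have cx := K_car Kx; have cy := K_car Ky.
rewrite -[y in leRHS](subrKC x) quadratic_fun_expand//; last exact: phB.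
by rewrite lerD2r lerDl; exact: first_order_condition.
Qed.

(** The direct method: a minimising sequence is Cauchy by the parallelogram identity. Completeness
    is asked only of sequences in [K], in the form in which the subproblem can supply it. *)
Lemma quadratic_fun_exists_min : K !=set0 ->
  (forall x_ : nat -> V, (forall n, K (x_ n)) ->
    (forall e : R, 0 < e -> exists N, forall m n, (N <= m)%N -> (N <= n)%N ->
       hnorm H (x_ m - x_ n) <= e) ->
    exists2 x, K x & hnorm H (x_ n - x) @[n --> \oo] --> (0 : R)) ->
  exists2 x, K x & forall y, K y -> J x <= J y.
Proof.
move=> [x0 Kx0] K_complete; have [llin [M lM]] := l_dual.
have JM x : car x -> - (M ^+ 2 / 2) <= J x.
  move=> cx; rewrite /J -ph_norm_sqr//; have := lM x cx; rewrite ler_norml.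
  by move=> /andP[+ _]; have := sqr_ge0 (hnorm H x - M); nra.
pose S := [set J x | x in K].
have Sinf : has_inf S.
  split; first by exists (J x0), x0.
  by exists (- (M ^+ 2 / 2)) => _ [x Kx <-]; exact/JM/K_car.
pose m := inf S.
have mJ x : K x -> m <= J x by move=> Kx; apply: ge_inf; [exact: Sinf.2|exists x].
have /choice[x_ xP] : forall n : nat, exists x, K x /\ J x <= m + n.+1%:R^-1.
  move=> n; have /(inf_adherent)/(_ Sinf)[_ [x Kx <-] Jx] : (0 : R) < n.+1%:R^-1.
    by rewrite invr_gt0.
  by exists x; split => //; exact: ltW.
(* Compare with the midpoint: its value is the mean of the two values minus an eighth of the squared
   distance, and it is at least m. *)
have gap i j : ip (x_ i - x_ j) (x_ i - x_ j) <= 4 * (i.+1%:R^-1 + j.+1%:R^-1).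
  have [Ki Ji] := xP i; have [Kj Jj] := xP j.
  have ci := K_car Ki; have cj := K_car Kj.
  have half01 : 0 <= (1 / 2 : R) <= 1 by apply/andP; split; lra.
  have := mJ _ (K_convex Kj Ki half01).
  have ch := phB pH ci cj.
  have := @quadratic_fun_expand (x_ j) (x_ i - x_ j) cj ch.
  rewrite subrKC quadratic_fun_expand//; last exact: phZ.
  rewrite phZr// in_dualZ// phZl ?phZr//; last exact: phZ.
  move: (i.+1%:R^-1) (j.+1%:R^-1) Ji Jj => a b Ji Jj.
  clearbody m; clear mJ xP.
  by lra.
have [n|e e0|x Kx xx] := K_complete x_; first exact: (xP n).1.
  have e20 : 0 < e ^+ 2 / 8 by rewrite divr_gt0// exprn_gt0.
  have /cvgr0Pnorm_lt/(_ _ e20)[N _ NP] := @cvg_harmonic R.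
  exists N => i j Ni Nj; have ci := K_car (xP i).1; have cj := K_car (xP j).1.
  rewrite -ler_sqr ?nnegrE ?ph_norm_ge0 ?(ltW e0)// ph_norm_sqr//; last exact: phB.
  apply: le_trans (gap i j) _.
  have := NP i Ni; have := NP j Nj; rewrite /= /harmonic !ger0_norm ?invr_ge0//.
  by move: (i.+1%:R^-1) (j.+1%:R^-1) => a b; lra.
exists x => // y Ky; apply: le_trans (mJ _ Ky); have cx := K_car Kx.
have cxn n : car (x_ n - x) by apply: (phB pH) => //; exact/K_car/(xP n).1.
(* J x is J (x_ n) minus the linear term minus half a square; dropping the square bounds it by this
   sequence, which tends to m. *)
have : m + n.+1%:R^-1 - (ip x (x_ n - x) + l (x_ n - x)) @[n --> \oo] --> m + 0 - (0 + 0).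
  apply: cvgB; first by apply: cvgD; [exact: cvg_cst|exact: cvg_harmonic].
  have h (c : R) : c * hnorm H (x_ n - x) @[n --> \oo] --> (0 : R).
    by rewrite -[X in _ --> X](mulr0 c); exact: cvgMl_tmp.
  apply: cvgD.
    by apply: cvg0_le (h (hnorm H x)) => n; exact: ph_CS.
  by apply: cvg0_le (h M) => n; exact: lM.
rewrite !addr0 subr0 => h; apply: (cvgr_to_ge h); near=> n.
have := (xP n).2; rewrite -{1}(subrKC x (x_ n)) quadratic_fun_expand//.
by have := ph_ge0 pH (cxn n); move: (n.+1%:R^-1) => a; lra.
Unshelve. all: by end_near. Qed.

End convex_minimization.

(** * Restricted measures, the domain and the space-time cylinder *)

Section restricted_measure.
Context (R : realType) disp (X : measurableType disp).
Variables (mu : {measure set X -> \bar R}) (D : set X) (mD : measurable D).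

Lemma ge0_integral_mrestr (f : X -> \bar R) :
  measurable_fun setT f -> (forall x, 0 <= f x)%E ->
  (\int[mrestr mu mD]_x f x = \int[mu]_(x in D) f x)%E.
Proof.
move=> mf f0; have mDC := measurableC mD.
have mfU : measurable_fun (D `|` ~` D) f by rewrite setUv.
have DD : [disjoint D & ~` D] by apply/disj_setPS => x [].
rewrite -(setUv D) (ge0_integral_setU _ mD mDC mfU)//.
rewrite [X in (_ + X)%E](_ : _ = 0%E) ?adde0.
  apply: eq_measure_integral => A mA AD.
  by rewrite /= /mrestr setIidl.
rewrite (eq_measure_integral mzero); first exact: integral_measure_zero.
move=> A mA AD; rewrite /= /mrestr/= (_ : _ `&` _ = set0) ?measure0//.
by rewrite -subset0 => x [/AD].
Qed.

Lemma ae_mrestr (P : X -> Prop) : {ae mu, forall x, D x -> P x} ->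
  {ae mrestr mu mD, forall x, P x}.
Proof.
move=> [N [mN N0 NP]]; exists (N `|` ~` D); split.
- by apply: measurableU => //; exact: measurableC.
- apply/eqP; rewrite -measure_le0 -N0 /= /mrestr; apply: le_measure.
  + by rewrite inE; apply: measurableI => //; apply: measurableU => //; exact: measurableC.
  + by rewrite inE.
  + by move=> x [[]].
move=> x /= nPx; have [Dx|] := pselect (D x); last by right.
by left; apply: NP => /= /(_ Dx).
Qed.

Lemma mrestr_ae (P : X -> Prop) : {ae mrestr mu mD, forall x, P x} ->
  {ae mu, forall x, D x -> P x}.
Proof.
move=> [N [mN N0 NP]]; exists (N `&` D); split => //; first exact: measurableI.
move=> x /= /not_implyP[Dx nPx]; split => //.
exact: NP.
Qed.

End restricted_measure.

Section domain_measure.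
Context (R : realType) (d : nat).
Implicit Types (Omega : lipschitz_domain R d) (x : 'rV[R]_d).

Lemma ler_rV_norm x i : `|x ord0 i| <= `|x|.
Proof.
rewrite [leRHS]/Num.Def.normr/= mx_normrE.
exact: (le_bigmax _ (fun ij : 'I_1 * 'I_d => `|x ij.1 ij.2|) (ord0, i)).
Qed.

Lemma dom_bounded_coord Omega :
  exists2 B : R, 0 < B & forall x, dom Omega x -> forall i, `|x ord0 i| <= B.
Proof.
have /ex_strict_bound_gt0[B B0 OB] := dom_bounded Omega.
by exists B => // x Ox i; apply: le_trans (ler_rV_norm _ _) (ltW (OB _ Ox)).
Qed.

Lemma measurable_box (A : 'I_d -> set (measurableTypeR R)) :
  (forall i, measurable (A i)) ->
  measurable [set x : 'rV[R]_d | forall i, A i (x ord0 i)].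
Proof.
move=> mA; rewrite [X in measurable X](_ : _ = \bigcap_(i in [set: 'I_d])
    ((fun x : 'rV[R]_d => x ord0 i : measurableTypeR R) @^-1` A i)).
  apply: fin_bigcap_measurable => [|i _]; first exact: finite_finset.
  by rewrite -[X in measurable X]setTI; exact: measurable_coord_rV.
by apply/seteqP; split => x /= Ax i; [move=> _|]; exact: Ax.
Qed.

Lemma lebesgue_rV_dom_lty Omega : (lebesgue_rV R d Omega < +oo)%E.
Proof.
have [B B0 OB] := dom_bounded_coord Omega.
have mI (i : 'I_d) : measurable (`[- B, B]%classic : set (measurableTypeR R)).
  exact: measurable_itv.
pose box := [set x : 'rV[R]_d | forall i, (`[- B, B]%classic : set R) (x ord0 i)].
have boxlty : (lebesgue_rV R d box < +oo)%E.
  rewrite (lebesgue_rV_box mI) ltey_eq prode_fin_num// => i _.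
  by rewrite lebesgue_measure_itv/=; case: ifPn.
apply: le_lt_trans boxlty; apply: le_measure.
- by rewrite inE; exact: measurable_dom.
- by rewrite inE; exact: (measurable_box mI).
- by move=> x Ox i /=; rewrite in_itv/= -ler_norml OB.
Qed.

Lemma dom_measure_lty Omega : (dom_measure Omega setT < +oo)%E.
Proof. by rewrite /= /mrestr setTI; exact: lebesgue_rV_dom_lty. Qed.

End domain_measure.

Section time_extension.
Context (R : realType) (d : nat) (Omega : lipschitz_domain R d) (T : R).
Hypothesis T_gt0 : 0 < T.
Local Notation D := (dom_measure Omega).
Local Notation C := (cyl_measure T Omega).

Lemma cyl_measure_slab (A : set 'rV[R]_d) : measurable A ->
  C (setT `*` A) = (T%:E * D A)%E.
Proof.
move=> mA; have mAO : measurable (A `&` Omega).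
  by apply: measurableI => //; exact: measurable_dom.
transitivity ((@lebesgue_measure R \x lebesgue_rV R d)%E
    (`]0, T[%classic `*` (A `&` Omega))).
  rewrite /cyl_measure /= /mrestr; congr (product_measure1 _ _ _); apply/seteqP.
  by split=> [[t x] /= [[? ?] [? ?]]|[t x] /= [? [? ?]]].
by rewrite product_measure1E// /= lebesgue_measure_itv/= lte_fin T_gt0 oppr0 adde0.
Qed.

(** The projection onto the space variable pushes the cylinder measure forward to T times the
    measure on Omega. *)
Lemma sqint_time_ext (w : L2 D) : sqint C (time_ext T w) = (T%:E * sqint D w)%E.
Proof.
have <- : (\int[pushforward C snd]_x (w x ^+ 2)%:E = sqint C (time_ext T w))%E.
  rewrite (ge0_integral_pushforward measurable_snd)//=.
    exact: measurable_EFin_sqr.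
  by move=> x _; rewrite lee_fin sqr_ge0.
pose c := NngNum (ltW T_gt0).
rewrite (eq_measure_integral (mscale c D)); last first.
  move=> A mA _; transitivity (C (setT `*` A)); last exact: cyl_measure_slab.
  suff E : (snd : measurableTypeR R * 'rV[R]_d -> _) @^-1` A = setT `*` A.
    by rewrite -E.
  by apply/seteqP; split => [[t x]|[t x] []].
rewrite ge0_integral_mscale//; last by move=> x _; rewrite lee_fin sqr_ge0.
exact: measurable_EFin_sqr.
Qed.

Lemma L2norm_time_ext (w : L2 D) : L2norm C (time_ext T w) = Num.sqrt T * L2norm D w.
Proof.
apply/eqP; rewrite -(@eqrXn2 _ 2)// ?L2norm_ge0 ?mulr_ge0 ?sqrtr_ge0 ?L2norm_ge0//.
apply/eqP/EFin_inj; rewrite exprMn (sqr_sqrtr (ltW T_gt0)).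
transitivity (sqint C (time_ext T w)); first exact: (L2norm_sqint (time_ext T w)).
by rewrite sqint_time_ext EFinM; congr (_ * _)%E; exact/esym/L2norm_sqint.
Qed.

Lemma time_ext_lin a (w z : L2 D) :
  time_ext T (a *: w + z) = a *: time_ext T w + time_ext T z.
Proof. exact/LfuneqP. Qed.

Lemma time_extB (w z : L2 D) : time_ext T (w - z) = time_ext T w - time_ext T z.
Proof. exact/LfuneqP. Qed.

Lemma time_extD (w z : L2 D) : time_ext T (w + z) = time_ext T w + time_ext T z.
Proof. exact/LfuneqP. Qed.

Lemma time_extZ a (w : L2 D) : time_ext T (a *: w) = a *: time_ext T w.
Proof. exact/LfuneqP. Qed.

Lemma ae_time_ext (P : 'rV[R]_d -> Prop) :
  {ae D, forall x, P x} -> {ae C, forall z, P z.2}.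
Proof.
move=> [N [mN N0 NP]]; exists (setT `*` N); split.
- exact: measurableX.
- by rewrite cyl_measure_slab// N0 mule0.
- by move=> [t x] /= nP; split => //; exact: NP.
Qed.

Lemma ae_time_ext_inv (P : 'rV[R]_d -> Prop) : measurable [set x | ~ P x] ->
  {ae C, forall z, P z.2} -> {ae D, forall x, P x}.
Proof.
move=> mP [N [mN N0 NP]]; exists [set x | ~ P x]; split => //.
have : (T%:E * D [set x | ~ P x] <= 0)%E.
  rewrite -cyl_measure_slab// -N0; apply: le_measure; rewrite ?inE//.
    exact: measurableX.
  by move=> [t x] /= [_ nP]; exact: NP.
rewrite pmule_rle0 ?lte_fin// => h; apply/eqP; rewrite eq_le h.
exact: measure_ge0.
Qed.

End time_extension.

(** * The concave smoothing and its tangent majorants *)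

Section smoothing_majorant.
Context (R : realType) (p : R).
Hypotheses (p_gt0 : 0 < p) (p_lt1 : p < 1).

(* The tangent at t = a^2 of the concave function t |-> t^(p/2); the smoothing
   psi_eps is the minimum of these tangents over a >= eps. *)
Definition tangent (a t : R) : R := a `^ (p - 2) * (p / 2 * t + (1 - p / 2) * a ^+ 2).

(** Since t^((p-2)/2) decreases, the minimum in [dpsi] is attained at the larger of eps and |r|:
    this is the slope of the tangent at a = max(eps, |r|). *)
Lemma dpsi_sqr (eps r : R) : 0 < eps ->
  dpsi p eps (r ^+ 2) = p / 2 * Num.max eps `|r| `^ (p - 2).
Proof.
move=> e0; rewrite dpsiE ?sqr_ge0//; last by rewrite (lt_trans p_lt1)// ltr1n.
rewrite -(real_normK (num_real r)) ltr_sqr ?nnegrE ?(ltW e0)//; congr (_ * _).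
have [re|er] := ltP `|r| eps; first by [].
rewrite -powR_mulrn// -powRrM; congr (_ `^ _); by field.
Qed.

Lemma powR_expr2 (a : R) : 0 < a -> a `^ (p - 2) * a ^+ 2 = a `^ p.
Proof.
move=> a0; rewrite -powR_mulrn ?(ltW a0)// -powRD ?subrK//.
by rewrite (gt_eqF a0) implybT.
Qed.

(** Concavity of t^(p/2), obtained from Young's inequality with exponents 2/p and its conjugate,
    applied to (r/a)^p and 1. *)
Lemma powR_le_tangent (a r : R) : 0 < a -> 0 <= r -> r `^ p <= tangent a (r ^+ 2).
Proof.
move=> a0 r0; have aN0 : a != 0 by rewrite gt_eqF.
pose th := p / 2; have th0 : 0 < th by rewrite divr_gt0.
have th1 : 0 < 1 - th by rewrite subr_gt0 /th; move: p_lt1; lra.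
have := @conjugate_powR R ((r / a) `^ p) 1 th^-1 (1 - th)^-1 (powR_ge0 _ _) ler01.
rewrite !invr_gt0 !invrK => /(_ th0 th1 (subrKC _ _)).
rewrite mulr1 powR1 mul1r -powRrM (_ : p / th = 2%:R); last first.
  by rewrite /th; field; rewrite gt_eqF.
rewrite powR_mulrn ?divr_ge0 ?(ltW a0)// => /(ler_wpM2r (powR_ge0 a p)).
rewrite -powRM ?divr_ge0 ?(ltW a0)// divfK// => /le_trans; apply.
rewrite /tangent -(powR_expr2 a0) -/th le_eqVlt; apply/orP; left; apply/eqP.
by field.
Qed.

(** For |r| >= eps the left tangent touches the graph of the power at r^2. For |r| < eps both sides
    are affine in r^2, so it is enough to compare them at 0 and at eps^2; the convex weight is x. *)
Lemma tangent_min (eps a r : R) : 0 < eps -> eps <= a ->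
  tangent (Num.max eps `|r|) (r ^+ 2) <= tangent a (r ^+ 2).
Proof.
move=> e0 ea; have a0 : 0 < a := lt_le_trans e0 ea.
have [re|er] := ltP `|r| eps; last first.
  have r0 : 0 < `|r| := lt_le_trans e0 er.
  rewrite {1}/tangent -(real_normK (num_real r)) -mulrDl subrKC mul1r powR_expr2//.
  exact: powR_le_tangent.
have e2 : 0 < eps ^+ 2 by rewrite exprn_gt0.
pose x := r ^+ 2 / eps ^+ 2.
have x01 : 0 <= x <= 1.
  rewrite divr_ge0 ?sqr_ge0//= ler_pdivrMr// mul1r -(real_normK (num_real r)).
  by rewrite ler_sqr ?nnegrE ?(ltW e0)// ltW.
have xE : r ^+ 2 = x * eps ^+ 2 by rewrite divfK ?gt_eqF.
have h1 : eps `^ p <= tangent a (eps ^+ 2) by apply: powR_le_tangent => //; exact: ltW.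
have h2 : eps `^ p <= a `^ p.
  by rewrite ge0_ler_powR ?nnegrE ?(ltW p_gt0) ?(ltW e0) ?(ltW a0).
move: h1 h2; rewrite /tangent xE -!powR_expr2//.
have p2 : 0 < 1 - p / 2 by move: p_lt1; lra.
set E := eps `^ _; set A := a `^ _; set e := eps ^+ 2; set b := a ^+ 2 => h1 h2.
rewrite (_ : E * _ = x * (E * e) + (1 - x) * ((1 - p / 2) * (E * e))); last by ring.
rewrite (_ : A * _ = x * (A * (p / 2 * e + (1 - p / 2) * b))
  + (1 - x) * ((1 - p / 2) * (A * b))); last by ring.
move/andP : x01 => [x0 x1].
rewrite lerD//; first by rewrite ler_wpM2l.
by rewrite ler_wpM2l ?subr_ge0// ler_wpM2l// ltW.
Qed.

Lemma tangent_ge0 a t : 0 <= t -> 0 <= tangent a t.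
Proof.
move=> t0; have p2 : 0 < 1 - p / 2 by move: p_lt1; lra.
rewrite mulr_ge0 ?powR_ge0// addr_ge0// mulr_ge0 ?sqr_ge0 ?(ltW p2)//.
by rewrite divr_ge0 ?(ltW p_gt0).
Qed.

Lemma tangent_step a t t' :
  tangent a t' = tangent a t + p / 2 * a `^ (p - 2) * (t' - t).
Proof. by rewrite /tangent; ring. Qed.

Lemma dpsi_ge0 eps t : 0 <= dpsi p eps t.
Proof.
rewrite mulr_ge0 ?divr_ge0 ?(ltW p_gt0)//; case: ifP => _; first exact: powR_ge0.
by rewrite le_min !powR_ge0.
Qed.

Lemma dpsi_le eps t : 0 < eps -> dpsi p eps t <= p / 2 * eps `^ (p - 2).
Proof.
move=> e0; rewrite ler_wpM2l ?divr_ge0 ?(ltW p_gt0)//; case: ifP => // _.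
by rewrite ge_min lexx.
Qed.

End smoothing_majorant.

(** * The abstract function space and the quadratic forms of the subproblem *)

Section good_space.
Context (R : realType) (d : nat) (Omega : lipschitz_domain R d).
Local Notation D := (dom_measure Omega).

(* What the argument needs to know about W. *)
Record good_space (W : hspace (L2 D)) : Prop := GoodSpace {
  gs_ph : prehilbert W ;
  gs_embed : exists2 c : R, 0 <= c & forall w, hcar W w -> L2norm D w <= c * hnorm W w ;
  gs_complete : forall (w_ : nat -> L2 D) (w : L2 D), (forall n, hcar W (w_ n)) ->
    (forall e : R, 0 < e -> exists N, forall m n, (N <= m)%N -> (N <= n)%N ->
       hnorm W (w_ m - w_ n) <= e) ->
    L2norm D (w_ n - w) @[n --> \oo] --> (0 : R) ->
    hcar W w /\ hnorm W (w_ n - w) @[n --> \oo] --> (0 : R) ;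
  gs_compact : forall (w_ : nat -> L2 D) (w : L2 D) (M : R),
    (forall n, hcar W (w_ n)) -> hcar W w -> (forall n, hnorm W (w_ n) <= M) ->
    weak_cvg W w_ w ->
    exists2 s : nat -> nat, {homo s : m n / (m < n)%N} &
      {ae D, forall x, w_ (s k) x @[k --> \oo] --> w x} }.

End good_space.

Section weighted_L2.
Context (R : realType) disp (X : measurableType disp).
Variable mu : {measure set X -> \bar R}.
Variables (m : X -> R) (B : R).
Hypotheses (mm : measurable_fun setT m) (m0 : forall x, 0 <= m x)
  (B0 : 0 <= B) (mB : forall x, m x <= B).

Lemma Lfun2_mul_bounded (w : L2 mu) : (fun x => m x * w x) \in Lfun mu 2%:E.
Proof.
apply: (@Lfun2_le _ _ _ _ _ (B *: w : L2 mu)) (LfunP _) _.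
  exact: measurable_funM.
move=> x; rewrite -[X in _ <= `|X|]/(B * w x) !normrM ler_wpM2r//.
by rewrite !ger0_norm.
Qed.

Definition mul_bounded (w : L2 mu) : L2 mu := Lfun_Sub (lee1n 2) (Lfun2_mul_bounded w).

Definition weighted_hspace : hspace (L2 mu) :=
  HSpace setT (fun w z : L2 mu => \int[mu]_x (m x * (w x * z x))).

Lemma weighted_ipE (w z : L2 mu) : hip weighted_hspace w z = L2ip mu (mul_bounded w) z.
Proof. by apply: eq_Rintegral => x _ /=; rewrite mulrA. Qed.

Lemma weighted_prehilbert : prehilbert weighted_hspace.
Proof.
split=> // [x y _ _|a x y z _ _ _|x _].
- by apply: eq_Rintegral => t _; rewrite [x t * _]mulrC.
- rewrite !weighted_ipE -L2ipZl -L2ipDl; congr L2ip.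
  by apply/funext => t; rewrite -[RHS]/(a * (m t * x t) + m t * y t)
    -[LHS]/(m t * (a * x t + y t)); ring.
- by apply: Rintegral_ge0 => t _; rewrite mulr_ge0// -expr2 sqr_ge0.
Qed.

Lemma weighted_sqr_integrable (w : L2 mu) :
  mu.-integrable setT (fun x => (m x * (w x * w x))%:E).
Proof.
rewrite (_ : (fun _ => _) = (fun x => (mul_bounded w x * w x)%:E)).
  exact: (Lfun2M_integrable (LfunP (mul_bounded w)) (LfunP w)).
by apply/funext => x /=; rewrite mulrA.
Qed.

Lemma weighted_ip_le (w : L2 mu) : hip weighted_hspace w w <= B * L2norm mu w ^+ 2.
Proof.
rewrite L2norm_sqr -L2ipZl /=; apply: le_Rintegral => //.
- exact: weighted_sqr_integrable.
- exact: (Lfun2M_integrable (LfunP (B *: w)) (LfunP w)).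
by move=> x _; rewrite -[leRHS]/(B * w x * w x) -mulrA ler_wpM2r// -expr2 sqr_ge0.
Qed.

End weighted_L2.

Section product_hspace.
Context (R : realType) (U V : lmodType R).
Variables (HU : hspace U) (HV Q : hspace V) (a b : R).
Hypotheses (a0 : 0 <= a) (b0 : 0 <= b).
Hypotheses (pU : prehilbert HU) (pV : prehilbert HV) (pQ : prehilbert Q)
  (VQ : hcar HV `<=` hcar Q).

(** With [Q] the weighted L2 form of the penalty, half of this squared norm is exactly the quadratic
    part of the subproblem. *)
Definition product_hspace : hspace (U * V)%type :=
  HSpace [set x : U * V | hcar HU x.1 /\ hcar HV x.2]
    (fun x y => a * hip HU x.1 y.1 + b * hip HV x.2 y.2 + hip Q x.2 y.2).

Lemma product_prehilbert : prehilbert product_hspace.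
Proof.
split.
- by split; [exact: ph0 pU|exact: ph0 pV].
- by move=> t x y [x1 x2] [y1 y2]; split; [exact: ph_lin|exact: ph_lin].
- move=> x y [x1 x2] [y1 y2] /=.
  by rewrite (phC pU x1 y1) (phC pV x2 y2) (phC pQ (VQ x2) (VQ y2)).
- move=> t x y z [x1 x2] [y1 y2] [z1 z2] /=.
  rewrite (ph_linl pU t x1 y1 z1) (ph_linl pV t x2 y2 z2)
    (ph_linl pQ t (VQ x2) (VQ y2) (VQ z2)); ring.
- move=> x [x1 x2] /=; have h1 := ph_ge0 pU x1; have h2 := ph_ge0 pV x2.
  have h3 := ph_ge0 pQ (VQ x2).
  by apply: addr_ge0 => //; apply: addr_ge0; exact: mulr_ge0.
Qed.

End product_hspace.

(** * The admissible cone *)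

Section feasible_set.
Context (R : realType) (d : nat) (Omega : lipschitz_domain R d) (T : R).
Hypothesis T_gt0 : 0 < T.
Local Notation D := (dom_measure Omega).
Local Notation C := (cyl_measure T Omega).
Variable W : hspace (L2 D).
Hypothesis pW : prehilbert W.

Lemma feasible_convex u w u' w' t : feasible W u w -> feasible W u' w' ->
  0 <= t <= 1 -> feasible W (u + t *: (u' - u) : L2 C) (w + t *: (w' - w)).
Proof.
move=> [cw uw] [cw' uw'] /andP[t0 t1]; split.
  by apply: (phD pW) => //; apply: (phZ pW); exact: (phB pW).
apply: filterS (filterI uw uw') => x [ux ux'].
rewrite -[X in `|X|]/(u x + t * (u' x - u x)).
rewrite -[leRHS]/(w x.2 + t * (w' x.2 - w x.2)).
rewrite (_ : u x + _ = (1 - t) * u x + t * u' x); last by ring.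
rewrite [leRHS](_ : _ = (1 - t) * w x.2 + t * w' x.2); last by ring.
rewrite (le_trans (ler_normD _ _))// !normrM (ger0_norm t0) ger0_norm ?subr_ge0//.
by rewrite lerD// ler_wpM2l// subr_ge0.
Qed.

(** The cone property, which permits the test points 0 and twice a solution in [solution_energy]. *)
Lemma feasible_scale u w c : 0 <= c -> feasible W u w ->
  feasible W (c *: u : L2 C) (c *: w).
Proof.
move=> c0 [cw uw]; split; first exact: (phZ pW).
apply: filterS uw => x ux; rewrite -[X in `|X|]/(c * u x) -[leRHS]/(c * w x.2).
by rewrite normrM ger0_norm// ler_wpM2l.
Qed.

Lemma feasible_ge0 (u : L2 C) w : feasible W u w -> {ae C, forall x, 0 <= w x.2}.
Proof. by move=> [_]; apply: filterS => x; apply: le_trans. Qed.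

(** The constraint |u| <= w says that w - u and w + u are nonnegative. Each is equivalent to
    nonnegative pairings with all nonnegative functions, a condition that survives weak limits. *)
Lemma feasible_limit (u_ : nat -> L2 C) (w_ : nat -> L2 D)
    (u : L2 C) (w : L2 D) :
  (forall n, feasible W (u_ n) (w_ n)) -> hcar W w ->
  (forall h : L2 C, L2ip C (u_ n) h @[n --> \oo] --> L2ip C u h) ->
  (forall h : L2 C, L2ip C (time_ext T (w_ n)) h @[n --> \oo] -->
     L2ip C (time_ext T w) h) ->
  feasible W u w.
Proof.
move=> uw cw uu ww; split => //.
have h1 : {ae C, forall x, 0 <= (time_ext T w - u) x}.
  apply: L2ip_test_ge0 => h h0; rewrite L2ipBl.
  apply: (cvgr_to_ge (cvgB (ww h) (uu h))); near=> n.
  rewrite subr_ge0; apply: le_L2ip => //; have [_] := uw n.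
  by apply: filterS => x; apply: le_trans; exact: ler_norm.
have h2 : {ae C, forall x, 0 <= (time_ext T w + u) x}.
  apply: L2ip_test_ge0 => h h0; rewrite L2ipDl.
  apply: (cvgr_to_ge (cvgD (ww h) (uu h))); near=> n.
  rewrite -lerBlDr sub0r -mulN1r -L2ipZl; apply: le_L2ip => //.
  have [_] := uw n; apply: filterS => x; rewrite ler_norml => /andP[+ _].
  by rewrite -[leLHS]/(- w_ n x.2) lerNl -[X in _ -> X <= _]/(-1 * u_ n x) mulN1r.
apply: filterS (filterI h1 h2) => x [].
rewrite -[X in 0 <= X -> _]/(w x.2 - u x) -[X in _ -> 0 <= X -> _]/(w x.2 + u x).
rewrite subr_ge0 => h3 h4; rewrite ler_norml; apply/andP; split => //.
by rewrite -subr_ge0 opprK addrC.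
Unshelve. all: by end_near. Qed.

End feasible_set.

Lemma scale2B (R : pzRingType) (V : lmodType R) (x : V) : 2 *: x - x = x.
Proof. by rewrite scaler_nat mulr2n addrK. Qed.

Lemma L2_strong_weak (R : realType) disp (X : measurableType disp)
    (mu : {measure set X -> \bar R}) (u_ : nat -> L2 mu) (u : L2 mu) :
  L2norm mu (u_ n - u) @[n --> \oo] --> (0 : R) ->
  forall h : L2 mu, L2ip mu (u_ n) h @[n --> \oo] --> L2ip mu u h.
Proof.
move=> uu h; rewrite (_ : (fun n => _) = (fun n => L2ip mu h (u_ n))); last first.
  by apply/funext => n; rewrite L2ipC.
rewrite [X in _ --> X]L2ipC.
exact: (dual_cvg_perturb (L2_prehilbert mu) (L2_in_dual h) (x_ := fun=> u) (y_ := u_)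
  (fun=> I) (fun=> I) (cvg_cst _) uu).
Qed.

(** * Existence, optimality and energy identity of one step *)

Section proximal_step.
Context (R : realType) (d : nat) (Omega : lipschitz_domain R d) (T : R).
Hypothesis T_gt0 : 0 < T.
Local Notation D := (dom_measure Omega).
Local Notation C := (cyl_measure T Omega).
Variable W : hspace (L2 D).
Hypothesis gW : good_space W.
Variable f' : L2 C -> L2 C.
Variables (alpha beta gamma p eps L : R).
Hypotheses (alpha_gt0 : 0 < alpha) (beta_gt0 : 0 < beta) (gamma_gt0 : 0 < gamma)
  (p_gt0 : 0 < p) (p_lt1 : p < 1) (eps_gt0 : 0 < eps) (L_gt0 : 0 < L).
Variables (uk : L2 C) (wk : L2 D).
Let pW := gs_ph gW.

(** The factor 2 makes half of the weighted square equal to gamma times the linearised penalty. *)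
Definition reg_weight (x : 'rV[R]_d) : R := 2 * gamma * dpsi p eps (wk x ^+ 2).

Let B := 2 * gamma * (p / 2 * eps `^ (p - 2)).

Lemma measurable_reg_weight : measurable_fun setT reg_weight.
Proof.
rewrite /reg_weight; under eq_fun do rewrite (dpsi_sqr p_lt1 _ eps_gt0).
apply: measurable_funM => //; apply: measurable_funM => //.
apply: (measurableT_comp (measurable_powR _)).
by apply: measurable_maxr => //; exact: measurableT_comp.
Qed.

Lemma reg_weight_ge0 x : 0 <= reg_weight x.
Proof.
by apply: mulr_ge0; [rewrite mulr_ge0// (ltW gamma_gt0)|exact: dpsi_ge0].
Qed.

Let B0 : 0 <= B.
Proof. by rewrite !mulr_ge0 ?divr_ge0 ?powR_ge0 ?(ltW p_gt0) ?(ltW gamma_gt0). Qed.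

Let wB x : reg_weight x <= B.
Proof. by rewrite ler_wpM2l ?mulr_ge0 ?(ltW gamma_gt0)// dpsi_le. Qed.

Definition reg_hspace : hspace (L2 D) := weighted_hspace D reg_weight.

Lemma reg_prehilbert : prehilbert reg_hspace.
Proof. exact: weighted_prehilbert measurable_reg_weight reg_weight_ge0 B0 wB. Qed.
Local Notation Q := reg_hspace.
Let pQ := reg_prehilbert.

Lemma reg_ip_le (w : L2 D) : hip Q w w <= B * L2norm D w ^+ 2.
Proof. exact: weighted_ip_le measurable_reg_weight reg_weight_ge0 B0 wB w. Qed.

Lemma reg_integrable (w : L2 D) :
  D.-integrable setT (fun x => (reg_weight x * (w x * w x))%:E).
Proof. exact: weighted_sqr_integrable measurable_reg_weight reg_weight_ge0 B0 wB w. Qed.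

Let H := product_hspace (L2_hspace C) W Q (alpha + L) beta.
Let aL : 0 < alpha + L. Proof. exact: addr_gt0. Qed.

Let pH : prehilbert H.
Proof. exact: product_prehilbert (ltW aL) (ltW beta_gt0) (L2_prehilbert C) pW pQ _. Qed.

(** Expanding the proximal penalty puts its square into the product form [H] and its cross term -L
    (uk, u) here. *)
Let l (x : L2 C * L2 D) := L2ip C (f' uk - L *: uk) x.1.

Let H_normU (x : L2 C * L2 D) : hcar H x ->
  L2norm C x.1 <= (Num.sqrt (alpha + L))^-1 * hnorm H x.
Proof.
move=> cx; have sa : 0 < Num.sqrt (alpha + L) by rewrite sqrtr_gt0.
rewrite ler_pdivlMl//.
rewrite -ler_sqr ?nnegrE ?mulr_ge0 ?L2norm_ge0 ?ph_norm_ge0 ?(ltW sa)//.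
rewrite (ph_norm_sqr pH cx) exprMn (sqr_sqrtr (ltW aL)) L2norm_sqr /= -addrA lerDl.
have [_ cx2] := cx.
by rewrite addr_ge0// ?mulr_ge0 ?(ltW beta_gt0) ?(ph_ge0 pW cx2)//; exact: (ph_ge0 pQ I).
Qed.

Let H_normW (x : L2 C * L2 D) : hcar H x ->
  hnorm W x.2 <= (Num.sqrt beta)^-1 * hnorm H x.
Proof.
move=> cx; have sa : 0 < Num.sqrt beta by rewrite sqrtr_gt0.
rewrite ler_pdivlMl//; have [_ cx2] := cx.
rewrite -ler_sqr ?nnegrE ?mulr_ge0 ?ph_norm_ge0 ?(ltW sa)//.
rewrite (ph_norm_sqr pH cx) exprMn (sqr_sqrtr (ltW beta_gt0)) (ph_norm_sqr pW cx2) /=.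
rewrite [X in _ <= X + _]addrC -addrA lerDl.
by rewrite addr_ge0// ?mulr_ge0 ?(ltW aL)//;
  [exact: (ph_ge0 (L2_prehilbert C) I)|exact: (ph_ge0 pQ I)].
Qed.

Let l_dual : in_dual H l.
Proof.
split=> [a x y _ _|].
  by have [/(_ a x.1 y.1 I I)] := L2_in_dual (f' uk - L *: uk).
exists (L2norm C (f' uk - L *: uk) * (Num.sqrt (alpha + L))^-1) => x cx.
apply: le_trans (L2_CS _ _) _; rewrite -mulrA ler_wpM2l ?L2norm_ge0//.
exact: H_normU.
Qed.

Definition model_const := - L2ip C (f' uk) uk - hip Q wk wk / 2
  + L / 2 * L2norm C uk ^+ 2.

Let K := [set x : L2 C * L2 D | feasible W x.1 x.2].

Let K_car : K `<=` hcar H. Proof. by move=> x []. Qed.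

Let K_convex x y t : K x -> K y -> 0 <= t <= 1 -> K (x + t *: (y - x)).
Proof. by move=> Kx Ky t01; exact: (feasible_convex pW Kx Ky t01). Qed.

Lemma reg_diffE (w : L2 D) : gamma * \int[D]_x
    (dpsi p eps (wk x ^+ 2) * (w x ^+ 2 - wk x ^+ 2)) = (hip Q w w - hip Q wk wk) / 2.
Proof.
have g2 : 2 * gamma != 0 by rewrite gt_eqF// mulr_gt0.
rewrite (_ : \int[D]_x _ = (2 * gamma)^-1 * (hip Q w w - hip Q wk wk)).
  by field; rewrite gt_eqF.
rewrite /= -RintegralB//; [|exact: reg_integrable|exact: reg_integrable].
rewrite -RintegralZl//.
  by apply: eq_Rintegral => x _ /=; rewrite /reg_weight; field; rewrite gt_eqF.
have := integrableB measurableT (reg_integrable w) (reg_integrable wk).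
by [].
Qed.

Lemma modelE u w : hcar W w ->
  model W f' alpha beta gamma p eps L uk wk u w = quadratic_fun H l (u, w) + model_const.
Proof.
move=> cw; rewrite /model reg_diffE /quadratic_fun /model_const.
rewrite -[l _]/(L2ip C (f' uk - L *: uk) u).
rewrite -[hip H _ _]/((alpha + L) * L2ip C u u + beta * hip W w w + hip Q w w).
rewrite !L2norm_sqr (ph_norm_sqr pW cw) !L2ipBl !L2ipBr L2ipZl (L2ipC u uk); by field.
Qed.

Lemma solution_min u' w' : solves W f' alpha beta gamma p eps L uk wk u' w' ->
  K (u', w') /\ forall y, K y -> quadratic_fun H l (u', w') <= quadratic_fun H l y.
Proof.
move=> [fw' wmin]; split => // -[u w] fw.
have := wmin u w fw; rewrite !modelE ?lerD2r//; first exact: fw.1.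
exact: fw'.1.
Qed.

Lemma solution_foc u' w' : solves W f' alpha beta gamma p eps L uk wk u' w' ->
  forall v z, feasible W v z ->
  0 <= L2ip C (f' uk + (alpha *: u' + L *: (u' - uk))) (v - u')
    + beta * hip W w' (z - w') + hip Q w' (z - w').
Proof.
move=> /solution_min[Kw wmin] v z Kv.
have h : 0 <= (alpha + L) * L2ip C u' (v - u') + beta * hip W w' (z - w')
    + hip Q w' (z - w') + L2ip C (f' uk - L *: uk) (v - u').
  exact: (first_order_condition pH K_car K_convex l_dual Kw wmin (Kv : K (v, z))).
apply: le_trans h _; rewrite le_eqVlt; apply/orP; left; apply/eqP.
by rewrite [L2ip _ (f' uk - _) _]L2ipBl 2!L2ipDl !L2ipZl L2ipBl; ring.
Qed.

(** [minimizer_gap] applied at the previous iterate, where the model reduces to the two squared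
    norms. The weighted part of the gap is nonnegative and is dropped. *)
Lemma solution_gap u' w' : solves W f' alpha beta gamma p eps L uk wk u' w' ->
  feasible W uk wk ->
  model W f' alpha beta gamma p eps L uk wk u' w'
    + ((alpha + L) / 2 * L2norm C (u' - uk) ^+ 2 + beta / 2 * hnorm W (w' - wk) ^+ 2)
  <= alpha / 2 * L2norm C uk ^+ 2 + beta / 2 * hnorm W wk ^+ 2.
Proof.
move=> sol Kk; have [Kw wmin] := solution_min sol.
have cw' : hcar W w' := Kw.1; have cwk : hcar W wk := Kk.1.
have := minimizer_gap pH K_car K_convex l_dual Kw wmin (Kk : K (uk, wk)).
have -> : alpha / 2 * L2norm C uk ^+ 2 + beta / 2 * hnorm W wk ^+ 2 =
    model W f' alpha beta gamma p eps L uk wk uk wk.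
  rewrite /model reg_diffE !subrr !mul0r addr0.
  have ip0 (h : L2 C) : L2ip C (0 : L2 C) h = 0.
    exact: (ph0l (L2_prehilbert C) (z := h) I).
  rewrite (_ : L2norm C (0 : L2 C) ^+ 2 = 0); last by rewrite L2norm_sqr ip0.
  by rewrite mulr0 !addr0 L2ipC ip0 add0r.
rewrite !modelE// => h; rewrite addrAC lerD2r; apply: le_trans h; rewrite lerD2l.
rewrite L2norm_distC (ph_norm_distC pW cw' cwk).
rewrite L2norm_sqr (ph_norm_sqr pW (phB pW cwk cw')).
rewrite -[hip H _ _]/((alpha + L) * L2ip C (uk - u') (uk - u')
  + beta * hip W (wk - w') (wk - w') + hip Q (wk - w') (wk - w')).
have : 0 <= hip Q (wk - w') (wk - w') by exact: (ph_ge0 pQ (x := wk - w') I).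
by lra.
Qed.

(** The norm of [H] controls the L2 norm of the first component and the W norm of the second, so
    both have L2 limits; [gs_complete] makes the second a limit in W, and [feasible_limit] keeps the
    constraint. The bound [B] on the weight handles the remaining part of the norm. *)
Let K_complete (x_ : nat -> L2 C * L2 D) : (forall n, K (x_ n)) ->
  (forall e : R, 0 < e -> exists N, forall m n, (N <= m)%N -> (N <= n)%N ->
     hnorm H (x_ m - x_ n) <= e) ->
  exists2 x, K x & hnorm H (x_ n - x) @[n --> \oo] --> (0 : R).
Proof.
move=> Kx cx.
have cxx m n : hcar H (x_ m - x_ n) by apply: (phB pH); exact/K_car/Kx.
have cauchy_le (c : R) (N : L2 C * L2 D -> R) :
    0 <= c -> (forall m n, N (x_ m - x_ n) <= c * hnorm H (x_ m - x_ n)) ->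
    forall e : R, 0 < e -> exists k, forall m n, (k <= m)%N -> (k <= n)%N ->
      N (x_ m - x_ n) <= e.
  move=> c0 Nc e e0; have c1 : 0 < c + 1 by rewrite ltr_wpDl.
  have [k kP] := cx (e / (c + 1)) (divr_gt0 e0 c1).
  exists k => m n km kn; apply: (le_trans (Nc m n)).
  apply: (@le_trans _ _ (c * (e / (c + 1)))); first by rewrite ler_wpM2l// kP.
  by rewrite mulrCA ler_piMr ?(ltW e0)// ler_pdivrMr// mul1r lerDl.
have [u uu] : exists u : L2 C, L2norm C ((x_ n).1 - u) @[n --> \oo] --> (0 : R).
  apply: L2_cauchy_cvg.
  apply: (cauchy_le (Num.sqrt (alpha + L))^-1 (fun y => L2norm C y.1)) => [|m n].
    by rewrite invr_ge0 sqrtr_ge0.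
  exact: H_normU.
have cW : forall e : R, 0 < e -> exists k, forall m n, (k <= m)%N -> (k <= n)%N ->
      hnorm W ((x_ m).2 - (x_ n).2) <= e.
  apply: (cauchy_le (Num.sqrt beta)^-1 (fun y => hnorm W y.2)) => [|m n].
    by rewrite invr_ge0 sqrtr_ge0.
  exact: H_normW.
have [c c0 Wc] := gs_embed gW.
have [w ww] : exists w : L2 D, L2norm D ((x_ n).2 - w) @[n --> \oo] --> (0 : R).
  apply: L2_cauchy_cvg.
  apply: (cauchy_le (c * (Num.sqrt beta)^-1) (fun y => L2norm D y.2)) => [|m n].
    by rewrite mulr_ge0// invr_ge0 sqrtr_ge0.
  apply: le_trans (Wc _ _) _; first exact: (cxx m n).2.
  by rewrite -mulrA ler_wpM2l//; exact: H_normW.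
have [cw hw] := gs_complete gW (fun n => (Kx n).1) cW ww.
exists (u, w).
  apply: (feasible_limit Kx cw).
  - exact: L2_strong_weak uu.
  - apply: L2_strong_weak.
    have hT : Num.sqrt T * L2norm D ((x_ n).2 - w) @[n --> \oo] --> (0 : R).
      by rewrite -[X in _ --> X](mulr0 (Num.sqrt T)); exact: cvgMl_tmp.
    apply: cvg0_le hT => n; rewrite -time_extB ger0_norm ?L2norm_ge0//.
    by rewrite (L2norm_time_ext T_gt0).
have cxn n : hcar W ((x_ n).2 - w) by apply: (phB pW) => //; exact: (Kx n).1.
have h0 : (alpha + L) * (L2norm C ((x_ n).1 - u) * L2norm C ((x_ n).1 - u))
   + beta * (hnorm W ((x_ n).2 - w) * hnorm W ((x_ n).2 - w))
   + B * (L2norm D ((x_ n).2 - w) * L2norm D ((x_ n).2 - w)) @[n --> \oo] --> (0 : R).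
  rewrite -[X in _ --> X](_ : (alpha + L) * (0 * 0) + beta * (0 * 0) + B * (0 * 0) = 0); last by ring.
  apply: cvgD; first (apply: cvgD; apply: cvgMl_tmp; exact: cvgM).
  by apply: cvgMl_tmp; exact: cvgM.
apply: sqr_cvg0; apply: cvg0_le h0 => n.
rewrite ger0_norm ?sqr_ge0// -!expr2.
rewrite (@ph_norm_sqr _ _ _ pH (x_ n - (u, w)) (conj I (cxn n))).
rewrite L2norm_sqr (ph_norm_sqr pW (cxn n)).
rewrite -[leLHS]/((alpha + L) * L2ip C ((x_ n).1 - u) ((x_ n).1 - u)
  + beta * hip W ((x_ n).2 - w) ((x_ n).2 - w) + hip Q ((x_ n).2 - w) ((x_ n).2 - w)).
by rewrite lerD2l; exact: reg_ip_le.
Qed.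

(** Needed for the backtracking: the rejection clause of [generated] speaks about all solutions of a
    trial subproblem, so it yields information only when one exists. *)
Lemma solution_exists : K !=set0 ->
  exists u' w', solves W f' alpha beta gamma p eps L uk wk u' w'.
Proof.
move=> K0; have [[u' w'] Kw wmin] :=
  quadratic_fun_exists_min pH K_car K_convex l_dual K0 K_complete.
exists u', w'; split; first exact: Kw.
move=> u w fw; rewrite (modelE _ fw.1) (modelE _ Kw.1) lerD2r.
exact: (wmin (u, w) fw).
Qed.

(** Optimality tested with twice the solution and with zero gives the two opposite inequalities. *)
Lemma solution_energy u' w' : solves W f' alpha beta gamma p eps L uk wk u' w' ->
  L2ip C (f' uk + (alpha *: u' + L *: (u' - uk))) u'
  + beta * hip W w' w' + hip Q w' w' = 0.
Proof.
move=> sol; have foc := solution_foc sol; have [[cw uw] _] := sol.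
have cN : hcar W (- w') := phN pW cw.
have f2 := feasible_scale pW (ler0n R 2) (conj cw uw : feasible W u' w').
have f0 := feasible_scale pW (lexx 0) (conj cw uw : feasible W u' w').
have := foc _ _ f2; rewrite (scale2B u') (scale2B w') => h2.
have := foc _ _ f0; rewrite (scale0r u') (scale0r w') (sub0r u') (sub0r w').
rewrite -(scaleN1r u') -(scaleN1r w') (L2ipZr (-1) u') (phZr pW (-1) cw cw).
rewrite (phZr pQ (-1) (x := w') (z := w') I I) => h0.
by apply/eqP; rewrite eq_le h2 andbT; move: h0; lra.
Qed.

End proximal_step.

(** * Mean value bounds along segments *)

Section mean_value.
Context (R : realType) disp (X : measurableType disp).
Variable mu : {measure set X -> \bar R}.
Variables (f : L2 mu -> R) (f' : L2 mu -> L2 mu).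
Hypothesis f_diff : frechet_derivative f f'.

Lemma frechet_is_derive (u h : L2 mu) (t : R) :
  is_derive t 1 (fun t : R => f (u + t *: h)) (L2ip mu (f' (u + t *: h)) h).
Proof.
(* Adding 1 to the norm of h avoids a division by zero when h vanishes almost everywhere. *)
set g := fun t => _; set l := L2ip _ _ _; set n := L2norm mu h + 1.
have n0 : 0 < n by rewrite ltr_wpDl ?L2norm_ge0.
have c : s^-1 *: (g (s *: 1 + t) - g t) @[s --> 0^'] --> l.
  apply/cvgrPdist_le => e e0.
  have [delta delta0 fP] := f_diff (u + t *: h) (divr_gt0 e0 n0).
  near=> s; have s0 : s != 0 by near: s; exact: nbhs_dnbhs_neq.
  have sd : `|s| <= delta / n.
    near: s; apply: dnbhs0_le; exact: divr_gt0.
  have shN : L2norm mu (s *: h) <= `|s| * n.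
    by rewrite L2normZ ler_wpM2l// lerDl.
  have /fP : L2norm mu (s *: h) <= delta.
    by apply: le_trans shN _; rewrite -ler_pdivlMr.
  have -> : u + t *: h + s *: h = u + (s + t) *: h by rewrite [s + t]addrC scalerDl addrA.
  rewrite L2ipZr -/l => h1.
  rewrite -[s *: 1]/(s * 1) mulr1 -[f (u + (s + t) *: h)]/(g (s + t)) in h1 *.
  rewrite -[f (u + t *: h)]/(g t) in h1.
  rewrite -[_ *: _]/(s^-1 * (g (s + t) - g t)).
  rewrite (_ : l - _ = s^-1 * (s * l - (g (s + t) - g t))); last by field.
  rewrite normrM normfV distrC mulrC ler_pdivrMr ?normr_gt0//.
  apply: le_trans h1 _; apply: le_trans (ler_wpM2l (ltW (divr_gt0 e0 n0)) shN) _.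
  by rewrite mulrCA divfK ?gt_eqF// mulrC.
split; first by apply/cvg_ex; exists l.
exact/cvg_lim.
Unshelve. all: by end_near. Qed.

(** The mean value theorem gives the constant M instead of the M/2 of an integral remainder; this
    suffices because the test [descent] carries L without a factor 1/2. *)
Lemma mean_value_le (u h : L2 mu) (M : R) :
  (forall t, 0 <= t <= 1 -> L2norm mu (f' (u + t *: h) - f' u) <= M * L2norm mu (t *: h)) ->
  f (u + h) - f u - L2ip mu (f' u) h <= M * L2norm mu h ^+ 2.
Proof.
move=> fM; pose g (t : R) := f (u + t *: h).
have dg (t : R) : is_derive t 1 g (L2ip mu (f' (u + t *: h)) h) := frechet_is_derive u h t.
have cg : {within `[0, 1], continuous g}.
  apply: derivable_within_continuous => t _.
  exact: (@ex_derive _ _ _ _ _ _ _ (dg t)).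
have [c c01] := MVT ltr01 (fun t _ => dg t) cg.
rewrite subr0 mulr1 /g scale1r scale0r addr0 => ->.
rewrite -L2ipBl; apply: le_trans (ler_norm _) _; apply: le_trans (L2_CS _ _) _.
move: c01; rewrite in_itv/= => /andP[c0 c1].
rewrite expr2 mulrA ler_wpM2r ?L2norm_ge0//.
have c01 : 0 <= c <= 1 by rewrite !ltW.
have h0 := fM c c01; have M0 : 0 <= M * (c * L2norm mu h).
  by have := le_trans (L2norm_ge0 mu _) h0; rewrite L2normZ ger0_norm ?(ltW c0).
apply: le_trans h0 _; rewrite L2normZ ger0_norm ?(ltW c0)//.
have : 0 <= M * L2norm mu h.
  by move: M0; rewrite mulrCA pmulr_rge0.
by move=> h1; rewrite [leLHS]mulrCA ler_piMl// ltW.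
Qed.

End mean_value.

Lemma segmentE (R : pzRingType) (V : lmodType R) (x y : V) (t : R) :
  x + t *: (y - x) = (1 - t) *: x + t *: y.
Proof. by rewrite scalerBl scale1r scalerBr addrA addrAC. Qed.

Lemma L2norm_segment_le (R : realType) disp (X : measurableType disp)
    (mu : {measure set X -> \bar R}) (x y : L2 mu) (t r : R) : 0 <= t <= 1 ->
  L2norm mu x <= r -> L2norm mu y <= r -> L2norm mu (x + t *: (y - x)) <= r.
Proof.
move=> /andP[t0 t1] xr yr; rewrite segmentE (le_trans (L2normD _ _))// !L2normZ.
rewrite (ger0_norm t0) ger0_norm ?subr_ge0//.
rewrite (_ : r = (1 - t) * r + t * r); last by ring.
by rewrite lerD// ler_wpM2l// subr_ge0.
Qed.

(** * Descent of the merit function and bounds on the iterates *)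

Section scheme_sequence.
Context (R : realType) (d : nat) (Omega : lipschitz_domain R d) (T : R).
Hypothesis T_gt0 : 0 < T.
Local Notation D := (dom_measure Omega).
Local Notation C := (cyl_measure T Omega).
Variable W : hspace (L2 D).
Hypothesis gW : good_space W.
Variables (f : L2 C -> R) (f' : L2 C -> L2 C).
Hypotheses (f_below : affinely_bounded_below f) (f_diff : frechet_derivative f f')
  (f'_lip : lipschitz_on_bounded f').
Variables (alpha beta gamma p b L : R).
Hypotheses (alpha_gt0 : 0 < alpha) (beta_gt0 : 0 < beta) (gamma_gt0 : 0 < gamma)
  (p_gt0 : 0 < p) (p_lt1 : p < 1) (b_gt1 : 1 < b) (L_gt0 : 0 < L).
Variable (eps : nat -> R).
Hypotheses (eps_gt0 : forall k, 0 < eps k) (eps_dec : nonincreasing_seq eps).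
Variables (u : nat -> L2 C) (w : nat -> L2 D) (Lk : nat -> R).
Hypothesis uwL_gen : generated W f f' alpha beta gamma p b L eps u w Lk.
Let pW := gs_ph gW.

Lemma iterate_feasible k : feasible W (u k) (w k).
Proof.
case: k => [|k]; first exact: uwL_gen.1.
by have [[]] := uwL_gen.2 k.
Qed.

Let cw k : hcar W (w k) := (iterate_feasible k).1.

Lemma iterate_solves k :
  solves W f' alpha beta gamma p (eps k) (Lk k) (u k) (w k) (u k.+1) (w k.+1).
Proof. by have [] := uwL_gen.2 k. Qed.

Let b_gt0 : 0 < b. Proof. exact: lt_trans ltr01 b_gt1. Qed.

Lemma Lk_gt0 k : 0 < Lk k.
Proof.
by have [_ [_ [l [-> _]]]] := uwL_gen.2 k; rewrite mulr_gt0// exprn_gt0.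
Qed.

(** This is psi_eps(w^2) for eps = eps_k, written as the active tangent so that comparisons reduce
    to [tangent_min]. *)
Definition smooth_density k (x : 'rV[R]_d) : R :=
  tangent p (Num.max (eps k) `|w k x|) (w k x ^+ 2).

Lemma smooth_density_ge0 k x : 0 <= smooth_density k x.
Proof. by apply: tangent_ge0 => //; exact: sqr_ge0. Qed.

(** Bounded by the tangent at eps_k, which is affine in w^2, on a domain of finite measure. *)
Lemma smooth_density_integrable k : D.-integrable setT (fun x => (smooth_density k x)%:E).
Proof.
have mw : measurable_fun setT (w k : 'rV[R]_d -> R) by [].
have icst (c : R) : D.-integrable setT (cst c%:E).
  apply/integrableP; split; first exact: measurable_cst.
  by rewrite integral_cst//= lte_mul_pinfty// dom_measure_lty.
have iw : D.-integrable setT (fun x => (w k x * w k x)%:E).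
  exact: Lfun2M_integrable (LfunP (w k)) (LfunP (w k)).
pose A := eps k `^ (p - 2).
have iS : D.-integrable setT (fun x =>
    ((A * (p / 2))%:E * (w k x * w k x)%:E + cst (A * ((1 - p / 2) * eps k ^+ 2))%:E x)%E).
  by apply: integrableD => //; exact: integrableZl.
apply: le_integrable iS => //.
  apply/measurable_EFinP; apply: measurable_funM.
    apply: (measurableT_comp (measurable_powR _)).
    by apply: measurable_maxr => //; exact: measurableT_comp.
  apply: measurable_funD; first by apply: measurable_funM => //; exact: measurable_funX.
  apply: measurable_funM => //; apply: measurable_funX.
  by apply: measurable_maxr => //; exact: measurableT_comp.
move=> x _; rewrite /= lee_fin ger0_norm ?smooth_density_ge0//.
apply: le_trans (ler_norm _); apply: le_trans (tangent_min p_gt0 p_lt1 _ (eps_gt0 k) (lexx _)) _.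
by rewrite /tangent -/A; rewrite le_eqVlt; apply/orP; left; apply/eqP; ring.
Qed.

Definition merit k : R := f (u k) + alpha / 2 * L2norm C (u k) ^+ 2
  + beta / 2 * hnorm W (w k) ^+ 2 + gamma * \int[D]_x smooth_density k x.

(** The tangent active at step k has its parameter at least eps_k >= eps_(k+1), so by [tangent_min]
    it still majorises the next density. Being affine, it changes by exactly the integrand on the
    right. *)
Lemma smooth_density_step k :
  \int[D]_x smooth_density k.+1 x - \int[D]_x smooth_density k x <=
  \int[D]_x (dpsi p (eps k) (w k x ^+ 2) * (w k.+1 x ^+ 2 - w k x ^+ 2)).
Proof.
have i1 := smooth_density_integrable k.+1; have i0 := smooth_density_integrable k.
rewrite -RintegralB//; apply: le_Rintegral => //.
  exact: (integrableB measurableT i1 i0).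
  have iQ (v : L2 D) : D.-integrable setT (fun x => (reg_weight gamma p (eps k) (w k) x * (v x * v x))%:E)
    := reg_integrable gamma_gt0 p_gt0 p_lt1 (eps_gt0 k) (w k) v.
  have := integrableZl measurableT (2 * gamma)^-1 (integrableB measurableT (iQ (w k.+1)) (iQ (w k))).
  congr (_ .-integrable _ _); apply/funext => x /=; congr EFin.
  by rewrite /reg_weight; field; rewrite gt_eqF.
move=> x _; rewrite lerBlDl (dpsi_sqr p_lt1 _ (eps_gt0 k)).
have ek : eps k.+1 <= Num.max (eps k) `|w k x|.
  by rewrite le_max eps_dec.
apply: le_trans (tangent_min p_gt0 p_lt1 _ (eps_gt0 k.+1) ek) _.
by rewrite (tangent_step p _ (w k x ^+ 2)).
Qed.

(** Add the backtracking test, [solution_gap] and [smooth_density_step]. The test costs L_k times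
    the squared step; the model and the gap contribute L_k / 2 each, and the gap leaves alpha /
    2. *)
Lemma merit_descent k :
  merit k.+1 + alpha / 2 * L2norm C (u k.+1 - u k) ^+ 2
  + beta / 2 * hnorm W (w k.+1 - w k) ^+ 2 <= merit k.
Proof.
have := solution_gap gW alpha_gt0 beta_gt0 gamma_gt0 p_gt0 p_lt1 (eps_gt0 k) (Lk_gt0 k)
  (iterate_solves k) (iterate_feasible k).
have [_ [+ _]] := uwL_gen.2 k; rewrite /descent /model /merit.
have := ler_wpM2l (ltW gamma_gt0) (smooth_density_step k).
rewrite mulrBr.
move: (gamma * _) (gamma * _) (gamma * _) => I2 I1 I0.
move: (L2ip _ _ _) (L2norm C (u k)) (L2norm C (u k.+1)) (L2norm C (_ - _))
  (hnorm W (w k)) (hnorm W (w k.+1)) (hnorm W _) (f (u k)) (f (u k.+1)) (Lk k).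
move=> i nu0 nu1 nu h0 h1 h f0 f1 l H1 H2 H3.
by move: H1 H2 H3; rewrite !mulrDl; nra.
Qed.

(** Half of the alpha term absorbs the affine minorant of f: alpha/4 n^2 - M n + M^2/alpha is the
    square of alpha/2 n - M, divided by alpha. *)
Lemma merit_bounds : exists c : R, forall k,
  c + alpha / 4 * L2norm C (u k) ^+ 2 + beta / 2 * hnorm W (w k) ^+ 2 <= merit k.
Proof.
have [g [c [[glin [M gM]] fg]]] := f_below.
exists (c - M ^+ 2 / alpha) => k.
have := fg (u k); have := gM (u k) I; rewrite ler_norml => /andP[+ _].
rewrite -[hnorm _ _]/(L2norm C (u k)) /merit.
have : 0 <= gamma * \int[D]_x smooth_density k x.
  rewrite mulr_ge0 ?(ltW gamma_gt0)//; apply: Rintegral_ge0 => x _.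
  exact: smooth_density_ge0.
move: (gamma * _) (L2norm C (u k)) (hnorm W (w k)) (f (u k)) (g (u k)) => I nu h fk gk.
have := sqr_ge0 (alpha / 2 * nu - M).
rewrite -(@pmulr_rge0 _ alpha^-1) ?invr_gt0//.
rewrite [X in 0 <= X -> _](_ : _ = alpha / 4 * nu ^+ 2 - M * nu + M ^+ 2 / alpha).
  by lra.
by field; rewrite gt_eqF.
Qed.

Lemma merit_nonincreasing : {homo merit : m n / (m <= n)%N >-> n <= m}.
Proof.
apply: (@homo_leq _ merit (fun x y => y <= x)) => //.
  by move=> x y z h1 h2; exact: le_trans h2 h1.
move=> k; apply: le_trans (merit_descent k).
by rewrite -addrA lerDl addr_ge0// mulr_ge0 ?divr_ge0 ?sqr_ge0 ?(ltW alpha_gt0) ?(ltW beta_gt0).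
Qed.

Lemma iterates_bounded : exists M : R, forall k,
  L2norm C (u k) <= M /\ hnorm W (w k) <= M.
Proof.
have [c cP] := merit_bounds; pose S := merit 0 - c.
pose M := 1 + `|4 / alpha * S| + `|2 / beta * S|.
have key (a x y : R) : 0 < a -> 0 <= x -> a * x ^+ 2 <= y -> x <= 1 + `|a^-1 * y|.
  move=> a0 x0; rewrite -ler_pdivlMl// => h.
  have h' := le_trans h (ler_norm _).
  move: h'; set z := `|_| => h'; rewrite leNgt; apply/negP => hx.
  have z0 : 0 <= z by exact: normr_ge0.
  by have : x <= x ^+ 2; nra.
exists M => k; have h := le_trans (cP k) (merit_nonincreasing (leq0n k)).
have hu : 0 <= alpha / 4 * L2norm C (u k) ^+ 2.
  by rewrite mulr_ge0 ?sqr_ge0// divr_ge0 ?(ltW alpha_gt0).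
have hw : 0 <= beta / 2 * hnorm W (w k) ^+ 2.
  by rewrite mulr_ge0 ?sqr_ge0// divr_ge0 ?(ltW beta_gt0).
split.
  apply: (@le_trans _ _ (1 + `|(alpha / 4)^-1 * S|)).
    apply: key; [by rewrite divr_gt0|exact: L2norm_ge0|].
    by rewrite /S; move: h hw; lra.
  by rewrite invf_div /M -addrA lerD2l lerDl.
apply: (@le_trans _ _ (1 + `|(beta / 2)^-1 * S|)).
  apply: key; [by rewrite divr_gt0|exact: ph_norm_ge0|].
  by rewrite /S; move: h hu; lra.
by rewrite invf_div /M -addrA lerD2l lerDr.
Qed.

(** The merit decreases and is bounded below, so its consecutive differences, which dominate the
    squared steps, tend to zero. *)
Lemma steps_cvg0 : L2norm C (u k.+1 - u k) @[k --> \oo] --> (0 : R) /\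
  hnorm W (w k.+1 - w k) @[k --> \oo] --> (0 : R).
Proof.
have [c cP] := merit_bounds.
have cm : cvgn merit.
  apply: nonincreasing_is_cvgn; first exact: merit_nonincreasing.
  exists c => _ [k _ <-]; apply: le_trans (cP k).
  by rewrite -addrA lerDl addr_ge0// mulr_ge0 ?divr_ge0 ?sqr_ge0 ?(ltW alpha_gt0) ?(ltW beta_gt0).
have m0 : merit k - merit k.+1 @[k --> \oo] --> (0 : R).
  rewrite -[X in _ --> X](subrr (limn merit)); apply: cvgB => //.
  by apply: (cvg_subseq (s := S)) => //; move=> m n; rewrite ltnS.
have key (a : R) : 0 < a -> forall x : nat -> R, (forall k, 0 <= x k) ->
    (forall k, a * x k ^+ 2 <= merit k - merit k.+1) -> x k @[k --> \oo] --> (0 : R).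
  move=> a0 x x0 xm; apply: sqr_cvg0.
  have h : a^-1 * (merit k - merit k.+1) @[k --> \oo] --> (0 : R).
    by rewrite -[X in _ --> X](mulr0 a^-1); exact: cvgMl_tmp.
  by apply: cvg0_le h => k; rewrite ger0_norm ?sqr_ge0// ler_pdivlMl.
have hu k : 0 <= alpha / 2 * L2norm C (u k.+1 - u k) ^+ 2.
  by rewrite mulr_ge0 ?sqr_ge0// divr_ge0 ?(ltW alpha_gt0).
have hw k : 0 <= beta / 2 * hnorm W (w k.+1 - w k) ^+ 2.
  by rewrite mulr_ge0 ?sqr_ge0// divr_ge0 ?(ltW beta_gt0).
split.
  apply: (key (alpha / 2)); [by rewrite divr_gt0|by move=> k; exact: L2norm_ge0|].
  by move=> k; have := merit_descent k; have := hw k; lra.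
apply: (key (beta / 2)); [by rewrite divr_gt0|by move=> k; exact: ph_norm_ge0|].
by move=> k; have := merit_descent k; have := hu k; lra.
Qed.

Lemma gradient_bounded : exists M : R, forall k, L2norm C (f' (u k)) <= M.
Proof.
have [M MP] := iterates_bounded; have [K KP] := f'_lip M.
exists (`|K| * M + L2norm C (f' (u 0%N)) + `|K| * M) => k.
have M0 : 0 <= M := le_trans (L2norm_ge0 C _) (MP 0%N).1.
rewrite -[f' (u k)](subrK (f' (u 0%N))).
apply: le_trans (L2normD _ _) _; rewrite addrAC lerD2r.
apply: le_trans (KP _ _ (MP k).1 (MP 0%N).1) _.
apply: le_trans (ler_wpM2r (L2norm_ge0 C _) (ler_norm K)) _.
rewrite -mulrDr ler_wpM2l// (le_trans (L2normB _ _))//.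
by rewrite lerD// (MP _).1.
Qed.

(** In the energy identity the terms in w are nonnegative, and so is the proximal term as soon as
    the norm of u' exceeds that of u_k; then alpha |u'|^2 <= M |u'|. The bound does not depend on
    the trial constant [l]. *)
Lemma solution_norm_le k (l : R) u' w' (M : R) : 0 < l ->
  solves W f' alpha beta gamma p (eps k) l (u k) (w k) u' w' ->
  L2norm C (f' (u k)) <= M -> L2norm C u' <= L2norm C (u k) + M / alpha.
Proof.
move=> l0 sol fM.
have := solution_energy gW alpha_gt0 beta_gt0 gamma_gt0 p_gt0 p_lt1 (eps_gt0 k) l0 sol.
have cw' : hcar W w' := sol.1.1.
have := ph_ge0 (reg_prehilbert gamma_gt0 p_gt0 p_lt1 (eps_gt0 k) (w k)) (x := w') I.
have := ph_ge0 pW cw'.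
rewrite 2!L2ipDl !L2ipZl L2ipBl -L2norm_sqr.
have /ler_normlP[+ _] := L2_CS (f' (u k)) u'; have /ler_normlP[_] := L2_CS (u k) u'.
have M0 : 0 <= M := le_trans (L2norm_ge0 C _) fM.
have := L2norm_ge0 C u'; have := L2norm_ge0 C (u k); have := L2norm_ge0 C (f' (u k)).
move: fM; move: (L2norm C u') (L2norm C (u k)) (L2norm C (f' (u k))) (L2ip C (f' (u k)) u')
  (L2ip C (u k) u') (hip W _ _) (hip (reg_hspace _ _ _ _) _ _) => n' n nf i1 i2 h1 h2.
move=> fM nf0 n0 n'0 H1 H2 h10 h20 E.
rewrite leNgt; apply/negP => lt.
have ma : 0 <= M / alpha by rewrite divr_ge0// ltW.
have nn' : n < n' by apply: le_lt_trans lt; rewrite lerDl.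
have : M < alpha * n'.
  rewrite -ltr_pdivrMl//; apply: le_lt_trans lt; rewrite mulrC lerDr//.
have n'1 : 0 < n' := le_lt_trans n0 nn'.
have : 0 <= l * (n' ^+ 2 - i2).
  by rewrite mulr_ge0 ?(ltW l0)//; nra.
have : 0 <= beta * h1 by rewrite mulr_ge0// ltW.
by nra.
Qed.

(** If the exponent is l + 1, the trial with exponent l was rejected. Both u_k and the rejected
    point lie in the ball of radius [r], where f' has Lipschitz constant [K]; by [mean_value_le] a
    trial constant at least [K] would have been accepted. Hence L b^l < K, and one more factor b
    bounds L_k. *)
Lemma Lk_bounded : exists Lmax : R, forall k, Lk k <= Lmax.
Proof.
have [M MP] := iterates_bounded; have [F FP] := gradient_bounded.
pose r := M + F / alpha; have [K KP] := f'_lip r.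
have F0 : 0 <= F := le_trans (L2norm_ge0 C _) (FP 0%N).
have Fa0 : 0 <= F / alpha by rewrite divr_ge0// ltW.
exists (L + b * `|K|) => k.
have [_ [_ [[|l] [-> lP]]]] := uwL_gen.2 k.
  by rewrite expr0 mulr1 lerDl mulr_ge0// ltW.
have l0 : 0 < L * b ^+ l by rewrite mulr_gt0// exprn_gt0.
have [] := @solution_exists _ _ _ _ T_gt0 _ gW f' _ beta gamma p (eps k) (L * b ^+ l)
  alpha_gt0 beta_gt0 gamma_gt0 p_gt0 p_lt1 (eps_gt0 k) l0 (u k) (w k).
  by exists (u k, w k); exact: iterate_feasible.
move=> u' [w' sol]; have := lP l u' w' (ltnSn l) sol.
rewrite /descent => /negP; rewrite -ltNge => nd.
have uk_r : L2norm C (u k) <= r by apply: le_trans (MP k).1 _; rewrite lerDl.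
have u'_r : L2norm C u' <= r.
  apply: le_trans (solution_norm_le l0 sol (FP k)) _.
  by rewrite lerD2r (MP k).1.
have seg (t : R) : 0 <= t <= 1 ->
    L2norm C (f' (u k + t *: (u' - u k)) - f' (u k)) <= K * L2norm C (t *: (u' - u k)).
  move=> t01; rewrite -[t *: _ in leRHS](addKr (u k)) [- u k + _]addrC.
  by apply: KP => //; exact: L2norm_segment_le.
have mv := mean_value_le f_diff seg; rewrite subrKC in mv.
have hn : 0 <= L2norm C (u' - u k) by exact: L2norm_ge0.
have LK : L * b ^+ l < K.
  by rewrite ltNge; apply/negP => KL; move: mv nd; nra.
rewrite exprS mulrCA ler_wpDl ?(ltW L_gt0)//.
by rewrite ler_wpM2l ?(ltW b_gt0)// (le_trans (ltW LK) (ler_norm K)).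
Qed.

End scheme_sequence.

(** * Limits of pairings, powers and truncated weights *)

Lemma L2ip_cvg (R : realType) disp (X : measurableType disp)
    (mu : {measure set X -> \bar R}) (x_ y_ : nat -> L2 mu) (x y : L2 mu) (M : R) :
  (forall n, L2norm mu (x_ n) <= M) ->
  (forall h : L2 mu, L2ip mu (x_ n) h @[n --> \oo] --> L2ip mu x h) ->
  L2norm mu (y_ n - y) @[n --> \oo] --> (0 : R) ->
  L2ip mu (x_ n) (y_ n) @[n --> \oo] --> L2ip mu x y.
Proof.
move=> xM xx yy.
have h0 : L2ip mu (x_ n) (y_ n - y) @[n --> \oo] --> (0 : R).
  have hM : M * L2norm mu (y_ n - y) @[n --> \oo] --> (0 : R).
    by rewrite -[X in _ --> X](mulr0 M); exact: cvgMl_tmp.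
  apply: cvg0_le hM => n; apply: le_trans (L2_CS _ _) _.
  by rewrite ler_wpM2r ?L2norm_ge0.
rewrite -[L2ip mu x y]add0r (_ : (fun n => _) =
  (fun n => L2ip mu (x_ n) (y_ n - y) + L2ip mu (x_ n) y)); first exact: cvgD.
by apply/funext => n; rewrite L2ipBr subrK.
Qed.

Lemma powR_cvg (R : realType) (a x : R) (x_ : nat -> R) : 0 < x ->
  x_ n @[n --> \oo] --> x -> x_ n `^ a @[n --> \oo] --> x `^ a.
Proof.
move=> x0 xx; have dx := @is_derive1_powR R a x x0.
have /derivable1_diffP/differentiable_continuous cx := @ex_derive _ _ _ _ _ _ _ dx.
exact: (cvg_comp x_ (fun y => y `^ a) xx cx).
Qed.

Section pointwise_limits.
Context (R : realType).

Lemma cvg_max (x_ y_ : nat -> R) (x y : R) : x_ n @[n --> \oo] --> x ->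
  y_ n @[n --> \oo] --> y -> Num.max (x_ n) (y_ n) @[n --> \oo] --> Num.max x y.
Proof.
move=> xx yy; have e (a c : R) : Num.max a c = (a + c + `|a - c|) / 2.
  by rewrite maxr_absE; congr (_ / 2); rewrite addrC.
rewrite e (_ : (fun n => _) = (fun n => (x_ n + y_ n + `|x_ n - y_ n|) / 2)).
  apply: cvgMr_tmp; apply: cvgD; first exact: cvgD.
  by apply: cvg_norm; exact: cvgB.
by apply/funext => n; rewrite e.
Qed.

Lemma cvg_min (x_ y_ : nat -> R) (x y : R) : x_ n @[n --> \oo] --> x ->
  y_ n @[n --> \oo] --> y -> Num.min (x_ n) (y_ n) @[n --> \oo] --> Num.min x y.
Proof.
move=> xx yy; have e (a c : R) : Num.min a c = - Num.max (- a) (- c).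
  by rewrite oppr_max !opprK.
rewrite e (_ : (fun n => _) = (fun n => - Num.max (- x_ n) (- y_ n))).
  by apply: cvgN; apply: cvg_max; exact: cvgN.
by apply/funext => n; rewrite e.
Qed.

(* Truncating by the limit makes the convergence hold also where the limit is 0,
   where the first factor may blow up. *)
Lemma cvg_min_weight (p : R) (eps x_ y_ : nat -> R) (x : R) : 0 < p ->
  (forall n, 0 < eps n) -> eps n @[n --> \oo] --> (0 : R) ->
  x_ n @[n --> \oo] --> x -> y_ n @[n --> \oo] --> x ->
  Num.min (Num.max (eps n) `|x_ n| `^ (p - 2) * y_ n ^+ 2) (`|x| `^ p)
    @[n --> \oo] --> `|x| `^ p.
Proof.
move=> p0 e0 ec xx yx; have [->|xN0] := eqVneq x 0.
  rewrite normr0 powR0 ?gt_eqF// (_ : (fun n => _) = (fun=> 0)); first exact: cvg_cst.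
  by apply/funext => n; rewrite min_r// mulr_ge0 ?powR_ge0 ?sqr_ge0.
have x0 : 0 < `|x| by rewrite normr_gt0.
have h : Num.max (eps n) `|x_ n| `^ (p - 2) * (y_ n * y_ n) @[n --> \oo] -->
    `|x| `^ (p - 2) * (x * x).
  apply: cvgM; last exact: cvgM.
  apply: powR_cvg => //; rewrite -[X in _ --> X](@max_r _ _ 0 `|x|) ?normr_ge0//.
  by apply: cvg_max => //; exact: cvg_norm.
rewrite -[X in _ --> X](minxx (`|x| `^ p)).
apply: cvg_min; last exact: cvg_cst.
rewrite -(powR_expr2 p x0) real_normK ?num_real// expr2.
Qed.

End pointwise_limits.

Lemma Rintegral_le0_ge0_ae0 (R : realType) disp (X : measurableType disp)
    (mu : {measure set X -> \bar R}) (f : X -> R) :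
  mu.-integrable setT (fun x => (f x)%:E) -> {ae mu, forall x, f x <= 0} ->
  0 <= \int[mu]_x f x -> {ae mu, forall x, f x = 0}.
Proof.
move=> fi f0 If; have mf : measurable_fun setT (fun x => (f x)%:E) := measurable_int _ fi.
have e : (\int[mu]_x `|(f x)%:E| = (-1)%:E * \int[mu]_x (f x)%:E)%E.
  rewrite -(integralZl measurableT fi); apply: ae_eq_integral => //.
  - exact: measurableT_comp.
  - by apply: emeasurable_funM.
  - by apply: filterS f0 => x fx _ /=; rewrite -EFinM mulN1r ler0_norm.
have : (\int[mu]_x `|(f x)%:E| = 0)%E.
  apply/eqP; rewrite eq_le integral_ge0// andbT e.
  rewrite -(fineK (integrable_fin_num measurableT fi)) -EFinM lee_fin mulN1r oppr_le0.
  exact: If.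
move/(ae_eq_integral_abs mu measurableT mf); apply: filterS => x /(_ I) /= [].
by [].
Qed.

(** * Optimality conditions at the weak limit *)

Section limit_point.
Context (R : realType) (d : nat) (Omega : lipschitz_domain R d) (T : R).
Hypothesis T_gt0 : 0 < T.
Local Notation D := (dom_measure Omega).
Local Notation C := (cyl_measure T Omega).
Variable W : hspace (L2 D).
Hypothesis gW : good_space W.
Variables (f : L2 C -> R) (f' : L2 C -> L2 C).
Hypotheses (f_below : affinely_bounded_below f) (f_diff : frechet_derivative f f')
  (f'_cc : completely_continuous f') (f'_lip : lipschitz_on_bounded f').
Variables (alpha beta gamma p b L : R).
Hypotheses (alpha_gt0 : 0 < alpha) (beta_gt0 : 0 < beta) (gamma_gt0 : 0 < gamma)
  (p_gt0 : 0 < p) (p_lt1 : p < 1) (b_gt1 : 1 < b) (L_gt0 : 0 < L).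
Variable (eps : nat -> R).
Hypotheses (eps_gt0 : forall k, 0 < eps k) (eps_dec : nonincreasing_seq eps)
  (eps_cvg : eps n @[n --> \oo] --> (0 : R)).
Variables (u : nat -> L2 C) (w : nat -> L2 D) (Lk : nat -> R).
Hypothesis uwL_gen : generated W f f' alpha beta gamma p b L eps u w Lk.
Variables (kn : nat -> nat) (ubar : L2 C) (wbar : L2 D).
Hypotheses (kn_incr : {homo kn : m n / (m < n)%N}) (wbar_W : hcar W wbar)
  (u_cvg : weak_cvg (L2_hspace C) (u \o kn) ubar) (w_cvg : weak_cvg W (w \o kn) wbar).
Let pW := gs_ph gW.

Let cw k : hcar W (w k) := (iterate_feasible uwL_gen k).1.

Let bounded := iterates_bounded gW f_below alpha_gt0 beta_gt0 gamma_gt0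
  p_gt0 p_lt1 b_gt1 L_gt0 eps_gt0 eps_dec uwL_gen.

Let steps := steps_cvg0 gW f_below alpha_gt0 beta_gt0 gamma_gt0
  p_gt0 p_lt1 b_gt1 L_gt0 eps_gt0 eps_dec uwL_gen.

Lemma time_ext_dual (h : L2 C) : in_dual W (fun z => L2ip C (time_ext T z) h).
Proof.
have [c c0 Wc] := gs_embed gW; split=> [a x y _ _|].
  by rewrite time_ext_lin L2ipDl L2ipZl.
exists (L2norm C h * (Num.sqrt T * c)) => x cx.
apply: le_trans (L2_CS _ _) _; rewrite (L2norm_time_ext T_gt0) mulrC -!mulrA.
by rewrite ler_wpM2l ?L2norm_ge0// ler_wpM2l ?sqrtr_ge0// Wc.
Qed.

(** The weight of a step is evaluated at w_k but multiplies the square of w_(k+1), so both must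
    converge at the same points. Compactness gives the first; the steps tend to zero in L2, and a
    further extraction gives the second. *)
Lemma ae_subsequence : exists s : nat -> nat, [/\ {homo s : m n / (m < n)%N},
  weak_cvg (L2_hspace C) (u \o s) ubar, weak_cvg W (w \o s) wbar,
  {ae D, forall x, w (s k) x @[k --> \oo] --> wbar x} &
  {ae D, forall x, w (s k).+1 x @[k --> \oo] --> wbar x}].
Proof.
have [M MP] := bounded; have [c c0 Wc] := gs_embed gW.
have [s hs sP] := gs_compact gW (fun n => cw (kn n)) wbar_W (fun n => (MP (kn n)).2) w_cvg.
pose t n := kn (s n).
have ht : {homo t : m n / (m < n)%N} by move=> m n mn; exact/kn_incr/hs.
have dw : L2norm D ((w (t n).+1 - w (t n)) - 0) @[n --> \oo] --> (0 : R).
  have hc : c * hnorm W (w (t n).+1 - w (t n)) @[n --> \oo] --> (0 : R).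
    rewrite -[X in _ --> X](mulr0 c); apply: cvgMl_tmp.
    exact: (cvg_subseq ht steps.2).
  apply: cvg0_le hc => n; rewrite ger0_norm ?L2norm_ge0//.
  rewrite (subr0 (w (t n).+1 - w (t n))); apply: Wc; exact: (phB pW).
have [r hr rP] := L2_cvg_ae_subseq dw.
exists (t \o r); split => /=.
- by move=> m n mn; exact/ht/hr.
- by move=> l ld; apply: (cvg_subseq (s := s \o r) _ (u_cvg ld)) => m n mn; exact/hs/hr.
- by move=> l ld; apply: (cvg_subseq (s := s \o r) _ (w_cvg ld)) => m n mn; exact/hs/hr.
- by apply: filterS sP => x sx; exact: (cvg_subseq hr sx).
apply: filterS (filterI sP rP) => x [sx rx].
rewrite -[wbar x]add0r (_ : (fun k => _) =
    (fun k => (w (t (r k)).+1 - w (t (r k))) x + w (t (r k)) x)).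
  by apply: cvgD => //; exact: (cvg_subseq hr sx).
by apply/funext => k; rewrite -[RHS]/(w (t (r k)).+1 x - w (t (r k)) x + w (t (r k)) x) subrK.
Qed.

(** Feasibility is weakly closed. Keeping the second component of a step fixed removes the terms in
    W and the penalty from its variational inequality, whose limit yields the pointwise identity.
    The energy identity survives as an inequality because its quadratic terms are only lower
    semicontinuous. *)
Lemma limit_conditions :
  {ae C, forall x, `|ubar x| <= wbar x.2} /\
  {ae C, forall x, (f' ubar + alpha *: ubar) x * ubar x
     = - (`|(f' ubar + alpha *: ubar) x| * wbar x.2)} /\
  L2ip C (f' ubar + alpha *: ubar) ubar + beta * hip W wbar wbar
  + gamma * (p * \int[D]_x (`|wbar x| `^ p)) <= 0.
Proof.
have [M MP] := bounded.
have [Lm LmP] := Lk_bounded T_gt0 gW f_below f_diff f'_lip alpha_gt0 beta_gt0 gamma_gt0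
  p_gt0 p_lt1 b_gt1 L_gt0 eps_gt0 eps_dec uwL_gen.
have [s [hs us ws wae w'ae]] := ae_subsequence.
have du : L2norm C (u (s n).+1 - u (s n)) @[n --> \oo] --> (0 : R).
  exact: (cvg_subseq hs steps.1).
have dw : hnorm W (w (s n).+1 - w (s n)) @[n --> \oo] --> (0 : R).
  exact: (cvg_subseq hs steps.2).
pose U n := u (s n).+1; pose V n := w (s n).+1.
have cV n : hcar W (V n) by exact: cw.
have uw (l : L2 C -> R) : in_dual (L2_hspace C) l -> l (U n) @[n --> \oo] --> l ubar.
  move=> ld; exact: (dual_cvg_perturb (L2_prehilbert C) ld (x_ := u \o s) (y_ := U)
    (fun=> I) (fun=> I) (us l ld) du).
have ww (l : L2 D -> R) : in_dual W l -> l (V n) @[n --> \oo] --> l wbar.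
  move=> ld; exact: (dual_cvg_perturb pW ld (x_ := w \o s) (y_ := V)
    (fun=> cw _) cV (ws l ld) dw).
have Uh (h : L2 C) : L2ip C (U n) h @[n --> \oo] --> L2ip C ubar h.
  rewrite (_ : (fun n => _) = (fun n => L2ip C h (U n))).
    by rewrite [X in _ --> X]L2ipC; exact: (uw _ (L2_in_dual h)).
  by apply/funext => n; rewrite L2ipC.
have feas : feasible W ubar wbar.
  apply: (feasible_limit (fun n => iterate_feasible uwL_gen (s n).+1) wbar_W Uh) => h.
  exact: (ww _ (time_ext_dual h)).
have wbar0 := feasible_ge0 feas.
pose G := f' ubar + alpha *: ubar.
(* The part of the u-gradient that converges strongly: f' is completely continuous, the L_k are
   bounded and the steps vanish. The term alpha u converges only weakly and is kept apart. *)
pose r n := f' (u (s n)) + Lk (s n) *: (U n - u (s n)).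
have rc : L2norm C (r n - f' ubar) @[n --> \oo] --> (0 : R).
  have hc : L2norm C (f' (u (s n)) - f' ubar) + Lm * L2norm C (U n - u (s n))
      @[n --> \oo] --> (0 : R).
    rewrite -[X in _ --> X](addr0 0) -[X in _ --> _ + X](mulr0 Lm).
    by apply: cvgD; [exact: (f'_cc us)|exact: cvgMl_tmp].
  apply: cvg0_le hc => n; rewrite ger0_norm ?L2norm_ge0// /r addrAC.
  rewrite (le_trans (L2normD _ _))// lerD2l L2normZ ler_wpM2r ?L2norm_ge0//.
  by rewrite gtr0_norm ?LmP// (Lk_gt0 b_gt1 L_gt0 uwL_gen).
have UM n : L2norm C (U n) <= M := (MP _).1.
have rU : L2ip C (r n) (U n) @[n --> \oo] --> L2ip C (f' ubar) ubar.
  rewrite [X in _ --> X]L2ipC (_ : (fun n => _) = (fun n => L2ip C (U n) (r n))).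
    exact: L2ip_cvg UM Uh rc.
  by apply/funext => n; rewrite L2ipC.
(* The squared norm is replaced by its affine minorant at [ubar], along which weak limits can be
   taken. *)
have Usqr n : 2 * L2ip C ubar (U n) - L2norm C ubar ^+ 2 <= L2norm C (U n) ^+ 2.
  have := ph_ge0 (L2_prehilbert C) (x := U n - ubar) I.
  rewrite (ph_sqrB (L2_prehilbert C) (x := U n) (y := ubar) I I).
  rewrite -[hip _ (U n) (U n)]/(L2ip C (U n) (U n)) -[hip _ ubar ubar]/(L2ip C ubar ubar).
  by rewrite -[hip _ (U n) ubar]/(L2ip C (U n) ubar) !L2norm_sqr (L2ipC (U n)); lra.
have ubU : 2 * L2ip C ubar (U n) - L2norm C ubar ^+ 2 @[n --> \oo] --> L2norm C ubar ^+ 2.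
  have e : 2 * L2ip C ubar ubar - L2norm C ubar ^+ 2 = L2norm C ubar ^+ 2.
    by rewrite L2norm_sqr; ring.
  rewrite -[X in _ --> X]e; apply: cvgB; last exact: cvg_cst.
  by apply: cvgMl_tmp; exact: (uw _ (L2_in_dual ubar)).
split; first exact: feas.2.
split.
- pose sg x : R := if 0 <= G x then 1 else -1.
  have sgG x : sg x * G x = `|G x|.
    by rewrite /sg; case: leP => h; [rewrite mul1r ger0_norm|rewrite mulN1r ltr0_norm].
  have sg1 x : `|sg x| = 1 by rewrite /sg; case: ifP; rewrite ?normrN1 ?normr1.
  have msg : measurable_fun setT sg.
    apply: measurable_fun_ifT => //.
    by apply: measurable_fun_ler.
  have mw2 (z : L2 D) : measurable_fun setT (fun x : measurableTypeR R * 'rV[R]_d => z x.2).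
    by apply: (@measurableT_comp _ _ _ _ _ _ (z : 'rV[R]_d -> R)) => //; exact: measurable_snd.
  (* The desired test function is -sg wbar. Truncating by [V n] makes it feasible together with
     [V n]; truncating by [wbar] gives a dominated, hence strongly convergent, sequence. *)
  pose v_fun (z : L2 D) (x : measurableTypeR R * 'rV[R]_d) :=
    - sg x * Num.max 0 (Num.min (z x.2) (wbar x.2)).
  have v_le z x : `|v_fun z x| <= `|wbar x.2|.
    rewrite normrM normrN sg1 mul1r ger0_norm ?le_max ?lexx//.
    rewrite ge_max normr_ge0/= ge_min; apply/orP; right; exact: ler_norm.
  have vL z : v_fun z \in Lfun C 2%:E.
    apply: (Lfun2_le _ (LfunP (time_ext T wbar)) (v_le z)).
    apply: measurable_funM; first exact: measurable_funN.
    by apply: measurable_maxr => //; exact: measurable_minr.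
  pose v_ n : L2 C := Lfun_Sub (lee1n 2) (vL (V n)).
  pose v : L2 C := Lfun_Sub (lee1n 2) (vL wbar).
  have vv : L2norm C (v_ n - v) @[n --> \oo] --> (0 : R).
    apply: (L2_dominated (LfunP (time_ext T wbar))).
    + have := ae_time_ext T_gt0 w'ae; apply: filterS => x wx.
      apply: cvgMl_tmp; apply: cvg_max; first exact: cvg_cst.
      by apply: cvg_min => //; exact: cvg_cst.
    + by apply: aeW => x n; exact: v_le.
    + by apply: aeW => x; exact: v_le.
  have vM n : L2norm C (v_ n) <= L2norm C (time_ext T wbar).
    apply: sqint_leP; first exact: L2norm_ge0.
    rewrite L2norm_sqint; apply: le_sqint (v_le (V n)); first exact: Lfun2_measurable (vL _).
    exact: mw2.
  have rv : L2ip C (r n) (v_ n) @[n --> \oo] --> L2ip C (f' ubar) v.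
    rewrite [X in _ --> X]L2ipC (_ : (fun n => _) = (fun n => L2ip C (v_ n) (r n))).
      exact: L2ip_cvg vM (L2_strong_weak vv) rc.
    by apply/funext => n; rewrite L2ipC.
  have vfeas n : feasible W (v_ n) (V n).
    split=> //; have V0 := feasible_ge0 (iterate_feasible uwL_gen (s n).+1 : feasible W (U n) (V n)).
    apply: filterS (filterI wbar0 V0) => x [wx Vx].
    rewrite -[X in `|X|]/(v_fun (V n) x) normrM normrN sg1 mul1r ger0_norm ?le_max ?lexx//.
    by rewrite ge_max Vx/= ge_min lexx.
  have foc n : 0 <= L2ip C (r n) (v_ n) + alpha * L2ip C (U n) (v_ n)
      - (L2ip C (r n) (U n) + alpha * (2 * L2ip C ubar (U n) - L2norm C ubar ^+ 2)).
    have Lk0 := Lk_gt0 b_gt1 L_gt0 uwL_gen (s n).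
    have := solution_foc gW alpha_gt0 beta_gt0 gamma_gt0 p_gt0 p_lt1 (eps_gt0 (s n)) Lk0
      (iterate_solves uwL_gen (s n)) (vfeas n).
    rewrite -/(U n) -/(V n) (subrr (V n)).
    rewrite (phC pW (cV n) (ph0 pW)) (ph0l pW (cV n)) mulr0 addr0.
    have pQ := reg_prehilbert gamma_gt0 p_gt0 p_lt1 (eps_gt0 (s n)) (w (s n)).
    rewrite (phC pQ (x := V n) (y := 0) I I) (ph0l pQ (z := V n) I) addr0.
    rewrite (addrCA (f' (u (s n)))) -/(r n) L2ipDl L2ipZl !L2ipBr -L2norm_sqr.
    by have := ler_wpM2l (ltW alpha_gt0) (Usqr n); lra.
  have lim : 0 <= L2ip C G (v - ubar).
    have -> : L2ip C G (v - ubar) = L2ip C (f' ubar) v + alpha * L2ip C ubar v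
        - (L2ip C (f' ubar) ubar + alpha * L2norm C ubar ^+ 2).
      by rewrite L2ipDl L2ipZl !L2ipBr -L2norm_sqr; ring.
    have cc : L2ip C (r n) (v_ n) + alpha * L2ip C (U n) (v_ n)
      - (L2ip C (r n) (U n) + alpha * (2 * L2ip C ubar (U n) - L2norm C ubar ^+ 2))
      @[n --> \oo] --> L2ip C (f' ubar) v + alpha * L2ip C ubar v
        - (L2ip C (f' ubar) ubar + alpha * L2norm C ubar ^+ 2).
      apply: cvgB; apply: cvgD => //; apply: cvgMl_tmp => //.
      exact: L2ip_cvg UM Uh vv.
    by apply: (cvgr_to_ge cc); near=> n; exact: foc.
  have Gv x : 0 <= wbar x.2 -> `|ubar x| <= wbar x.2 ->
      G x * (v - ubar) x = - (`|G x| * wbar x.2) - G x * ubar x.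
    move=> wx ux; rewrite -[(v - ubar) x]/(v_fun wbar x - ubar x) /v_fun minxx max_r//.
    by rewrite -sgG; ring.
  (* By |ubar| <= wbar this integrand is nonpositive, while [lim] makes its integral nonnegative; so
     it vanishes almost everywhere. *)
  have ae0 := Rintegral_le0_ge0_ae0 (Lfun2M_integrable (LfunP G) (LfunP (v - ubar))) _ lim.
  have Gae : {ae C, forall x, G x * (v - ubar) x = 0}.
    apply: ae0; apply: filterS (filterI wbar0 feas.2) => x [wx ux].
    rewrite Gv// subr_le0 lerNl -mulrN.
    by apply: le_trans (ler_norm _) _; rewrite normrM normrN ler_wpM2l.
  apply: filterS (filterI (filterI wbar0 feas.2) Gae) => x [[wx ux]].
  rewrite Gv// => /eqP; rewrite subr_eq0 => /eqP ->.
  exact: erefl.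
(* Capping by |wbar|^p does not change the limit and forces convergence where wbar = 0, where the
   weight may blow up. *)
- pose F n x := Num.min (Num.max (eps (s n)) `|w (s n) x| `^ (p - 2) * V n x ^+ 2)
    (`|wbar x| `^ p).
  have gp0 : 0 < gamma * p by rewrite mulr_gt0.
  (* The energy identity solved for the weighted integral, with both squared norms replaced by
     affine minorants so that the right-hand side converges. *)
  pose c_ n := (gamma * p)^-1 * - (L2ip C (r n) (U n)
    + alpha * (2 * L2ip C ubar (U n) - L2norm C ubar ^+ 2)
    + beta * (2 * hip W wbar (V n) - hip W wbar wbar)).
  pose c := (gamma * p)^-1 * - (L2ip C (f' ubar) ubar + alpha * L2norm C ubar ^+ 2
    + beta * hip W wbar wbar).
  have cc : c_ n @[n --> \oo] --> c.
    apply: cvgMl_tmp; apply: cvgN; apply: cvgD; first by apply: cvgD => //; exact: cvgMl_tmp.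
    apply: cvgMl_tmp; have e : 2 * hip W wbar wbar - hip W wbar wbar = hip W wbar wbar by ring.
    rewrite -[X in _ --> X]e; apply: cvgB; last exact: cvg_cst.
    by apply: cvgMl_tmp; exact: (ww _ (in_dual_ip pW wbar_W)).
  have mF1 n : measurable_fun setT
      (fun x => Num.max (eps (s n)) `|w (s n) x| `^ (p - 2) * V n x ^+ 2).
    apply: measurable_funM; last exact: measurable_funX.
    apply: (measurableT_comp (measurable_powR _)).
    by apply: measurable_maxr => //; exact: measurableT_comp.
  have mG : measurable_fun setT (fun x => `|wbar x| `^ p).
    by apply: (measurableT_comp (measurable_powR _)); exact: measurableT_comp.
  have Fc n : (\int[D]_x (F n x)%:E <= (c_ n)%:E)%E.
    have pQ := reg_prehilbert gamma_gt0 p_gt0 p_lt1 (eps_gt0 (s n)) (w (s n)).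
    pose QV := hip (reg_hspace gamma p (eps (s n)) (w (s n))) (V n) (V n).
    have iQ := reg_integrable gamma_gt0 p_gt0 p_lt1 (eps_gt0 (s n)) (w (s n)) (V n).
    have QE : (\int[D]_x (reg_weight gamma p (eps (s n)) (w (s n)) x * (V n x * V n x))%:E = QV%:E)%E.
      exact: (esym (fineK (integrable_fin_num measurableT iQ))).
    apply: (@le_trans _ _ (((gamma * p)^-1 * QV)%:E)).
      rewrite EFinM -QE -integralZl//; apply: ge0_le_integral => //.
      - by move=> x _; rewrite lee_fin le_min powR_ge0 mulr_ge0 ?powR_ge0 ?sqr_ge0.
      - by apply/measurable_EFinP; exact: measurable_minr.
      - by apply: emeasurable_funM => //; exact: (measurable_int _ iQ).
      - move=> x _; rewrite -EFinM lee_fin /F ge_min; apply/orP; left.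
        rewrite /reg_weight (dpsi_sqr p_lt1 _ (eps_gt0 (s n))) le_eqVlt; apply/orP; left.
        by apply/eqP; field; rewrite !gt_eqF.
    rewrite lee_fin /c_ ler_pM2l ?invr_gt0//.
    have Lk0 := Lk_gt0 b_gt1 L_gt0 uwL_gen (s n).
    have := solution_energy gW alpha_gt0 beta_gt0 gamma_gt0 p_gt0 p_lt1 (eps_gt0 (s n)) Lk0
      (iterate_solves uwL_gen (s n)).
    rewrite -/(U n) -/(V n) -/QV (addrCA (f' (u (s n)))) -/(r n) L2ipDl L2ipZl -L2norm_sqr.
    have := ler_wpM2l (ltW alpha_gt0) (Usqr n).
    have : beta * (2 * hip W wbar (V n) - hip W wbar wbar) <= beta * hip W (V n) (V n).
      rewrite ler_wpM2l ?(ltW beta_gt0)//.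
      have := ph_ge0 pW (phB pW (cV n) wbar_W).
      by rewrite (ph_sqrB pW (cV n) wbar_W) (phC pW (cV n) wbar_W); lra.
    by lra.
  have FG : {ae D, forall x, F n x @[n --> \oo] --> `|wbar x| `^ p}.
    apply: filterS (filterI wae w'ae) => x [wx w'x].
    apply: (cvg_min_weight p_gt0 _ _ wx w'x) => //.
    exact: (cvg_subseq hs eps_cvg).
  have F0 n x : 0 <= F n x.
    by rewrite le_min powR_ge0 mulr_ge0 ?powR_ge0 ?sqr_ge0.
  have h := fatou_cvg (fun n => measurable_minr (mF1 n) mG) mG F0
    (fun x => powR_ge0 _ _) FG Fc cc.
  have I0 : (0 <= \int[D]_x (`|wbar x| `^ p)%:E)%E.
    by apply: integral_ge0 => x _; rewrite lee_fin powR_ge0.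
  have : \int[D]_x (`|wbar x| `^ p) <= c.
    rewrite -lee_fin /Rintegral fineK//.
    by rewrite ge0_fin_numE// (le_lt_trans h (ltry _)).
  rewrite -(ler_pM2l gp0) mulVKf ?gt_eqF// -mulrA.
  by rewrite L2ipDl L2ipZl -L2norm_sqr; lra.
Unshelve. all: by end_near. Qed.

End limit_point.

Lemma L2ip_ae_eq (R : realType) disp (X : measurableType disp)
    (mu : {measure set X -> \bar R}) (x y x' y' : L2 mu) :
  {ae mu, forall t, x t * y t = x' t * y' t} -> L2ip mu x y = L2ip mu x' y'.
Proof.
move=> xy; congr fine; apply: ae_eq_integral => //.
- by apply/measurable_EFinP; exact: measurable_funM.
- by apply/measurable_EFinP; exact: measurable_funM.
by apply: filterS xy => t -> _.
Qed.

Lemma L2ip_ae_le0 (R : realType) disp (X : measurableType disp)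
    (mu : {measure set X -> \bar R}) (x y : L2 mu) :
  {ae mu, forall t, x t * y t <= 0} -> L2ip mu x y <= 0.
Proof.
move=> xy; rewrite -oppr_ge0; pose F t := Num.max (- (x t * y t)) 0.
rewrite (_ : - L2ip mu x y = \int[mu]_t F t).
  by apply: Rintegral_ge0 => t _; rewrite le_max lexx orbT.
rewrite -mulN1r /L2ip -RintegralZl//; last exact: (Lfun2M_integrable (LfunP x) (LfunP y)).
have mxy : measurable_fun setT (fun t => x t * y t) by exact: measurable_funM.
congr fine; apply: ae_eq_integral => //.
- by apply/measurable_EFinP; exact: measurable_funM.
- apply/measurable_EFinP; apply: measurable_maxr => //.
  by rewrite (_ : (fun t => _) = \- (fun t => x t * y t)) //; exact: measurable_funN.
by apply: filterS xy => t h _ /=; rewrite /F mulN1r max_l// oppr_ge0.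
Qed.

Lemma in_dual_comb (R : realType) (V : lmodType R) (H : hspace V) (a c : R) (l m : V -> R) :
  in_dual H l -> in_dual H m -> in_dual H (fun x => a * l x + c * m x).
Proof.
move=> [llin [M lM]] [mlin [N mN]]; split=> [t x y cx cy|].
  by rewrite llin// mlin//; ring.
exists (`|a| * M + `|c| * N) => x cx.
rewrite (le_trans (ler_normD _ _))// !normrM mulrDl -!mulrA lerD// ler_wpM2l//.
  exact: lM.
exact: mN.
Qed.

(** * Construction of the multipliers *)

Section stationarity.
Context (R : realType) (d : nat) (Omega : lipschitz_domain R d) (T : R).
Hypothesis T_gt0 : 0 < T.
Local Notation D := (dom_measure Omega).
Local Notation C := (cyl_measure T Omega).
Variable W : hspace (L2 D).
Hypothesis gW : good_space W.
Variables (f : L2 C -> R) (f' : L2 C -> L2 C).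
Hypotheses (f_below : affinely_bounded_below f) (f_diff : frechet_derivative f f')
  (f'_cc : completely_continuous f') (f'_lip : lipschitz_on_bounded f').
Variables (alpha beta gamma p b L : R).
Hypotheses (alpha_gt0 : 0 < alpha) (beta_gt0 : 0 < beta) (gamma_gt0 : 0 < gamma)
  (p_gt0 : 0 < p) (p_lt1 : p < 1) (b_gt1 : 1 < b) (L_gt0 : 0 < L).
Variable (eps : nat -> R).
Hypotheses (eps_gt0 : forall k, 0 < eps k) (eps_dec : nonincreasing_seq eps)
  (eps_cvg : eps n @[n --> \oo] --> (0 : R)).
Variables (u : nat -> L2 C) (w : nat -> L2 D) (Lk : nat -> R).
Hypothesis uwL_gen : generated W f f' alpha beta gamma p b L eps u w Lk.
Variables (kn : nat -> nat) (ubar : L2 C) (wbar : L2 D).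
Hypotheses (kn_incr : {homo kn : m n / (m < n)%N}) (wbar_W : hcar W wbar)
  (u_cvg : weak_cvg (L2_hspace C) (u \o kn) ubar) (w_cvg : weak_cvg W (w \o kn) wbar).

Let pW := gs_ph gW.

(** Where G <= 0, the identity G ubar = -|G| wbar reads G (wbar - ubar) = 0, and [mu1] vanishes
    elsewhere; so [mu1] is nonpositive and complementary to wbar - ubar. The argument for [mu2] is
    symmetric. *)
Lemma limit_stationary :
  exists (lam : L2 D -> R) (mu1 mu2 : L2 C),
    [/\ in_dual W lam,
        forall (v : L2 C) (z : L2 D), hcar W z ->
          L2ip C (f' ubar) v + alpha * L2ip C ubar v
          + beta * hip W wbar z + gamma * lam z
          + L2ip C mu1 (time_ext T z - v) + L2ip C mu2 (time_ext T z + v) = 0,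
        p * (\int[D]_x (`|wbar x| `^ p))%R <= lam wbar,
        subdiff_indicator (nonneg_cone (mu := C)) (time_ext T wbar - ubar) mu1 &
        subdiff_indicator (nonneg_cone (mu := C)) (time_ext T wbar + ubar) mu2].
Proof.
have [feas [Gu energy]] := limit_conditions T_gt0 gW f_below f_diff f'_cc f'_lip
  alpha_gt0 beta_gt0 gamma_gt0 p_gt0 p_lt1 b_gt1 L_gt0 eps_gt0 eps_dec eps_cvg
  uwL_gen kn_incr wbar_W u_cvg w_cvg.
set G := f' ubar + alpha *: ubar in Gu energy.
have mG : measurable_fun setT (G : measurableTypeR R * 'rV[R]_d -> R) by [].
have m1L : (fun x => Num.min (G x) 0) \in Lfun C 2%:E.
  apply: (Lfun2_le _ (LfunP G)) => [|x]; first exact: measurable_minr.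
  by rewrite /Num.min; case: ifP => //; rewrite normr0.
have m2L : (fun x => - Num.max (G x) 0) \in Lfun C 2%:E.
  apply: (Lfun2_le _ (LfunP G)) => [|x].
    by apply: measurable_funN; exact: measurable_maxr.
  by rewrite normrN /Num.max; case: ifP => //; rewrite normr0.
pose mu1 : L2 C := Lfun_Sub (lee1n 2) m1L.
pose mu2 : L2 C := Lfun_Sub (lee1n 2) m2L.
have mu1E x : mu1 x = Num.min (G x) 0 by [].
have mu2E x : mu2 x = - Num.max (G x) 0 by [].
have mu12 : mu1 - mu2 = G.
  apply/LfuneqP => x; rewrite -[LHS]/(Num.min (G x) 0 - - Num.max (G x) 0) opprK.
  by rewrite addr_min_max addr0.
have mu12N x : (mu1 + mu2) x = - `|G x|.
  rewrite -[LHS]/(Num.min (G x) 0 - Num.max (G x) 0).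
  by case: leP => h; [rewrite subr0 ler0_norm ?opprK|rewrite sub0r gtr0_norm].
have sgn_cases := (feas, Gu).
(* Stationarity in z solved for lambda. Evaluated at [wbar], the pairing with mu1 + mu2 = -|G| is
   (G, ubar), so the energy inequality becomes the lower bound. *)
pose lam (z : L2 D) := (- (beta / gamma)) * hip W wbar z
  + (- gamma^-1) * L2ip C (time_ext T z) (mu1 + mu2).
have gN0 : gamma != 0 by rewrite gt_eqF.
exists lam, mu1, mu2; split.
- apply: in_dual_comb; first exact: in_dual_ip.
  exact: (time_ext_dual T_gt0 gW (mu1 + mu2)).
- move=> v z cz; have -> : gamma * lam z =
      - (beta * hip W wbar z) - (L2ip C mu1 (time_ext T z) + L2ip C mu2 (time_ext T z)).
    by rewrite /lam (L2ipC (time_ext T z)) L2ipDl; field.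
  have -> : L2ip C (f' ubar) v + alpha * L2ip C ubar v = L2ip C mu1 v - L2ip C mu2 v.
    by rewrite -L2ipBl mu12 L2ipDl L2ipZl.
  by rewrite L2ipBr L2ipDr; ring.
- have -> : lam wbar = - gamma^-1 * (beta * hip W wbar wbar + L2ip C G ubar).
    rewrite (_ : L2ip C G ubar = L2ip C (time_ext T wbar) (mu1 + mu2)).
      by rewrite /lam; field.
    apply: L2ip_ae_eq; apply: filterS Gu => x ->.
    by rewrite mu12N mulrN mulrC.
  rewrite -(ler_pM2l gamma_gt0) [leRHS]mulrA mulrN divff// mulN1r.
  by move: energy; lra.
- split.
    apply: filterS feas => x ux; rewrite -[X in 0 <= X]/(wbar x.2 - ubar x) subr_ge0.
    exact: le_trans (ler_norm _) ux.
  move=> z z0; apply: L2ip_ae_le0; apply: filterS (filterI (filterI feas Gu) z0) => x [[ux Gx] zx].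
  rewrite -[X in _ * X]/(z x - (wbar x.2 - ubar x)) mu1E.
  have [h|h] := leP (G x) 0; last by rewrite mul0r.
  move: Gx; rewrite ler0_norm// mulNr opprK => Gx.
  by rewrite mulrBr [X in _ - X]mulrBr Gx subrr subr0 mulr_le0_ge0.
- split.
    apply: filterS feas => x ux; rewrite -[X in 0 <= X]/(wbar x.2 + ubar x).
    by rewrite addrC -lerBlDr sub0r; move: ux; rewrite ler_norml => /andP[].
  move=> z z0; apply: L2ip_ae_le0; apply: filterS (filterI (filterI feas Gu) z0) => x [[ux Gx] zx].
  rewrite -[X in _ * X]/(z x - (wbar x.2 + ubar x)) mu2E.
  have [h|h] := leP (G x) 0; first by rewrite oppr0 mul0r.
  move: Gx; rewrite gtr0_norm// => Gx.
  by rewrite mulNr mulrBr [X in _ - X]mulrDr Gx subrr subr0 oppr_le0 mulr_ge0// ltW.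
Qed.

End stationarity.

(** * Inner products pulled back from L2 spaces by a linear map *)

Section energy_space.
Context (R : realType) disp (X : measurableType disp) (D : {measure set X -> \bar R}).
Context dispZ (Z : measurableType dispZ) (kappa : {measure set Z -> \bar R}).
Variables (H : hspace (L2 D)) (B : L2 D -> Z -> R) (a0 c : R).
Hypotheses (a0_ge0 : 0 <= a0) (a0_le1 : a0 <= 1) (c_ge0 : 0 <= c).
Hypothesis B_lin : forall a x y z, B (a *: x + y) z = a * B x z + B y z.
Hypothesis B_meas : forall x, measurable_fun setT (B x).
Hypothesis H_car : forall x, hcar H x <-> (sqint kappa (B x) < +oo)%E.
Hypothesis H_ip : forall x y, hcar H x -> hcar H y ->
  hip H x y = a0 * L2ip D x y + c * L2ip kappa (B x) (B y).
Hypothesis B_ae : forall (x_ : nat -> L2 D) (x : L2 D),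
  L2norm D (x_ n - x) @[n --> \oo] --> (0 : R) ->
  {ae D, forall t, x_ n t @[n --> \oo] --> x t} ->
  {ae kappa, forall z, B (x_ n) z @[n --> \oo] --> B x z}.

Let BL x : hcar H x -> B x \in Lfun kappa 2%:E.
Proof. by move=> /H_car ?; apply/Lfun2P. Qed.

Let BD x y z : B (x + y) z = B x z + B y z.
Proof. by rewrite -[x]scale1r B_lin mul1r scale1r. Qed.

Let B0 z : B 0 z = 0.
Proof. by have /eqP := BD 0 0 z; rewrite addr0 -subr_eq subrr eq_sym => /eqP. Qed.

(** One argument serves two kinds of spaces: for Gagliardo norms, [B] is the difference quotient and
    a0 = 1; for the spectral space, [B] gives the weighted coefficients and a0 = 0. *)
Lemma energy_prehilbert : prehilbert H.
Proof.
have clin a x y : hcar H x -> hcar H y -> hcar H (a *: x + y).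
  move=> cx cy; apply/H_car.
  have /Lfun2P[_] := LfunP (a *: (Lfun_Sub (lee1n 2) (BL cx) : L2 kappa)
    + (Lfun_Sub (lee1n 2) (BL cy) : L2 kappa)).
  apply: le_lt_trans; rewrite le_eqVlt; apply/orP; left; apply/eqP.
  by congr (sqint _ _); apply/funext => z; exact: B_lin.
have c0 : hcar H 0.
  apply/H_car; rewrite (_ : B 0 = cst 0); last by apply/funext => z; rewrite B0.
  by rewrite /sqint /= expr0n integral0 ltry.
split => //.
- move=> x y cx cy; rewrite !H_ip// L2ipC; congr (_ + c * _).
  by apply: eq_Rintegral => z _; rewrite mulrC.
- move=> a x y z cx cy cz; rewrite !H_ip//; last exact: clin.
  pose bx : L2 kappa := Lfun_Sub (lee1n 2) (BL cx).
  pose by_ : L2 kappa := Lfun_Sub (lee1n 2) (BL cy).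
  pose bz : L2 kappa := Lfun_Sub (lee1n 2) (BL cz).
  rewrite L2ipDl L2ipZl (_ : L2ip kappa (B _) (B z) = L2ip kappa (a *: bx + by_) bz).
    rewrite [L2ip kappa (_ + _) _]L2ipDl L2ipZl.
    by rewrite -[L2ip kappa (B x) _]/(L2ip kappa bx bz) -[L2ip kappa (B y) _]/(L2ip kappa by_ bz); ring.
  by congr (L2ip _ _ _); apply/funext => t; exact: B_lin.
- move=> x cx; rewrite H_ip// addr_ge0//.
    by rewrite mulr_ge0// -L2norm_sqr sqr_ge0.
  by rewrite mulr_ge0//; apply: Rintegral_ge0 => z _; rewrite -expr2 sqr_ge0.
Qed.
Let pH := energy_prehilbert.

Lemma energy_norm x : hcar H x ->
  hnorm H x ^+ 2 = a0 * L2norm D x ^+ 2 + c * fine (sqint kappa (B x)).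
Proof.
by move=> cx; rewrite ph_norm_sqr// H_ip// -L2norm_sqr -(L2ip_sqint (BL cx)).
Qed.

Lemma energy_embed x : a0 = 1 -> hcar H x -> L2norm D x <= hnorm H x.
Proof.
move=> a1 cx; rewrite -ler_sqr ?nnegrE ?L2norm_ge0 ?ph_norm_ge0//.
by rewrite energy_norm// a1 mul1r lerDl mulr_ge0// fine_ge0// sqint_ge0.
Qed.

Lemma energy_sqint_le x M : 0 < c -> hcar H x -> hnorm H x <= M ->
  (sqint kappa (B x) <= (c^-1 * M ^+ 2)%:E)%E.
Proof.
move=> c0 cx xM; have /H_car foo := cx.
rewrite -(@fineK _ (sqint kappa (B x))) ?ge0_fin_numE ?sqint_ge0// lee_fin.
rewrite ler_pdivlMl//; have : hnorm H x ^+ 2 <= M ^+ 2.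
  by rewrite ler_sqr ?nnegrE ?ph_norm_ge0//; exact: le_trans (ph_norm_ge0 H x) xM.
by rewrite energy_norm//; apply: le_trans; rewrite lerDr mulr_ge0// sqr_ge0.
Qed.

(** The L2 limit is almost everywhere a limit along a subsequence, hence so are its images under
    [B]. Fatou's lemma in the second index of the Cauchy condition bounds the energy of x_n - x;
    this gives both finiteness and convergence. *)
Lemma energy_complete (x_ : nat -> L2 D) (x : L2 D) : 0 < c ->
  (forall n, hcar H (x_ n)) ->
  (forall e : R, 0 < e -> exists N, forall m n, (N <= m)%N -> (N <= n)%N ->
     hnorm H (x_ m - x_ n) <= e) ->
  L2norm D (x_ n - x) @[n --> \oo] --> (0 : R) ->
  hcar H x /\ hnorm H (x_ n - x) @[n --> \oo] --> (0 : R).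
Proof.
move=> c0 cx cauchy xx; have [s hs sP] := L2_cvg_ae_subseq xx.
have bound (e : R) N : 0 <= e -> (forall m n, (N <= m)%N -> (N <= n)%N ->
     hnorm H (x_ m - x_ n) <= e) ->
     forall n, (N <= n)%N -> (sqint kappa (B (x_ n - x)%R) <= (c^-1 * e ^+ 2)%:E)%E.
  move=> e0 NP n Nn.
  apply: (@fatou_cvg _ _ _ kappa (fun k z => B (x_ n - x_ (s (k + N)%N)) z ^+ 2)
    (fun z => B (x_ n - x) z ^+ 2) (fun=> c^-1 * e ^+ 2)).
  - by move=> k; exact: measurable_funX.
  - exact: measurable_funX.
  - by move=> *; rewrite sqr_ge0.
  - by move=> *; rewrite sqr_ge0.
  - have aeX : {ae D, forall t, (x_ n - x_ (s (k + N)%N)) t @[k --> \oo] --> (x_ n - x) t}.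
      apply: filterS sP => t xt.
      have h : x_ n t - x_ (s (k + N)%N) t @[k --> \oo] --> x_ n t - x t.
        by apply: cvgB; [exact: cvg_cst|rewrite (cvg_shiftn N (fun k => x_ (s k) t))].
      exact: h.
    have L2X : L2norm D (x_ n - x_ (s (k + N)%N) - (x_ n - x) : L2 D) @[k --> \oo] --> (0 : R).
      rewrite (_ : (fun k => _) = (fun k => L2norm D (x_ (s (k + N)%N) - x : L2 D))).
        rewrite (cvg_shiftn N (fun k => L2norm D (x_ (s k) - x))); exact: cvg_subseq hs xx.
      apply/funext => k; rewrite L2norm_distC.
      have -> // : (x_ n - x - (x_ n - x_ (s (k + N)%N)) : L2 D) = x_ (s (k + N)%N) - x.
      by rewrite opprB addrC addrA subrK.
    apply: filterS (B_ae L2X aeX) => z Bz; rewrite expr2.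
    rewrite (_ : (fun k => _) = (fun k => B (x_ n - x_ (s (k + N)%N)) z * B (x_ n - x_ (s (k + N)%N)) z)).
      exact: cvgM.
    by apply/funext => k; rewrite expr2.
  - move=> k; apply: (energy_sqint_le c0); first exact: (phB pH).
    apply: NP => //; by rewrite (leq_trans _ (homo_ltn_ge hs _))// leq_addl.
  - exact: cvg_cst.
have [N1 N1P] := cauchy 1 ltr01.
have cxx : hcar H (x_ N1 - x).
  by apply/H_car; apply: le_lt_trans (bound 1 N1 ler01 N1P N1 (leqnn _)) (ltry _).
have cX : hcar H x by rewrite -(subKr (x_ N1) x); exact: (phB pH).
split => //; have cxn n : hcar H (x_ n - x) by exact: (phB pH).
apply: sqr_cvg0; apply/cvgr0Pnorm_le => e e0.
pose e' := Num.sqrt (e / 2).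
have e'0 : 0 < e' by rewrite sqrtr_gt0 divr_gt0.
have e'2 : e' ^+ 2 = e / 2 by rewrite sqr_sqrtr ?divr_ge0 ?(ltW e0).
have [N NP] := cauchy e' e'0; move/cvgr0Pnorm_le : xx => /(_ _ e'0)[M _ MP].
exists (maxn N M) => // n /=; rewrite geq_max => /andP[Nn Mn].
rewrite ger0_norm ?sqr_ge0// energy_norm// (splitr e) -e'2 lerD//.
  apply: le_trans (ler_piMl (sqr_ge0 _) a0_le1) _.
  rewrite ler_sqr ?nnegrE ?L2norm_ge0 ?(ltW e'0)//.
  by have := MP n Mn; rewrite ger0_norm ?L2norm_ge0.
rewrite -ler_pdivlMl// -lee_fin fineK; first exact: (bound e' N (ltW e'0) NP n Nn).
by have /H_car foo := cxn n; rewrite ge0_fin_numE// sqint_ge0.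
Qed.

End energy_space.

(** * The Gagliardo seminorm as an L2 norm on pairs of points *)

Section gagliardo.
Context (R : realType) (d : nat).
Variable mu : {sigma_finite_measure set 'rV[R]_d -> \bar R}.
Variable s : R.
Local Notation X := 'rV[R]_d.
Local Notation mu2 := (mu \x mu)%E.

Lemma measurable_Num_sqrt : measurable_fun setT (@Num.sqrt R).
Proof. by apply: continuous_measurable_fun; exact: sqrt_continuous. Qed.

Lemma enorm_ge0 (x : X) : 0 <= enorm x. Proof. exact: sqrtr_ge0. Qed.

Lemma measurable_enorm_sub : measurable_fun setT (fun z : X * X => enorm (z.1 - z.2)).
Proof.
apply: (measurableT_comp measurable_Num_sqrt).
rewrite (_ : (fun _ => _) = (fun z : X * X => \sum_i (z.1 ord0 i - z.2 ord0 i) ^+ 2)).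
  apply: measurable_sum => i; apply: measurable_funX; apply: measurable_funB.
    exact: (measurableT_comp (measurable_coord_rV i) measurable_fst).
  exact: (measurableT_comp (measurable_coord_rV i) measurable_snd).
by apply/funext => z; apply: eq_bigr => i _; rewrite !mxE.
Qed.

(* The square root of the Gagliardo kernel, so that the seminorm becomes an L2 norm
   on the product space. *)
Definition sqrt_kernel (z : X * X) : R :=
  Num.sqrt (enorm (z.1 - z.2) `^ (d%:R + 2 * s))^-1.

Definition gagliardo_quotient (f : X -> R) (z : X * X) : R :=
  (f z.1 - f z.2) * sqrt_kernel z.

Lemma measurable_inv_pos d1 (T1 : measurableType d1) (g : T1 -> R) :
  measurable_fun setT g -> (forall x, 0 <= g x) -> measurable_fun setT (fun x => (g x)^-1).
Proof.
move=> mg g0; rewrite (_ : (fun x => _) = (fun x => g x `^ (- 1))).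
  exact: (measurableT_comp (measurable_powR _)).
by apply/funext => x; rewrite powR_inv1.
Qed.

Lemma measurable_sqrt_kernel : measurable_fun setT sqrt_kernel.
Proof.
apply: (measurableT_comp measurable_Num_sqrt).
apply: measurable_inv_pos => [|z]; last exact: powR_ge0.
exact: (measurableT_comp (measurable_powR _) measurable_enorm_sub).
Qed.

Lemma sqr_sqrt_kernel z : sqrt_kernel z ^+ 2 = (enorm (z.1 - z.2) `^ (d%:R + 2 * s))^-1.
Proof. by rewrite sqr_sqrtr// invr_ge0 powR_ge0. Qed.

Lemma measurable_gagliardo_quotient (f : X -> R) : measurable_fun setT f ->
  measurable_fun setT (gagliardo_quotient f).
Proof.
move=> mf; apply: measurable_funM; last exact: measurable_sqrt_kernel.
by apply: measurable_funB; [exact: (measurableT_comp mf measurable_fst)|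
  exact: (measurableT_comp mf measurable_snd)].
Qed.

Lemma gagliardo_quotientE (f : X -> R) : measurable_fun setT f ->
  (\int[mu]_x \int[mu]_y
    (`|f x - f y| ^+ 2 / enorm (x - y) `^ (d%:R + 2 * s))%:E)%E =
  sqint mu2 (gagliardo_quotient f).
Proof.
move=> mf; rewrite /sqint (fubini_tonelli1 (fun z => (gagliardo_quotient f z ^+ 2)%:E)).
- apply: eq_integral => x _; apply: eq_integral => y _ /=.
  rewrite /gagliardo_quotient exprMn sqr_sqrt_kernel real_normK ?num_real//.
- exact: measurable_EFin_sqr (measurable_gagliardo_quotient mf).
- by move=> z; rewrite lee_fin sqr_ge0.
Qed.

(** [Hs_ip] iterates real-valued integrals. The inner one agrees with the extended-real integral at
    every x whose slice is integrable, thus almost everywhere by Fubini. *)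
Lemma Hs_ipE (f g : X -> R) : gagliardo_quotient f \in Lfun mu2 2%:E ->
  gagliardo_quotient g \in Lfun mu2 2%:E ->
  Hs_ip mu s f g = L2ip mu f g
    + c_ds d s / 2 * L2ip mu2 (gagliardo_quotient f) (gagliardo_quotient g).
Proof.
move=> fL gL; rewrite /Hs_ip; congr (_ + _ * _).
have iF := Lfun2M_integrable fL gL.
pose F z := gagliardo_quotient f z * gagliardo_quotient g z.
rewrite [RHS]/(fine (\int[mu2]_z (F z)%:E)%E) -(integral12_prod_meas1 iF).
congr fine; apply: ae_eq_integral => //.
- apply/measurable_EFinP.
  have := measurable_fubini_F iF.
  move=> /(measurableT_comp (fine_measurable measurableT)).
  congr measurable_fun; apply/funext => x; congr fine.
  apply: eq_integral => y _ /=; congr EFin.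
  rewrite /gagliardo_quotient/= mulrACA -expr2 sqr_sqrt_kernel/=.
  by [].
- exact: (measurable_fubini_F iF).
apply: filterS (ae_integrable1 iF) => x ix _ /=.
rewrite /fubini_F /= -[RHS](fineK (integrable_fin_num measurableT ix)).
congr (EFin (fine _)); apply: eq_integral => y _ /=; congr EFin.
by rewrite /gagliardo_quotient/= mulrACA -expr2 sqr_sqrt_kernel.
Qed.

Lemma ae_prod_fst (P : X -> Prop) : {ae mu, forall x, P x} -> {ae mu2, forall z, P z.1}.
Proof.
move=> [N [mN N0 NP]]; exists (N `*` setT); split.
- exact: measurableX.
- rewrite product_measure1E//; by rewrite [X in (X * _)%E]N0 mul0e.
- by move=> z /= nP; split => //; exact: NP.
Qed.

Lemma ae_prod_snd (P : X -> Prop) : {ae mu, forall x, P x} -> {ae mu2, forall z, P z.2}.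
Proof.
move=> [N [mN N0 NP]]; exists (setT `*` N); split.
- exact: measurableX.
- by rewrite product_measure1E// [X in (_ * X)%E]N0 mule0.
- by move=> z /= nP; split => //; exact: NP.
Qed.

Lemma gagliardo_quotient_ae (f_ : nat -> X -> R) (f : X -> R) :
  {ae mu, forall x, f_ n x @[n --> \oo] --> f x} ->
  {ae mu2, forall z, gagliardo_quotient (f_ n) z @[n --> \oo] --> gagliardo_quotient f z}.
Proof.
move=> ff; apply: filterS (filterI (ae_prod_fst ff) (ae_prod_snd ff)) => z [f1 f2].
by apply: cvgMr_tmp; exact: cvgB.
Qed.

End gagliardo.

(** * Averages and oscillation over cubes *)

Section cube_average.
Context (R : realType) (d : nat).
Local Notation X := 'rV[R]_d.
Local Notation nu := (lebesgue_rV R d).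

(** For h > 0 the open ball of the sup norm; the coordinatewise form exhibits it as a box, whose
    measure is a product. *)
Definition cube (x : X) (h : R) : set X := [set y | forall i, `|x ord0 i - y ord0 i| < h].

Definition cube_rel (h : R) : set (X * X) := [set z | cube z.1 h z.2].

Lemma measurable_cube_rel h : measurable (cube_rel h).
Proof.
rewrite (_ : cube_rel h = \bigcap_(i in [set: 'I_d])
    [set z : X * X | `|z.1 ord0 i - z.2 ord0 i| < h]); last first.
  by apply/seteqP; split => z /= zh i; [move=> _|]; exact: zh.
apply: fin_bigcap_measurable => [|i _]; first exact: finite_finset.
have mf : measurable_fun setT (fun z : X * X => `|z.1 ord0 i - z.2 ord0 i|).
  apply: measurableT_comp => //; apply: measurable_funB.
    exact: (measurableT_comp (measurable_coord_rV i) measurable_fst).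
  exact: (measurableT_comp (measurable_coord_rV i) measurable_snd).
rewrite -[X in measurable X]setTI.
by apply: (measurable_fun_ltr mf (measurable_cst h) measurableT (Y := [set true])).
Qed.

Lemma cubeE (x : X) h : cube x h =
  [set y | forall i, (ball (x ord0 i) h : set (measurableTypeR R)) (y ord0 i)].
Proof. by []. Qed.

Lemma measurable_cube (x : X) h : measurable (cube x h).
Proof.
rewrite cubeE; pose A i : set (measurableTypeR R) := ball (x ord0 i) h.
by apply: (@measurable_box _ _ A) => i; exact: measurable_ball.
Qed.

Lemma lebesgue_cube (x : X) h : 0 <= h -> nu (cube x h) = ((2 * h) ^+ d)%:E.
Proof.
move=> h0; rewrite cubeE; pose A i : set (measurableTypeR R) := ball (x ord0 i) h.
rewrite (@lebesgue_rV_box _ _ A) => [|i]; last exact: measurable_ball.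
rewrite (eq_bigr (fun=> (2 * h)%:E)) => [|i _].
  by rewrite prodEFin prodr_const card_ord.
by rewrite lebesgue_measure_ball// mulr_natl.
Qed.

Lemma cube_indic_Lfun2 (x : X) h : 0 <= h -> (\1_(cube x h) : X -> R) \in Lfun nu 2%:E.
Proof.
move=> h0; apply/Lfun2P; split; first by apply: measurable_indic; exact: measurable_cube.
rewrite /sqint (eq_integral (fun y => (\1_(cube x h) y)%:E)) => [|y _].
  by rewrite (integral_indic _ measurableT (measurable_cube x h)) setIT
    [X in (X < _)%E](lebesgue_cube x h0) ltry.
by rewrite indicE; case: (_ \in _); rewrite ?expr1n ?expr0n.
Qed.

(** Mean square oscillation at scale h over K, not normalised by the volume of the cube. *)
Definition oscillation (K : set X) (h : R) (g : X -> R) : \bar R :=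
  (\int[nu]_x ((\1_K x)%:E * \int[nu]_y (\1_(cube x h) y * (g x - g y) ^+ 2)%:E))%E.

Definition cube_int (h : R) (g : X -> R) (x : X) : R := L2ip nu (\1_(cube x h)) g.

Section one_function.
Variables (g : X -> R) (h : R).
Hypotheses (gL : g \in Lfun nu 2%:E) (h_gt0 : 0 < h).
Local Notation V := ((2 * h) ^+ d).
Let V_gt0 : 0 < V. Proof. by rewrite exprn_gt0// mulr_gt0. Qed.
Let mg : measurable_fun setT g. Proof. exact: Lfun2_measurable gL. Qed.

Lemma indic_mul_Lfun2 x : (fun y => \1_(cube x h) y * g y) \in Lfun nu 2%:E.
Proof.
apply: (Lfun2_le _ gL) => [|y].
  by apply: measurable_funM => //; by apply: measurable_indic; exact: measurable_cube.
by rewrite indicE; case: (_ \in _); rewrite ?mul1r ?mul0r ?normr0.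
Qed.

Let q x : L2 nu := Lfun_Sub (lee1n 2) (cube_indic_Lfun2 x (ltW h_gt0)).
Let qg x : L2 nu := Lfun_Sub (lee1n 2) (indic_mul_Lfun2 x).

Lemma cube_oscillationE x :
  (\int[nu]_y (\1_(cube x h) y * (g x - g y) ^+ 2)%:E)%E =
  sqint nu (g x *: q x - qg x : L2 nu).
Proof.
apply: eq_integral => y _; congr EFin.
rewrite -[RHS]/((g x * \1_(cube x h) y - \1_(cube x h) y * g y) ^+ 2).
by rewrite indicE; case: (_ \in _); rewrite /= ?mul0r ?mulr0 ?subr0 ?expr0n//= !mul1r mulr1.
Qed.

Lemma q_norm x : L2norm nu (q x) ^+ 2 = V.
Proof.
apply: EFin_inj; rewrite L2norm_sqint; apply: etrans (lebesgue_cube x (ltW h_gt0)).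
have := integral_indic nu measurableT (measurable_cube x h); rewrite setIT => <-.
apply: eq_integral => y _; rewrite -[q x y]/(\1_(cube x h) y) indicE.
by case: (_ \in _); rewrite ?expr1n ?expr0n.
Qed.

(** Expand the oscillation as V a^2 - 2 a J + t with a = g(x), J the integral of g over the cube and
    t >= 0. What remains is (V a - 2 J)^2 / V >= 0. *)
Lemma cube_average_le x : ((V * g x ^+ 2)%:E <=
  2%:E * \int[nu]_y (\1_(cube x h) y * (g x - g y) ^+ 2)%:E
  + (4 / V * cube_int h g x ^+ 2)%:E)%E.
Proof.
rewrite cube_oscillationE -L2norm_sqint -EFinM -EFinD lee_fin.
rewrite L2norm_sqr L2_sqrB !L2ipZl L2ipZr -!L2norm_sqr q_norm.
have -> : L2ip nu (q x) (qg x) = cube_int h g x.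
  apply: eq_Rintegral => y _; rewrite -[qg x y]/(\1_(cube x h) y * g y).
  by rewrite -[q x y]/(\1_(cube x h) y) mulrA -expr2 indicE; case: (_ \in _); rewrite ?expr1n ?expr0n.
have := sqr_ge0 (L2norm nu (qg x)); set t := _ ^+ 2 => t0.
set J := cube_int _ _ _; set a := g x.
have := sqr_ge0 (V * a - 2 * J); rewrite -(@pmulr_rge0 _ V^-1) ?invr_gt0//.
rewrite [X in 0 <= X -> _](_ : _ = V * a ^+ 2 - 4 * a * J + 4 / V * J ^+ 2); last first.
  by field; rewrite gt_eqF.
by lra.
Qed.

Lemma cube_int_le x : cube_int h g x ^+ 2 <= V * fine (sqint nu g).
Proof.
pose gg : L2 nu := Lfun_Sub (lee1n 2) gL.
have := L2_CS (q x) gg; rewrite -[`|_|]/(`|cube_int h g x|) => cs.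
rewrite -(L2norm_sqint gg) -(q_norm x) -exprMn -(real_normK (num_real (cube_int _ _ _))).
by rewrite ler_sqr ?nnegrE ?mulr_ge0 ?L2norm_ge0.
Qed.

Lemma measurable_cube_oscillation : measurable_fun setT
  (fun x => (\int[nu]_y (\1_(cube x h) y * (g x - g y) ^+ 2)%:E)%E).
Proof.
apply: (measurable_fun_fubini_tonelli_F (m2 := nu)
  (fun z : X * X => (\1_(cube_rel h) z * (g z.1 - g z.2) ^+ 2)%:E)).
- apply/measurable_EFinP; apply: measurable_funM.
    by apply: measurable_indic; exact: measurable_cube_rel.
  apply: measurable_funX; apply: measurable_funB.
    exact: (measurableT_comp mg measurable_fst).
  exact: (measurableT_comp mg measurable_snd).
- by move=> z; rewrite lee_fin mulr_ge0 ?sqr_ge0// indicE; case: (_ \in _).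
Qed.

(** Positive and negative parts are treated separately, so that Tonelli applies to each. *)
Lemma measurable_cube_int : measurable_fun setT (cube_int h g).
Proof.
have m1 (f : X -> R) : measurable_fun setT f -> (forall y, 0 <= f y) ->
    measurable_fun setT (fun x => (\int[nu]_y (\1_(cube x h) y * f y)%:E)%E).
  move=> mf f0; apply: (measurable_fun_fubini_tonelli_F (m2 := nu)
    (fun z : X * X => (\1_(cube_rel h) z * f z.2)%:E)).
  - apply/measurable_EFinP; apply: measurable_funM.
      by apply: measurable_indic; exact: measurable_cube_rel.
    exact: (measurableT_comp mf measurable_snd).
  - by move=> z; rewrite lee_fin mulr_ge0// indicE; case: (_ \in _).
have mp := measurable_funrpos mg; have mn := measurable_funrneg mg.
rewrite (_ : cube_int h g = (fun x => fine (\int[nu]_y (\1_(cube x h) y * g^\+ y)%:E)%E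
    - fine (\int[nu]_y (\1_(cube x h) y * g^\- y)%:E)%E)).
  apply: measurable_funB.
    by apply: (measurableT_comp (fine_measurable measurableT)); apply: m1.
  by apply: (measurableT_comp (fine_measurable measurableT)); apply: m1.
have pL : g^\+ \in Lfun nu 2%:E.
  apply: (Lfun2_le mp gL) => y; rewrite /funrpos /Num.max.
  by case: ifP => //; rewrite normr0.
have nL : g^\- \in Lfun nu 2%:E.
  apply: (Lfun2_le mn gL) => y; rewrite /funrneg /Num.max.
  by case: ifP => //; rewrite ?normrN ?normr0.
apply/funext => x; rewrite /cube_int /L2ip.
have iL := cube_indic_Lfun2 x (ltW h_gt0).
transitivity (\int[nu]_y (\1_(cube x h) y * g^\+ y) - \int[nu]_y (\1_(cube x h) y * g^\- y)).
  rewrite -RintegralB//; [|exact: Lfun2M_integrable|exact: Lfun2M_integrable].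
  apply: eq_Rintegral => y _; rewrite -mulrBr; congr (_ * _).
  rewrite /funrpos /funrneg; have [g0|/ltW g0] := leP 0 (g y).
    by rewrite (max_r (_ : - g y <= 0)) ?oppr_le0// subr0.
  by rewrite (max_l (_ : 0 <= - g y)) ?oppr_ge0// sub0r opprK.
by [].
Qed.

End one_function.

End cube_average.

(** * From weak convergence and small oscillation to strong convergence *)

Section local_compactness.
Context (R : realType) (d : nat).
Local Notation X := 'rV[R]_d.
Local Notation nu := (lebesgue_rV R d).
Variables (K : set X) (g_ : nat -> X -> R) (M : R).
Hypotheses (mK : measurable K) (K_lty : (nu K < +oo)%E).
Hypotheses (gL : forall n, g_ n \in Lfun nu 2%:E)
  (gM : forall n, (sqint nu (g_ n) <= M%:E)%E)
  (g_weak : forall f : X -> R, f \in Lfun nu 2%:E ->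
    L2ip nu f (g_ n) @[n --> \oo] --> (0 : R)).

(** At each point the cube integral is a pairing with an indicator, so it tends to zero; dominated
    convergence applies because K has finite measure and the integrals are uniformly bounded. *)
Lemma cube_int_sqr_cvg0 h : 0 < h ->
  (\int[nu]_x (\1_K x * cube_int h (g_ n) x ^+ 2)%:E)%E @[n --> \oo] --> 0%E.
Proof.
move=> h0; pose V : R := (2 * h) ^+ d.
have M0 : 0 <= M by rewrite -lee_fin (le_trans (sqint_ge0 nu (g_ 0%N))).
have mI : measurable_fun setT (\1_K : X -> R) by exact: measurable_indic.
have mf n : measurable_fun setT (fun x => (\1_K x * cube_int h (g_ n) x ^+ 2)%:E).
  apply/measurable_EFinP; apply: measurable_funM => //; apply: measurable_funX.
  exact: measurable_cube_int.
have f0 : {ae nu, forall x, setT x ->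
    (\1_K x * cube_int h (g_ n) x ^+ 2)%:E @[n --> \oo] --> cst 0%E x}.
  apply: aeW => x _; apply/fine_cvgP; split; first by near=> n.
  rewrite -[X in _ --> X](mulr0 (\1_K x)); apply: cvgMl_tmp.
  have c0 : cube_int h (g_ n) x @[n --> \oo] --> (0 : R).
    exact: (g_weak (cube_indic_Lfun2 x (ltW h0))).
  rewrite (_ : (fun n => _) = (fun n => cube_int h (g_ n) x * cube_int h (g_ n) x)).
    by rewrite -[X in _ --> X](mulr0 0); exact: cvgM.
  by apply/funext => n; rewrite expr2.
have fG : {ae nu, forall x n, setT x ->
    (`|(\1_K x * cube_int h (g_ n) x ^+ 2)%:E| <= (\1_K x * (V * M))%:E)%E}.
  apply: aeW => x n _; rewrite /= lee_fin normrM ger0_norm ?indicE ?ler0n//.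
  rewrite ler_wpM2l ?ler0n// ger0_norm ?sqr_ge0//.
  apply: le_trans (cube_int_le (gL n) h0 x) _; rewrite ler_wpM2l ?exprn_ge0 ?mulr_ge0 ?(ltW h0)//.
  rewrite -lee_fin fineK//; rewrite ge0_fin_numE ?sqint_ge0//.
  exact: le_lt_trans (gM n) (ltry _).
have iG : nu.-integrable setT (fun x => (\1_K x * (V * M))%:E).
  have iK : nu.-integrable setT (fun x => (\1_K x)%:E).
    apply/integrableP; split; first exact/measurable_EFinP.
    rewrite (eq_integral (fun x => (\1_K x)%:E)) => [|x _].
      by rewrite (integral_indic nu measurableT mK) setIT.
    by rewrite gee0_abs// lee_fin indicE ler0n.
  have := integrableZl measurableT (V * M) iK.
  by congr integrable; apply/funext => x; rewrite -EFinM mulrC.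
have [_ _] := dominated_convergence measurableT mf
  (measurable_cst _ : measurable_fun setT (cst 0%E)) f0 iG fG.
by rewrite integral0.
Unshelve. all: by end_near. Qed.

(** Integrate [cube_average_le] over K: fix the scale h at which the oscillation is small for all n,
    then let the averages tend to zero. *)
Lemma local_cvg :
  (forall dl : R, 0 < dl -> exists2 h, 0 < h &
     forall n, (oscillation K h (g_ n) <= (dl * (2 * h) ^+ d)%:E)%E) ->
  forall e : R, 0 < e -> exists N, forall n, (N <= n)%N ->
    (sqint nu (fun x => g_ n x * \1_K x)%R <= e%:E)%E.
Proof.
(* With V the volume of the cube, an oscillation of at most (e/4) V and averages of at most (e/8)
   V^2 each contribute half of V e. *)
move=> osc e e0; have [h h0 hP] := osc (e / 4) (divr_gt0 e0 (ltr0n R 4)).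
pose V : R := (2 * h) ^+ d; have V0 : 0 < V by rewrite exprn_gt0// mulr_gt0.
have k0 : 0 < e / 8 * V ^+ 2 by apply: mulr_gt0; [exact: divr_gt0|exact: exprn_gt0].
have := cube_int_sqr_cvg0 h0 => /fine_cvgP[[N1 _ fin] /cvgr0Pnorm_lt/(_ _ k0)[N2 _ NP]].
exists (maxn N1 N2) => n; rewrite geq_max => /andP[Nn1 Nn2].
have mg : measurable_fun setT (g_ n) := Lfun2_measurable (gL n).
have mI : measurable_fun setT (\1_K : X -> R) by exact: measurable_indic.
set S := sqint _ _.
have I0 : (0 <= \int[nu]_x (\1_K x * cube_int h (g_ n) x ^+ 2)%:E)%E.
  by apply: integral_ge0 => x _; rewrite lee_fin mulr_ge0 ?sqr_ge0// indicE ler0n.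
have IN : (\int[nu]_x (\1_K x * cube_int h (g_ n) x ^+ 2)%:E <= (e / 8 * V ^+ 2)%:E)%E.
  have := NP n Nn2 => /ltW; rewrite /= ger0_norm ?fine_ge0// => hI.
  by rewrite -(fineK (fin n Nn1)) lee_fin.
have mosc : measurable_fun setT (fun x => (\1_K x)%:E *
    \int[nu]_y (\1_(cube x h) y * (g_ n x - g_ n y) ^+ 2)%:E)%E.
  apply: emeasurable_funM; first exact/measurable_EFinP.
  exact: (measurable_cube_oscillation _ (gL n)).
have mint : measurable_fun setT (fun x => (\1_K x * cube_int h (g_ n) x ^+ 2)%:E).
  apply/measurable_EFinP; apply: measurable_funM => //; apply: measurable_funX.
  exact: measurable_cube_int.
have osc0 x : (0 <= (\1_K x)%:E *
    \int[nu]_y (\1_(cube x h) y * (g_ n x - g_ n y) ^+ 2)%:E)%E.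
  rewrite mule_ge0 ?lee_fin ?indicE ?ler0n//; apply: integral_ge0 => y _.
  by rewrite lee_fin mulr_ge0 ?sqr_ge0// indicE ler0n.
have int0 x : (0 <= (\1_K x * cube_int h (g_ n) x ^+ 2)%:E)%E.
  by rewrite lee_fin mulr_ge0 ?sqr_ge0// indicE ler0n.
have main : (V%:E * S <= 2%:E * oscillation K h (g_ n)
    + (4 / V)%:E * \int[nu]_x (\1_K x * cube_int h (g_ n) x ^+ 2)%:E)%E.
  rewrite /oscillation -!ge0_integralZl_EFin//; last 4 first.
  - by rewrite divr_ge0// ltW.
  - by move=> x _; rewrite lee_fin sqr_ge0.
  - by apply: measurable_EFin_sqr; exact: measurable_funM.
  - exact: ltW.
  rewrite -ge0_integralD//; last 4 first.
  - by move=> x _; rewrite mule_ge0.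
  - exact: emeasurable_funM.
  - by move=> x _; rewrite mule_ge0// lee_fin divr_ge0// ltW.
  - exact: emeasurable_funM.
  apply: ge0_le_integral => //.
  - by move=> x _; rewrite mule_ge0 ?lee_fin ?sqr_ge0// ltW.
  - apply: emeasurable_funM => //; apply: measurable_EFin_sqr; exact: measurable_funM.
  - by apply: emeasurable_funD; exact: emeasurable_funM.
  move=> x _; rewrite -EFinM indicE; case: (x \in K) => /=.
    rewrite mulr1 mul1e mul1r -EFinM; exact: (cube_average_le (gL n) h0 x).
  by rewrite mulr0 expr0n/= mulr0 mul0e mul0r !mule0 adde0.
have Sfin : (V%:E * S <= (V * e)%:E)%E.
  apply: (le_trans main).
  apply: (@le_trans _ _ (2%:E * (e / 4 * V)%:E + (4 / V)%:E * (e / 8 * V ^+ 2)%:E)%E).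
    by apply: leeD; rewrite lee_pmul2l ?lte_fin ?divr_gt0//; exact: hP.
  rewrite -!EFinM -EFinD lee_fin le_eqVlt; apply/orP; left; apply/eqP.
  by field; rewrite gt_eqF.
by move: Sfin; rewrite EFinM lee_pmul2l ?lte_fin.
Qed.

End local_compactness.

(** * Restriction to Omega and extension by zero *)

Section signed_restriction.
Context (R : realType) disp (X : measurableType disp).
Variables (mu : {measure set X -> \bar R}) (D : set X) (mD : measurable D).

Lemma integral_mrestr_EFin (f : X -> R) : measurable_fun setT f ->
  \int[mrestr mu mD]_x f x = \int[mu]_x (patch (cst 0) D f x).
Proof.
move=> mf; congr fine; have mfE : measurable_fun setT (EFin \o f) by exact/measurable_EFinP.
have e : (\int[mrestr mu mD]_x (f x)%:E = \int[mu]_(x in D) (f x)%:E)%E.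
  rewrite [LHS]integralE [RHS]integralE.
  by congr (_ - _)%E; apply: ge0_integral_mrestr => //;
    [exact: measurable_funepos|exact: measurable_funeneg].
rewrite e integral_mkcond; apply: eq_integral => x _ /=.
by rewrite /patch; case: ifP.
Qed.

Lemma ge0_integral_mrestr_supp (f : X -> \bar R) : measurable_fun setT f ->
  (forall x, 0 <= f x)%E -> (forall x, ~ D x -> f x = 0%E) ->
  (\int[mrestr mu mD]_x f x = \int[mu]_x f x)%E.
Proof.
move=> mf f0 fD; rewrite ge0_integral_mrestr// integral_mkcond.
apply: eq_integral => x _; rewrite /patch; case: ifPn => // /negP xD.
by rewrite fD// => Dx; apply: xD; rewrite inE.
Qed.

Lemma ge0_integral_mrestr_le (f : X -> \bar R) : measurable_fun setT f ->
  (forall x, 0 <= f x)%E -> (\int[mrestr mu mD]_x f x <= \int[mu]_x f x)%E.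
Proof.
move=> mf f0; rewrite ge0_integral_mrestr//.
by apply: ge0_subset_integral => //; exact: measurableT.
Qed.

End signed_restriction.

Section zero_extension.
Context (R : realType) (d : nat) (Omega : lipschitz_domain R d).
Local Notation X := 'rV[R]_d.
Local Notation nu := (lebesgue_rV R d).
Local Notation D := (dom_measure Omega).

Lemma zero_extE (f : X -> R) x : dom Omega x -> zero_ext Omega f x = f x.
Proof. by move=> Ox; rewrite /zero_ext /patch mem_set. Qed.

Lemma zero_ext_out (f : X -> R) x : ~ dom Omega x -> zero_ext Omega f x = 0.
Proof. by move=> Ox; rewrite /zero_ext /patch memNset. Qed.

Lemma measurable_zero_ext (f : X -> R) : measurable_fun setT f ->
  measurable_fun setT (zero_ext Omega f).
Proof.
move=> mf; rewrite (_ : zero_ext Omega f = (fun x => \1_Omega x * f x)).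
  apply: measurable_funM => //; apply: measurable_indic; exact: measurable_dom.
apply/funext => x; rewrite indicE; case: (boolP (x \in (Omega : set X))) => /= xO.
  by rewrite mul1r zero_extE//; exact: set_mem.
by rewrite mul0r zero_ext_out// => Ox; move/negP: xO; apply; rewrite inE.
Qed.

Lemma zero_ext_lin a (f g : X -> R) x :
  zero_ext Omega (fun t => a * f t + g t) x = a * zero_ext Omega f x + zero_ext Omega g x.
Proof. by rewrite /zero_ext /patch; case: ifP => // _; rewrite mulr0 addr0. Qed.

Lemma sqint_zero_ext (f : X -> R) : measurable_fun setT f ->
  sqint nu (zero_ext Omega f) = sqint D f.
Proof.
move=> mf; have mz := measurable_zero_ext mf.
rewrite /sqint -(ge0_integral_mrestr_supp nu (measurable_dom Omega)).
- rewrite ge0_integral_mrestr; last 2 first.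
  + exact: measurable_EFin_sqr.
  + by move=> x; rewrite lee_fin sqr_ge0.
  rewrite ge0_integral_mrestr; last 2 first.
  + exact: measurable_EFin_sqr.
  + by move=> x; rewrite lee_fin sqr_ge0.
  by apply: eq_integral => x /set_mem Ox; rewrite zero_extE.
- exact: measurable_EFin_sqr.
- by move=> x; rewrite lee_fin sqr_ge0.
- by move=> x Ox; rewrite zero_ext_out// expr0n.
Qed.

Lemma zero_ext_Lfun2 (w : L2 D) : zero_ext Omega w \in Lfun nu 2%:E.
Proof.
have mw : measurable_fun setT (w : X -> R) by [].
apply/Lfun2P; split; first exact: measurable_zero_ext.
by rewrite sqint_zero_ext//; have /Lfun2P[] := LfunP w.
Qed.

Lemma restrict_Lfun2 (f : X -> R) : f \in Lfun nu 2%:E -> f \in Lfun D 2%:E.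
Proof.
move=> /Lfun2P[mf foo]; apply/Lfun2P; split => //; apply: le_lt_trans foo.
apply: ge0_integral_mrestr_le; first exact: measurable_EFin_sqr.
by move=> x; rewrite lee_fin sqr_ge0.
Qed.

Lemma L2ip_zero_ext (f g : X -> R) : measurable_fun setT f -> measurable_fun setT g ->
  L2ip nu f (zero_ext Omega g) = L2ip D f g.
Proof.
move=> mf mg; rewrite /L2ip integral_mrestr_EFin; last exact: measurable_funM.
apply: eq_Rintegral => x _; rewrite /zero_ext /patch; case: ifP => // _.
by rewrite mulr0.
Qed.

Lemma zero_ext_ae (f_ : nat -> X -> R) (f : X -> R) :
  {ae D, forall x, f_ n x @[n --> \oo] --> f x} ->
  {ae nu, forall x, zero_ext Omega (f_ n) x @[n --> \oo] --> zero_ext Omega f x}.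
Proof.
move=> /mrestr_ae; apply: filterS => x fx.
have [Ox|Ox] := pselect (dom Omega x).
  rewrite zero_extE// (_ : (fun n => _) = (fun n => f_ n x)); first exact: fx.
  by apply/funext => n; rewrite zero_extE.
rewrite zero_ext_out// (_ : (fun n => _) = (fun=> 0)); first exact: cvg_cst.
by apply/funext => n; rewrite zero_ext_out.
Qed.

End zero_extension.

(** * The Gagliardo energy controls oscillation inside the domain *)

Section gagliardo_compactness.
Context (R : realType) (d : nat) (Omega : lipschitz_domain R d).
Local Notation X := 'rV[R]_d.
Local Notation nu := (lebesgue_rV R d).
Local Notation D := (dom_measure Omega).
Variable s : R.
Hypothesis s_gt0 : 0 < s.

Lemma ler_coord_enorm (x : X) i : `|x ord0 i| <= enorm x.
Proof.
rewrite -sqrtr_sqr; apply: ler_wsqrtr; rewrite (bigD1 i)//= lerDl.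
by apply: sumr_ge0 => j _; rewrite sqr_ge0.
Qed.

Lemma enorm_eq0 (x y : X) : enorm (x - y) = 0 -> x = y.
Proof.
move=> xy; apply/rowP => i; apply/eqP; rewrite -subr_eq0 -normr_le0.
by have := ler_coord_enorm (x - y) i; rewrite xy !mxE.
Qed.

Lemma enorm_cube_le (x y : X) h : cube x h y -> enorm (x - y) <= Num.sqrt d%:R * h.
Proof.
move=> xy; have [h0|hN] := leP 0 h; last first.
  have [e|/negP] := eqVneq d 0%N.
    move: x y xy; rewrite {}e => x y _.
    rewrite [X in X <= _](_ : _ = 0); first by rewrite sqrtr0 mul0r.
    by rewrite /enorm big_ord0 sqrtr0.
  move/negP; rewrite -lt0n => d0; have := xy (Ordinal d0).
  by move=> /(le_lt_trans (normr_ge0 _)); rewrite ltNge ltW.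
rewrite -(ger0_norm h0) -sqrtr_sqr -sqrtrM ?ler0n//; apply: ler_wsqrtr.
rewrite (@le_trans _ _ (\sum_(i < d) h ^+ 2))//; last first.
  by rewrite sumr_const card_ord mulr_natl.
apply: ler_sum => i _; rewrite !mxE -(real_normK (num_real (_ - _))).
by rewrite ler_sqr ?nnegrE// ltW.
Qed.

(** Inside the cube |x - y| <= sqrt(d) h, which bounds the kernel from below. On the diagonal, where
    the kernel takes its default value 0, both sides vanish. *)
Lemma gagliardo_pointwise (g : X -> R) (x y : X) h : 0 < h -> cube x h y ->
  (g x - g y) ^+ 2 <= (Num.sqrt d%:R * h) `^ (d%:R + 2 * s) *
    (`|g x - g y| ^+ 2 / enorm (x - y) `^ (d%:R + 2 * s)).
Proof.
move=> h0 xy; have [e0|eN0] := eqVneq (enorm (x - y)) 0.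
  by rewrite (enorm_eq0 e0) subrr normr0 !expr0n/= mul0r mulr0.
have e0 : 0 < enorm (x - y) by rewrite lt_neqAle eq_sym eN0 enorm_ge0.
rewrite real_normK ?num_real// mulrCA ler_peMr ?sqr_ge0//.
rewrite ler_pdivlMr ?powR_gt0// mul1r ge0_ler_powR//.
- by rewrite addr_ge0// mulr_ge0// ltW.
- by rewrite nnegrE enorm_ge0.
- by rewrite nnegrE mulr_ge0// ltW.
- exact: enorm_cube_le.
Qed.

(** For such x the cube stays inside Omega, so the extension by zero creates no jump there and the
    energy over Omega suffices. *)
Definition inner_set (h : R) : set X := [set x | cube x h `<=` Omega].

Lemma inner_sub h : 0 < h -> inner_set h `<=` Omega.
Proof. by move=> h0 x; apply => i; rewrite subrr normr0. Qed.

Lemma cube_ball (x : X) h : 0 < h -> cube x h = ball x h.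
Proof.
move=> h0; apply/seteqP; split => y xy.
  by split=> // i j; rewrite !ord1; exact: xy.
by case: xy => _ xy i; exact: xy.
Qed.

Lemma measurable_inner_set h : 0 < h -> measurable (inner_set h).
Proof.
move=> h0; rewrite -[inner_set h]setCK; apply: measurableC; apply: open_measurable_rV.
rewrite (_ : ~` inner_set h = \bigcup_(y in ~` Omega) ball y h).
  by apply: bigcup_open => y _; exact: ball_open.
apply/seteqP; split => x /=.
  move=> /existsNP[y /not_implyP[xy Oy]]; exists y => //.
  by apply: ball_sym; rewrite -cube_ball.
move=> [y Oy yx] /(_ y) xO; apply: Oy; apply: xO.
by rewrite cube_ball//; exact: ball_sym.
Qed.

Lemma inner_set_exhausts (x : X) : dom Omega x ->
  exists m, forall k, (m <= k)%N -> inner_set k.+1%:R^-1 x.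
Proof.
move=> Ox; have /nbhs_ballP[e /= e0 xe] : nbhs x (Omega : set X).
  by apply: open_nbhs_nbhs; split => //; exact: dom_open.
have [m _ mP] := near_infty_natSinv_lt (PosNum e0).
exists m => k mk y; rewrite cube_ball ?invr_gt0//; move=> xy; apply: xe.
by apply: le_ball xy; exact/ltW/mP.
Qed.

Lemma oscillation_gagliardo_le (w : L2 D) h k : 0 < h -> h <= k ->
  (oscillation (inner_set k) h (zero_ext Omega w) <=
   ((Num.sqrt d%:R * h) `^ (d%:R + 2 * s))%:E *
   \int[D]_x \int[D]_y
    (`|w x - w y| ^+ 2 / enorm (x - y) `^ (d%:R + 2 * s))%:E)%E.
Proof.
move=> h0 hk; have k0 : 0 < k := lt_le_trans h0 hk.
have mD := measurable_dom Omega.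
pose g := zero_ext Omega w; set c := (_ `^ _).
have mw : measurable_fun setT (w : X -> R) by [].
have mg : measurable_fun setT g := measurable_zero_ext Omega mw.
pose G x y := `|w x - w y| ^+ 2 / enorm (x - y) `^ (d%:R + 2 * s).
have G0 x y : 0 <= G x y by rewrite divr_ge0 ?sqr_ge0 ?powR_ge0.
have GE x y : G x y = gagliardo_quotient s w (x, y) ^+ 2.
  by rewrite /gagliardo_quotient exprMn sqr_sqrt_kernel /G real_normK ?num_real.
have mGxy : measurable_fun setT (fun z : X * X => (G z.1 z.2)%:E).
  rewrite (_ : (fun z => _) = (fun z => (gagliardo_quotient s w z ^+ 2)%:E)).
    exact: measurable_EFin_sqr (measurable_gagliardo_quotient _ mw).
  by apply/funext => -[x y]; rewrite GE.
have mGx x : measurable_fun setT (fun y => (G x y)%:E).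
  exact: (measurableT_comp mGxy (measurable_pair1 x)).
have mGi : measurable_fun setT (fun x => (\int[D]_y (G x y)%:E)%E).
  rewrite (_ : (fun x => _) = (fun x => (\int[nu]_y ((\1_Omega y)%:E * (G x y)%:E))%E)).
    apply: (measurable_fun_fubini_tonelli_F (m2 := nu)
      (fun z : X * X => ((\1_Omega z.2)%:E * (G z.1 z.2)%:E)%E)).
      apply: emeasurable_funM => //; apply/measurable_EFinP.
      exact: (measurableT_comp (measurable_indic mD) measurable_snd).
    by move=> z; rewrite mule_ge0 ?lee_fin ?indicE ?ler0n.
  apply/funext => x; rewrite ge0_integral_mrestr//; last by move=> y; rewrite lee_fin.
  rewrite integral_mkcond; apply: eq_integral => y _.
  by rewrite /patch indicE; case: ifP => _; rewrite ?mul1e ?mul0e.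
have inner_le x : inner_set k x ->
    (\int[nu]_y (\1_(cube x h) y * (g x - g y) ^+ 2)%:E <= c%:E * \int[D]_y (G x y)%:E)%E.
  move=> Kx; have hO : cube x h `<=` Omega.
    by move=> y xy; apply: Kx => i; exact: lt_le_trans (xy i) hk.
  have Ox : dom Omega x by exact: (inner_sub k0 Kx).
  have mi : measurable_fun setT (fun y => (\1_(cube x h) y * (g x - g y) ^+ 2)%:E).
    apply/measurable_EFinP; apply: measurable_funM.
      by apply: measurable_indic; exact: measurable_cube.
    by apply: measurable_funX; apply: measurable_funB.
  have i0 y : (0 <= (\1_(cube x h) y * (g x - g y) ^+ 2)%:E)%E.
    by rewrite lee_fin mulr_ge0 ?sqr_ge0// indicE ler0n.
  rewrite -(ge0_integral_mrestr_supp nu mD mi i0); last first.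
    by move=> y Oy; rewrite indicE memNset ?mul0r// => /hO.
  rewrite -ge0_integralZl_EFin//; last exact: powR_ge0.
  - apply: ge0_le_integral => //; first by apply: emeasurable_funM.
    move=> y _; rewrite -EFinM lee_fin indicE; case: (boolP (y \in cube x h)) => [/set_mem yx|_].
      rewrite mul1r /g (zero_extE _ Ox) (zero_extE _ (hO y yx)).
      exact: gagliardo_pointwise.
    by rewrite mul0r mulr_ge0// powR_ge0.
  - by move=> y _; rewrite lee_fin.
have gL : g \in Lfun nu 2%:E := zero_ext_Lfun2 w.
have mosc : measurable_fun setT (fun x => (\1_(inner_set k) x)%:E *
    \int[nu]_y (\1_(cube x h) y * (g x - g y) ^+ 2)%:E)%E.
  apply: emeasurable_funM; last exact: (measurable_cube_oscillation _ gL).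
  by apply/measurable_EFinP/measurable_indic; exact: measurable_inner_set.
have osc0 x : (0 <= (\1_(inner_set k) x)%:E *
    \int[nu]_y (\1_(cube x h) y * (g x - g y) ^+ 2)%:E)%E.
  rewrite mule_ge0 ?lee_fin ?indicE ?ler0n//; apply: integral_ge0 => y _.
  by rewrite lee_fin mulr_ge0 ?sqr_ge0// indicE ler0n.
rewrite /oscillation -(ge0_integral_mrestr_supp nu mD mosc osc0); last first.
  move=> x Ox; rewrite indicE memNset ?mul0e// => Kx; apply: Ox.
  exact: (inner_sub k0 Kx).
rewrite -ge0_integralZl_EFin//; last exact: powR_ge0.
- apply: ge0_le_integral => //; first by apply: emeasurable_funM.
  move=> x _; rewrite indicE; case: (boolP (x \in inner_set k)) => [/set_mem Kx|_].
    by rewrite mul1e; exact: inner_le.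
  rewrite mul0e mule_ge0 ?lee_fin ?powR_ge0//; apply: integral_ge0 => y _.
  by rewrite lee_fin; exact: G0.
- by move=> x _; apply: integral_ge0 => y _; rewrite lee_fin; exact: G0.
Qed.

End gagliardo_compactness.

(** * Compactness from bounded Gagliardo energy *)

Section gagliardo_compact.
Context (R : realType) (d : nat) (Omega : lipschitz_domain R d).
Local Notation X := 'rV[R]_d.
Local Notation nu := (lebesgue_rV R d).
Local Notation D := (dom_measure Omega).
Variables (s : R) (W : hspace (L2 D)) (c E : R).
Hypotheses (s_gt0 : 0 < s) (pW : prehilbert W) (c_ge0 : 0 <= c) (E_ge0 : 0 <= E).
Hypothesis W_embed : forall w, hcar W w -> L2norm D w <= c * hnorm W w.
Hypothesis W_gagliardo : forall (w : L2 D) M, hcar W w -> hnorm W w <= M ->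
  (\int[D]_x \int[D]_y
    (`|w x - w y| ^+ 2 / enorm (x - y) `^ (d%:R + 2 * s))%:E <= (E * M ^+ 2)%:E)%E.

Lemma L2ip_in_dual (f : L2 D) : in_dual W (L2ip D f).
Proof.
split=> [a x y _ _|]; first by rewrite L2ipDr L2ipZr.
exists (L2norm D f * c) => x cx; apply: le_trans (L2_CS _ _) _.
by rewrite -mulrA ler_wpM2l ?L2norm_ge0// W_embed.
Qed.

Lemma small_cube (a B k dl : R) : 0 < a -> 0 <= B -> 0 < k -> 0 < dl ->
  exists2 h, 0 < h <= k & B * h `^ a <= dl.
Proof.
move=> a0 B0 k0 dl0; have q0 : 0 < dl / (B + 1) by rewrite divr_gt0// ltr_wpDl.
(* B + 1 in the denominator covers B = 0. *)
exists (Num.min k ((dl / (B + 1)) `^ a^-1)).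
  by rewrite lt_min k0 powR_gt0//= ge_min lexx.
set h := Num.min _ _; have h0 : 0 <= h by rewrite le_min (ltW k0) powR_ge0.
have : h `^ a <= dl / (B + 1).
  have -> : dl / (B + 1) = ((dl / (B + 1)) `^ a^-1) `^ a.
    by rewrite -powRrM mulVf ?gt_eqF// powRr1// ltW.
  have hq : h <= (dl / (B + 1)) `^ a^-1 by rewrite /h ge_min lexx orbT.
  have hn : h \is Num.nneg by rewrite nnegrE.
  have qn : (dl / (B + 1)) `^ a^-1 \is Num.nneg by rewrite nnegrE powR_ge0.
  exact: (ge0_ler_powR (ltW a0) hn qn hq).
move=> /(ler_wpM2l B0)/le_trans; apply.
by rewrite mulrCA ler_piMr ?(ltW dl0)// ler_pdivrMr ?ltr_wpDl// mul1r lerDl.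
Qed.

(** On an inner set the oscillation at scale h is of order h^(d+2s), while the volume of the cube is
    of order h^d; the factor h^(2s) makes the quotient small uniformly in n. So [local_cvg] applies
    on each inner set, and [ae_subseq] combines the inner sets, which exhaust Omega. *)
Lemma gagliardo_compact (w_ : nat -> L2 D) (w : L2 D) (M : R) :
  (forall n, hcar W (w_ n)) -> hcar W w -> (forall n, hnorm W (w_ n) <= M) ->
  weak_cvg W w_ w ->
  exists2 sg : nat -> nat, {homo sg : m n / (m < n)%N} &
    {ae D, forall x, w_ (sg k) x @[k --> \oo] --> w x}.
Proof.
move=> cw_ cw wM ww; pose g n := zero_ext Omega (w_ n - w : L2 D).
pose N := M + hnorm W w.
have cd n : hcar W (w_ n - w) := phB pW (cw_ n) cw.
have dN n : hnorm W (w_ n - w) <= N.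
  by apply: le_trans (ph_normB pW (cw_ n) cw) _; rewrite lerD2r.
have gL n : g n \in Lfun nu 2%:E := zero_ext_Lfun2 _.
have gM n : (sqint nu (g n) <= ((c * N) ^+ 2)%:E)%E.
  rewrite sqint_zero_ext//; apply: L2norm_le_sqint.
  by apply: le_trans (W_embed (cd n)) _; rewrite ler_wpM2l.
have g_weak (f : X -> R) : f \in Lfun nu 2%:E -> L2ip nu f (g n) @[n --> \oo] --> (0 : R).
  move=> fL; have fD := restrict_Lfun2 Omega fL.
  pose F : L2 D := Lfun_Sub (lee1n 2) fD.
  have h := ww _ (L2ip_in_dual F).
  have h0 : L2ip D F (w_ n) - L2ip D F w @[n --> \oo] --> (0 : R) by apply/subr_cvg0.
  rewrite (_ : (fun n => _) = (fun n => L2ip D F (w_ n) - L2ip D F w)) //.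
  apply/funext => n; rewrite -L2ipBr /g L2ip_zero_ext//.
  exact: Lfun2_measurable fL.
have K0 k : 0 < (k.+1%:R^-1 : R) by rewrite invr_gt0.
pose K k : set X := inner_set Omega k.+1%:R^-1.
have mK k : measurable (K k) by exact: measurable_inner_set.
have K_lty k : (nu (K k) < +oo)%E.
  apply: le_lt_trans (lebesgue_rV_dom_lty Omega); apply: le_measure; rewrite ?inE//.
    exact: measurable_dom.
  exact: inner_sub.
have osc k dl : 0 < dl -> exists2 h, 0 < h &
     forall n, (oscillation (K k) h (g n) <= (dl * (2 * h) ^+ d)%:E)%E.
  move=> dl0; pose B := Num.sqrt d%:R `^ (d%:R + 2 * s) * (E * N ^+ 2).
  have B0 : 0 <= B by rewrite mulr_ge0 ?powR_ge0// mulr_ge0 ?sqr_ge0.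
  have s20 : 0 < 2 * s by rewrite mulr_gt0.
  have [h /andP[h0 hk] hB] := small_cube s20 B0 (K0 k) (mulr_gt0 dl0 (exprn_gt0 d (ltr0n R 2))).
  exists h => // n.
  apply: le_trans (oscillation_gagliardo_le s_gt0 (w_ n - w) h0 hk) _.
  apply: le_trans (lee_wpmul2l _ (W_gagliardo (cd n) (dN n))) _; first by rewrite lee_fin powR_ge0.
  rewrite -EFinM lee_fin powRM ?sqrtr_ge0 ?(ltW h0)// (@powRD _ h); last by rewrite (gt_eqF h0) implybT.
  rewrite powR_mulrn ?(ltW h0)//.
  rewrite (_ : _ * (E * _) = h ^+ d * (B * h `^ (2 * s))); last by rewrite /B; ring.
  rewrite exprMn [leRHS](_ : _ = h ^+ d * (dl * 2 ^+ d)); last by ring.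
  by rewrite ler_wpM2l// exprn_ge0// ltW.
have mg n : measurable_fun setT (g n) := Lfun2_measurable (gL n).
have loc k := local_cvg (mK k) (K_lty k) gL gM g_weak (osc k).
have [sg hsg sgP] := ae_subseq mg mK loc.
exists sg => //; apply: ae_mrestr; apply: filterS sgP => x gx Ox.
have := gx (inner_set_exhausts Ox) => h0.
apply/subr_cvg0; rewrite (_ : (fun n => _) = (fun k => g (sg k) x)) //.
by apply/funext => k; rewrite /g zero_extE.
Qed.

End gagliardo_compact.

(** * Integrals estimated over dyadic shells *)

Section dyadic.
Context (R : realType).

Lemma dyadic_shell (r : R) : 0 < r -> r <= 1 ->
  exists k : nat, (2 ^+ k.+1)^-1 < r <= (2 ^+ k)^-1.
Proof.
move=> r0 r1.
have ex : exists n : nat, (2 ^+ n)^-1 < r.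
  have r'0 : 0 < r^-1 by rewrite invr_gt0.
  exists (Num.truncn r^-1).+1.
  rewrite invf_plt ?posrE ?exprn_gt0//.
  apply: lt_le_trans (truncnS_gt _) _ => //.
  by rewrite -natrX ler_nat ltnW// ltn_expl.
pose n := ex_minn ex; have : (2 ^+ n)^-1 < r by rewrite /n; case: ex_minnP.
have : forall m, (2 ^+ m)^-1 < r -> (n <= m)%N by rewrite /n; case: ex_minnP.
case: n => [|k] kmin kr; first by move: kr; rewrite expr0 invr1 ltNge r1.
exists k; rewrite kr/= leNgt; apply/negP => /kmin; by rewrite ltnn.
Qed.

Lemma geometric_nneseries_lty (c q : R) : 0 <= c -> 0 <= q -> q < 1 ->
  (\sum_(0 <= k <oo) (c * q ^+ k)%:E < +oo)%E.
Proof.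
move=> c0 q0 q1; apply: (@le_lt_trans _ _ (c / (1 - q))%:E); last exact: ltry.
apply: lime_le; first by apply: is_cvg_nneseries => k _ _; rewrite lee_fin mulr_ge0// exprn_ge0.
near=> n; rewrite sumEFin lee_fin -mulr_sumr ler_wpM2l//.
have q10 : 0 < 1 - q by rewrite subr_gt0.
rewrite -[leRHS]mul1r ler_pdivlMr// big_mkord.
have -> : (\sum_(i < n) q ^+ i) * (1 - q) = 1 - q ^+ n.
  by rewrite -[RHS](opprB (q ^+ n)) subrX1; ring.
by rewrite gerBl exprn_ge0.
Unshelve. all: by end_near. Qed.

(** [F] lives where 0 < rho <= 1, which the shells cover. On shell k it is at most a_k G, and [G]
    has integral at most b_k there. *)
Lemma dyadic_integral_lty disp (X : measurableType disp) (mu : {measure set X -> \bar R})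
    (rho F G : X -> R) (c q : R) (a b : nat -> R) :
  measurable_fun setT rho -> measurable_fun setT F -> measurable_fun setT G ->
  (forall x, 0 <= G x) -> (forall x, 0 <= F x) -> (forall x, F x != 0 -> 0 < rho x <= 1) ->
  (forall k, 0 <= a k) ->
  (forall k x, (2 ^+ k.+1)^-1 < rho x <= (2 ^+ k)^-1 -> F x <= a k * G x) ->
  (forall k, (\int[mu]_x (\1_[set x | ((2 ^+ k.+1)^-1 < rho x <= (2 ^+ k)^-1)%R] x * G x)%:E
    <= (b k)%:E)%E) ->
  0 <= c -> 0 <= q -> q < 1 -> (forall k, a k * b k <= c * q ^+ k) ->
  (\int[mu]_x (F x)%:E <= \sum_(0 <= k <oo) (c * q ^+ k)%:E)%E.
Proof.
move=> mrho mF mG G0 F0 Frho a0 Fa mub c0 q0 q1 abc.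
pose S k : set X := [set x | ((2 ^+ k.+1)^-1 < rho x <= (2 ^+ k)^-1)%R].
have mS k : measurable (S k).
  rewrite (_ : S k = rho @^-1` `](2 ^+ k.+1)^-1, (2 ^+ k)^-1]).
    by rewrite -[X in measurable X]setTI; apply: mrho => //; exact: measurable_itv.
  by apply/seteqP; split => x; rewrite /S /= in_itv.
have mIS k : measurable_fun setT (fun x => (a k * (\1_(S k) x * G x))%:E).
  apply/measurable_EFinP; apply: measurable_funM; first exact: measurable_cst.
  by apply: measurable_funM => //; apply: measurable_indic; exact: mS.
apply: (@le_trans _ _ (\int[mu]_x \sum_(0 <= k <oo) (a k * (\1_(S k) x * G x))%:E)%E).
  apply: ge0_le_integral => //.
  - by move=> x _; rewrite lee_fin.
  - exact/measurable_EFinP.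
  - apply: ge0_emeasurable_sum => // k x _ _.
    by rewrite lee_fin !mulr_ge0// indicE ler0n.
  move=> x _; have T0 k : (0 <= (a k * (\1_(S k) x * G x))%:E)%E.
    by rewrite lee_fin !mulr_ge0// indicE ler0n.
  have [->|Fx] := eqVneq (F x) 0; first by apply: nneseries_ge0.
  have /andP[r0 r1] := Frho x Fx; have [k kP] := dyadic_shell r0 r1.
  apply: le_trans (nneseries_lim_ge k.+1 (fun k _ _ => T0 k)).
  rewrite big_nat_recr//=; apply: (@le_trans _ _ (a k * (\1_(S k) x * G x))%:E).
    by rewrite lee_fin indicE mem_set// mul1r Fa.
  by rewrite leeDr// sume_ge0.
rewrite integral_nneseries//; last by move=> k x _; rewrite lee_fin !mulr_ge0// indicE ler0n.
apply: lee_nneseries => k _.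
  by move=> _; apply: integral_ge0 => x _; rewrite lee_fin !mulr_ge0// indicE ler0n.
under eq_integral do rewrite EFinM.
rewrite ge0_integralZl_EFin//; last 2 first.
- by move=> x _; rewrite lee_fin mulr_ge0// indicE ler0n.
- by apply/measurable_EFinP; apply: measurable_funM => //; exact: measurable_indic.
apply: (@le_trans _ _ (a k * b k)%:E); last by rewrite lee_fin.
by rewrite EFinM; apply: lee_wpmul2l; [rewrite lee_fin|exact: mub].
Qed.

End dyadic.

(** * Finiteness and positivity of the Gamma integral and of the kernel constant *)

Section gamma.
Context (R : realType).
Local Notation leb := (@lebesgue_measure R).

(** With m > z, t^(z-1) <= t^m <= (2m)^m exp(t/2); the second inequality is 1 + x <= exp(x) at x =
    t/(2m), raised to the power m. *)
Lemma gamma_tail (z t : R) : 0 < z -> 1 <= t ->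
  t `^ (z - 1) * expR (- t) <=
  (2 * (Num.truncn z).+1%:R) ^+ (Num.truncn z).+1 * expR (- (t / 2)).
Proof.
move=> z0 t1; set m := (Num.truncn z).+1; have t0 : 0 <= t := le_trans ler01 t1.
have m0 : 0 < m%:R :> R by rewrite ltr0n.
have h1 : t `^ (z - 1) <= t ^+ m.
  rewrite -powR_mulrn//; apply: ler_powR => //.
  by rewrite lerBlDr (le_trans (ltW (truncnS_gt z)))// lerDl.
have h2 : t ^+ m <= (2 * m%:R) ^+ m * expR (t / 2).
  have -> : expR (t / 2) = expR (t / (2 * m%:R)) ^+ m.
    by rewrite -expRM_natl; congr expR; field; rewrite gt_eqF.
  rewrite -exprMn lerXn2r ?nnegrE ?mulr_ge0 ?expR_ge0 ?ler0n//.
  rewrite -ler_pdivrMl ?mulr_gt0//; apply: le_trans (expR_ge1Dx _).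
  by rewrite mulrC lerDr.
have -> : expR (- (t / 2)) = expR (t / 2) * expR (- t).
  by rewrite -expRD; congr expR; field.
by rewrite mulrA ler_wpM2r ?expR_ge0// (le_trans h1).
Qed.

(** On the shell near 2^-k the integrand t^z / t is at most q^k 2^(k+1) with q = 2^-z < 1, and the
    shell has length at most 2^-k. *)
Lemma gamma_head (z : R) : 0 < z ->
  (\int[leb]_t (\1_(`]0%R, 1%R]%classic) t * t `^ (z - 1))%:E < +oo)%E.
Proof.
move=> z0; pose F t : R := \1_(`]0%R, 1%R]%classic) t * t `^ (z - 1); pose q : R := (2^-1) `^ z.
have q0 : 0 <= q := powR_ge0 _ _.
have q1 : q < 1.
  have -> : 1 = (1 : R) `^ z by rewrite powR1.
  rewrite /q gt0_ltr_powR ?nnegrE ?invr_ge0//.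
  by rewrite invf_plt ?posrE// invr1 ltr1n.
have I01 t : F t != 0 -> 0 < t <= 1.
  rewrite /F indicE; have [|] := pselect (`]0%R, 1%R]%classic t); first by rewrite /= in_itv.
  by move=> h; rewrite memNset// mul0r eqxx.
have iexp k : 0 <= (2 ^+ k)^-1 :> R by rewrite invr_ge0 exprn_ge0.
have qk k : ((2 ^+ k)^-1) `^ z = q ^+ k.
  by rewrite -exprVn -powR_mulrn ?invr_ge0// powRAC powR_mulrn ?powR_ge0.
apply: le_lt_trans (geometric_nneseries_lty (c := 2) (q := q) _ q0 q1) => //.
apply: (@dyadic_integral_lty _ _ _ leb id F (cst 1) 2 q (fun k => q ^+ k * 2 ^+ k.+1)
  (fun k => (2 ^+ k)^-1)) => //.
- apply: measurable_funM; last exact: measurable_powR.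
  by apply: measurable_indic; exact: measurable_itv.
- by move=> t; rewrite /F mulr_ge0 ?powR_ge0// indicE ler0n.
- by move=> k; rewrite mulr_ge0 ?exprn_ge0.
- move=> k t /andP[kt tk]; rewrite /F mulr1 indicE mem_set ?mul1r; last first.
    rewrite /= in_itv/= (le_lt_trans (iexp k.+1) kt)/=.
    by rewrite (le_trans tk)// invf_ple ?posrE ?exprn_gt0// invr1 exprn_ege1// ler1n.
  have t0 : 0 < t := le_lt_trans (iexp _) kt.
  have -> : t `^ (z - 1) = t `^ z / t.
    by rewrite powRD ?(gt_eqF t0) ?implybT// powR_inv1// ltW.
  apply: ler_pM; rewrite ?powR_ge0 ?invr_ge0 ?(ltW t0)//.
    by rewrite -qk ge0_ler_powR ?nnegrE ?(ltW t0) ?(ltW z0).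
  by rewrite invf_ple ?posrE ?exprn_gt0// ltW.
- move=> k; have h : (leb `]((2 ^+ k.+1)^-1)%R, ((2 ^+ k)^-1)%R]%classic <= ((2 ^+ k)^-1)%:E)%E.
    rewrite lebesgue_measure_itv/= lte_fin; case: ifPn => _; last by rewrite lee_fin.
    by rewrite -EFinB lee_fin lerBlDr lerDl.
  apply: le_trans h; rewrite le_eqVlt; apply/orP; left; apply/eqP.
  under eq_integral do rewrite mulr1.
  rewrite (_ : [set _ | _] = `]((2 ^+ k.+1)^-1)%R, ((2 ^+ k)^-1)%R]%classic); last first.
    by apply/seteqP; split => x /=; rewrite in_itv.
  by rewrite integral_indic ?setIT.
- by move=> k; rewrite exprS mulrA mulfK ?expf_neq0// mulrC.
Qed.

(** A real-valued integral would be 0 if it diverged, so positivity requires finiteness as well. The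
    interval [1, 2] gives the lower bound; the head and an exponential density of rate 1/2 give the
    upper one. *)
Lemma Gamma_gt0 (z : R) : 0 < z -> 0 < Gamma z.
Proof.
move=> z0; rewrite /Gamma; pose F t : R := t `^ (z - 1) * expR (- t).
rewrite -[Rintegral _ _ _]/(Rintegral leb `]0, +oo[ F).
have F0 t : 0 <= F t by rewrite mulr_ge0 ?powR_ge0 ?expR_ge0.
have mF : measurable_fun setT F.
  apply: measurable_funM; first exact: measurable_powR.
  by apply: (measurableT_comp (@measurable_expR R)); exact: measurable_funN.
have mE A : measurable_fun A (fun t => (F t)%:E).
  by apply/measurable_EFinP; exact: measurable_funS mF.
pose C : R := (2 * (Num.truncn z).+1%:R) ^+ (Num.truncn z).+1.
have C0 : 0 <= C by rewrite exprn_ge0// mulr_ge0.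
rewrite /Rintegral; apply: fine_gt0; apply/andP; split.
  pose m : R := 2^-1 * expR (- 2).
  have m0 : 0 < m by rewrite mulr_gt0// expR_gt0.
  apply: (@lt_le_trans _ _ (\int[leb]_(t in `[1%R, 2%R]) m%:E)%E).
    rewrite integral_cst//= lebesgue_measure_itv/= lte_fin ltr1n/= -EFinB -EFinM lte_fin.
    by rewrite mulr_gt0// subr_gt0 ltr1n.
  apply: (@le_trans _ _ (\int[leb]_(t in `[1%R, 2%R]) (F t)%:E)%E).
    apply: ge0_le_integral => //.
    - by move=> t _; rewrite lee_fin ltW.
    - exact: mE.
    move=> t; rewrite /= in_itv/= => /andP[t1 t2]; rewrite lee_fin.
    have t0 : 0 < t := lt_le_trans ltr01 t1.
    apply: ler_pM; rewrite ?expR_ge0 ?invr_ge0//; last by rewrite ler_expR lerN2.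
    rewrite powRD ?(gt_eqF t0) ?implybT// powR_inv1 ?(ltW t0)// -[leLHS]mul1r.
    apply: ler_pM; rewrite ?invr_ge0 ?ler01 ?ler0n//.
      by rewrite -(powRr0 t) ler_powR// ltW.
    by rewrite lef_pV2 ?posrE.
  apply: ge0_subset_integral => //; [exact: mE| |].
    by move=> t _; rewrite lee_fin.
  by apply: subset_itv; rewrite bnd_simp.
pose E t : R := exponential_pdf 2^-1 t.
have E0 t : 0 <= E t by apply: exponential_pdf_ge0; rewrite invr_ge0.
have mEE : measurable_fun setT E := measurable_exponential_pdf _.
pose F1 (t : R) := \1_(`]0%R, 1%R]%classic) t * t `^ (z - 1).
have F10 t : 0 <= F1 t by rewrite mulr_ge0 ?powR_ge0// indicE ler0n.
have mF1 : measurable_fun setT F1.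
  apply: measurable_funM; last exact: measurable_powR.
  by apply: measurable_indic; exact: measurable_itv.
apply: (@le_lt_trans _ _ (\int[leb]_t ((F1 t)%:E + (C * 2)%:E * (E t)%:E))%E).
  rewrite integral_mkcond; apply: ge0_le_integral => //.
  - by move=> t _; rewrite patchE; case: ifPn => // _; rewrite lee_fin.
  - apply/(measurable_restrictT _ (measurable_itv _)); exact: mE.
  - apply: emeasurable_funD; first exact/measurable_EFinP.
    by apply: emeasurable_funM => //; exact/measurable_EFinP.
  move=> t _; rewrite patchE; case: ifPn; last first.
    by move=> _; rewrite -EFinM -EFinD lee_fin addr_ge0// !mulr_ge0.
  rewrite inE/= in_itv/= andbT => t0; rewrite -EFinM -EFinD lee_fin.
  have [t1|t1] := leP t 1.
    rewrite /F1 indicE mem_set ?mul1r /= ?in_itv/= ?t0//.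
    rewrite ler_wpDr ?mulr_ge0// /F -[leRHS]mulr1 ler_wpM2l ?powR_ge0//.
    by rewrite -expR0 ler_expR oppr_le0 ltW.
  rewrite ler_wpDl// (le_trans (gamma_tail z0 (ltW t1)))// -/C.
  rewrite /E exponential_pdfE ?(ltW t0)// -mulrA ler_wpM2l//.
  by rewrite mulrA mulfV// mul1r mulNr mulrC.
rewrite ge0_integralD//=; last 4 first.
- by move=> t _; rewrite lee_fin.
- exact/measurable_EFinP.
- by move=> t _; rewrite -EFinM lee_fin !mulr_ge0.
- by apply: emeasurable_funM => //; exact/measurable_EFinP.
rewrite ge0_integralZl_EFin ?mulr_ge0//; last 2 first.
- by move=> t _; rewrite lee_fin.
- exact/measurable_EFinP.
by rewrite integral_exponential_pdf ?invr_gt0// mule1 lte_add_pinfty ?ltry// gamma_head.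
Qed.

Lemma c_ds_gt0 (d : nat) (s : R) : 0 < s -> s < 1 -> 0 < c_ds d s.
Proof.
move=> s0 s1; rewrite /c_ds divr_gt0// !mulr_gt0 ?powR_gt0 ?pi_gt0 ?Gamma_gt0//.
  by rewrite ltr_pwDl.
by rewrite subr_gt0.
Qed.

End gamma.

(** * The spaces defined by a Gagliardo norm *)

Section gagliardo_space.
Context (R : realType) (d : nat) (Omega : lipschitz_domain R d).
Local Notation X := 'rV[R]_d.
Local Notation D := (dom_measure Omega).
Variables (s : R) (mu : {sigma_finite_measure set X -> \bar R}) (e : L2 D -> X -> R).
Hypotheses (s_gt0 : 0 < s) (s_lt1 : s < 1).
Hypothesis e_lin : forall a u v x, e (a *: u + v) x = a * e u x + e v x.
Hypothesis e_meas : forall u, measurable_fun setT (e u).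
Hypothesis e_ae : forall (u_ : nat -> L2 D) (u : L2 D),
  {ae D, forall x, u_ n x @[n --> \oo] --> u x} ->
  {ae mu, forall x, e (u_ n) x @[n --> \oo] --> e u x}.
Hypothesis e_ip : forall u v : L2 D, L2ip mu (e u) (e v) = L2ip D u v.
Hypothesis e_le : forall u : L2 D,
  (\int[D]_x \int[D]_y (`|u x - u y| ^+ 2 / enorm (x - y) `^ (d%:R + 2 * s))%:E <=
   \int[mu]_x \int[mu]_y (`|e u x - e u y| ^+ 2 / enorm (x - y) `^ (d%:R + 2 * s))%:E)%E.

Let H : hspace (L2 D) := @HSpace R (L2 D) [set w : L2 D | gagliardo_finite mu s (e w)]
  (fun u w : L2 D => Hs_ip mu s (e u) (e w)).
Let B (u : L2 D) := gagliardo_quotient s (e u).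
Let c : R := c_ds d s / 2.

Let c_gt0 : 0 < c. Proof. by rewrite divr_gt0// c_ds_gt0. Qed.

Let H_car u : hcar H u <-> (sqint (mu \x mu)%E (B u) < +oo)%E.
Proof. by rewrite /= /gagliardo_finite gagliardo_quotientE. Qed.

Let B_meas u : measurable_fun setT (B u).
Proof. exact: measurable_gagliardo_quotient. Qed.

Let H_ip u v : hcar H u -> hcar H v ->
  hip H u v = 1 * L2ip D u v + c * L2ip (mu \x mu)%E (B u) (B v).
Proof.
move=> cu cv; rewrite /= mul1r Hs_ipE ?e_ip//.
  by apply/Lfun2P; split; [exact: B_meas|exact/H_car].
by apply/Lfun2P; split; [exact: B_meas|exact/H_car].
Qed.

Let B_lin a u v z : B (a *: u + v) z = a * B u z + B v z.
Proof. by rewrite /B /gagliardo_quotient !e_lin; ring. Qed.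

Let B_ae (u_ : nat -> L2 D) (u : L2 D) :
  L2norm D (u_ n - u) @[n --> \oo] --> (0 : R) ->
  {ae D, forall x, u_ n x @[n --> \oo] --> u x} ->
  {ae (mu \x mu)%E, forall z, B (u_ n) z @[n --> \oo] --> B u z}.
Proof. by move=> _ uu; apply: gagliardo_quotient_ae; exact: e_ae. Qed.

(** The map [e] is the identity with the measure of Omega for H^s, and the extension by zero with
    Lebesgue measure for its tilde variant. By [e_le], compactness uses the energy over Omega in
    both cases. *)
Lemma good_gagliardo : good_space H.
Proof.
have c0 := ltW c_gt0.
have pH : prehilbert H := energy_prehilbert ler01 c0 B_lin B_meas H_car H_ip.
have embed w : hcar H w -> L2norm D w <= 1 * hnorm H w.
  by rewrite mul1r; exact: (energy_embed ler01 c0 B_lin B_meas H_car H_ip).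
split => //.
- by exists 1.
- by move=> w_ w cw cauchy ww; exact: (energy_complete ler01 (lexx 1) c0 B_lin B_meas H_car H_ip B_ae c_gt0 cw cauchy ww).
move=> w_ w M; apply: (@gagliardo_compact _ _ _ s H 1 c^-1) => //.
  by rewrite invr_ge0.
move=> u K cu uK; apply: le_trans (e_le u) _; rewrite gagliardo_quotientE//.
exact: (energy_sqint_le ler01 c0 B_lin B_meas H_car H_ip c_gt0 cu uK).
Qed.

End gagliardo_space.

Section domain_integral.
Context (R : realType) (d : nat) (Omega : lipschitz_domain R d).
Local Notation X := 'rV[R]_d.
Local Notation nu := (lebesgue_rV R d).
Local Notation D := (dom_measure Omega).

(** Holds without measurability, since the integral of a nonnegative function is a supremum over the
    simple functions below it. *)
Lemma ge0_le_integralT disp (X : measurableType disp) (mu : {measure set X -> \bar R})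
    (f g : X -> \bar R) : (forall x, 0 <= f x)%E -> (forall x, f x <= g x)%E ->
  (\int[mu]_x f x <= \int[mu]_x g x)%E.
Proof.
move=> f0 fg; have g0 x : (0 <= g x)%E by exact: le_trans (f0 x) (fg x).
rewrite !ge0_integralTE//; apply: ge_ereal_sup => _ [h hf <-].
by apply: ereal_sup_ubound; exists h => // x; exact: le_trans (hf x) (fg x).
Qed.

Let sigma_finite_dom : sigma_finite setT D.
Proof.
apply: fin_num_fun_sigma_finite; first by rewrite measure0 ltry.
move=> A mA; rewrite ge0_fin_numE//; apply: le_lt_trans (dom_measure_lty Omega).
by apply: le_measure; rewrite ?inE.
Qed.

(** The measure [dom_measure Omega] bundled with its sigma-finiteness, which product measures
    require. *)
Definition sigma_finite_D : {sigma_finite_measure set X -> \bar R} :=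
  HB.pack (mrestr nu (measurable_dom Omega)) (Measure_isSigmaFinite.Build _ _ _ (mrestr nu (measurable_dom Omega)) sigma_finite_dom).

Lemma measurable_gagliardo (s : R) (w : X -> R) : measurable_fun setT w ->
  measurable_fun setT (fun z : X * X =>
    `|w z.1 - w z.2| ^+ 2 / enorm (z.1 - z.2) `^ (d%:R + 2 * s)).
Proof.
move=> mw; rewrite (_ : (fun z => _) = (fun z => gagliardo_quotient s w z ^+ 2)).
  by apply: measurable_funX; exact: measurable_gagliardo_quotient.
apply/funext => -[x y]; rewrite /gagliardo_quotient exprMn sqr_sqrt_kernel.
by rewrite real_normK ?num_real.
Qed.

Lemma dom_dom_le (H H' : X -> X -> R) :
  measurable_fun setT (fun z : X * X => H z.1 z.2) ->
  (forall x y, 0 <= H x y) -> (forall x y, 0 <= H' x y) ->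
  (forall x y, dom Omega x -> dom Omega y -> H x y <= H' x y) ->
  (\int[D]_x \int[D]_y (H x y)%:E <= \int[nu]_x \int[nu]_y (H' x y)%:E)%E.
Proof.
move=> mH H0 H'0 HH'; have mHE : measurable_fun setT (fun z : X * X => (H z.1 z.2)%:E).
  exact/measurable_EFinP.
have i0 (m : {measure set X -> \bar R}) x : (0 <= \int[m]_y (H x y)%:E)%E.
  by apply: integral_ge0 => y _; rewrite lee_fin.
rewrite ge0_integral_mrestr//; last first.
  by apply: (measurable_fun_fubini_tonelli_F (m2 := sigma_finite_D) _ mHE) => z; rewrite lee_fin.
rewrite integral_mkcond; apply: ge0_le_integralT => x; rewrite patchE.
  by case: ifP => // _; exact: i0.
case: ifPn => [/set_mem xO|_]; last by apply: integral_ge0 => y _; rewrite lee_fin.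
have mHx : measurable_fun setT (fun y => (H x y)%:E).
  exact: (measurableT_comp mHE (measurable_pair1 x)).
rewrite ge0_integral_mrestr//; last by move=> y; rewrite lee_fin.
rewrite integral_mkcond; apply: ge0_le_integralT => y; rewrite patchE.
  by case: ifP => // _; rewrite lee_fin.
by case: ifPn => [/set_mem yO|_]; rewrite lee_fin// HH'.
Qed.

End domain_integral.

Section sobolev_spaces.
Context (R : realType) (d : nat) (Omega : lipschitz_domain R d).
Local Notation X := 'rV[R]_d.
Local Notation nu := (lebesgue_rV R d).
Local Notation D := (dom_measure Omega).
Variables (s : R).
Hypotheses (s_gt0 : 0 < s) (s_lt1 : s < 1).

Lemma good_Hs : good_space (Hs Omega s).
Proof.
apply: (@good_gagliardo _ _ Omega s (sigma_finite_D Omega) (fun u : L2 D => (u : X -> R))) => //.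
Qed.

Lemma good_Hs_tilde : good_space (Hs_tilde Omega s).
Proof.
apply: (@good_gagliardo _ _ Omega s nu (fun u : L2 D => zero_ext Omega u)) => //.
- by move=> a u v x; exact: zero_ext_lin.
- by move=> u; apply: measurable_zero_ext.
- by move=> u_ u; exact: zero_ext_ae.
- move=> u v; have mu : measurable_fun setT (u : X -> R) by [].
  have mv : measurable_fun setT (v : X -> R) by [].
  rewrite -(L2ip_zero_ext Omega mu mv) /L2ip; apply: eq_Rintegral => x _.
  by rewrite /zero_ext /patch; case: ifP => // _; rewrite !mulr0.
move=> u; have mu : measurable_fun setT (u : X -> R) by [].
have mz := measurable_zero_ext Omega mu.
apply: (@dom_dom_le _ _ Omega (fun x y => `|u x - u y| ^+ 2 / enorm (x - y) `^ (d%:R + 2 * s))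
  (fun x y => `|zero_ext Omega u x - zero_ext Omega u y| ^+ 2 / enorm (x - y) `^ (d%:R + 2 * s))).
- exact: measurable_gagliardo.
- by move=> x y; rewrite divr_ge0 ?sqr_ge0 ?powR_ge0.
- by move=> x y; rewrite divr_ge0 ?sqr_ge0 ?powR_ge0.
- by move=> x y Ox Oy; rewrite !zero_extE.
Qed.

End sobolev_spaces.

(** * Nonlocal energies on product spaces *)

Section kernel_energy.
Context (R : realType).

Definition kernel_energy disp (X : measurableType disp) (m : {measure set X -> \bar R})
    (K : X -> X -> R) (F : X -> R) : \bar R :=
  (\int[m]_x \int[m]_y (K x y * (F x - F y) ^+ 2)%:E)%E.

Section product.
Context d1 d2 (X1 : measurableType d1) (X2 : measurableType d2).
Variables (m1 : {sigma_finite_measure set X1 -> \bar R})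
  (m2 : {sigma_finite_measure set X2 -> \bar R}).
Local Notation m := (m1 \x m2)%E.

Lemma sigma_finite_product : sigma_finite setT m.
Proof.
have /sigma_finiteP[A [TA ndA Aoo]] := sigma_finiteT m1.
have /sigma_finiteP[B [TB ndB Boo]] := sigma_finiteT m2.
exists (fun k => A k `*` B k) => [|k].
  rewrite -setXTT TA TB predeqE => -[x y]; split.
    move=> [/= [n _ Anx] [k _ Bky]]; exists (maxn n k) => //; split.
    - by move: x Anx; exact/subsetPset/ndA/leq_maxl.
    - by move: y Bky; exact/subsetPset/ndB/leq_maxr.
  by move=> [n _ []/= ? ?]; split; exists n.
have [mA Ak] := Aoo k; have [mB Bk] := Boo k; split; first exact: measurableX.
by rewrite product_measure1E// lte_mul_pinfty// ge0_fin_numE.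
Qed.

(** The integrand depends on the second coordinate of q only through [K], whose integral is at most
    V; that coordinate is integrated out first. *)
Lemma integral_slice_fst (g : X1 * X2 -> X1 -> R) (K : X2 -> X2 -> R) (V : R) :
  measurable_fun setT (fun z : (X1 * X2) * X1 => g z.1 z.2) ->
  measurable_fun setT (fun z : X2 * X2 => K z.1 z.2) ->
  (forall p b, 0 <= g p b) -> (forall v w, 0 <= K v w) -> 0 <= V ->
  (forall v, \int[m2]_w (K v w)%:E <= V%:E)%E ->
  (\int[m]_p \int[m]_q (g p q.1 * K p.2 q.2)%:E <=
   V%:E * \int[m]_p \int[m1]_b (g p b)%:E)%E.
Proof.
move=> mg mK g0 K0 V0 KV.
have mgE : measurable_fun setT (fun z : (X1 * X2) * X1 => (g z.1 z.2)%:E).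
  exact/measurable_EFinP.
rewrite -ge0_integralZl_EFin//; last 2 first.
- by move=> p _; apply: integral_ge0 => b _; rewrite lee_fin.
- by apply: (measurable_fun_fubini_tonelli_F (m2 := m1) _ mgE) => z; rewrite lee_fin.
apply: ge0_le_integralT => p.
  by apply: integral_ge0 => q _; rewrite lee_fin mulr_ge0.
have mgp : measurable_fun setT (g p).
  exact: (measurableT_comp mg (measurable_pair1 p)).
have mKp : measurable_fun setT (K p.2).
  exact: (measurableT_comp mK (measurable_pair1 p.2)).
rewrite (fubini_tonelli1 (fun q : X1 * X2 => (g p q.1 * K p.2 q.2)%:E)); last 2 first.
- apply/measurable_EFinP; apply: measurable_funM.
    exact: (measurableT_comp mgp measurable_fst).
  exact: (measurableT_comp mKp measurable_snd).
- by move=> q; rewrite lee_fin mulr_ge0.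
rewrite -ge0_integralZl_EFin//; last 2 first.
- by move=> b _; rewrite lee_fin.
- exact/measurable_EFinP.
apply: ge0_le_integralT => b.
  by apply: integral_ge0 => w _; rewrite lee_fin mulr_ge0.
rewrite /fubini_F /=; under eq_integral do rewrite EFinM.
rewrite ge0_integralZl_EFin//; last 2 first.
- by move=> w _; rewrite lee_fin.
- exact/measurable_EFinP.
by rewrite muleC lee_wpmul2r// lee_fin.
Qed.

Lemma integral_slice_snd (g : X1 * X2 -> X2 -> R) (K : X1 -> X1 -> R) (V : R) :
  measurable_fun setT (fun z : (X1 * X2) * X2 => g z.1 z.2) ->
  measurable_fun setT (fun z : X1 * X1 => K z.1 z.2) ->
  (forall p b, 0 <= g p b) -> (forall v w, 0 <= K v w) -> 0 <= V ->
  (forall v, \int[m1]_w (K v w)%:E <= V%:E)%E ->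
  (\int[m]_p \int[m]_q (g p q.2 * K p.1 q.1)%:E <=
   V%:E * \int[m]_p \int[m2]_b (g p b)%:E)%E.
Proof.
move=> mg mK g0 K0 V0 KV.
have mgE : measurable_fun setT (fun z : (X1 * X2) * X2 => (g z.1 z.2)%:E).
  exact/measurable_EFinP.
rewrite -ge0_integralZl_EFin//; last 2 first.
- by move=> p _; apply: integral_ge0 => b _; rewrite lee_fin.
- by apply: (measurable_fun_fubini_tonelli_F (m2 := m2) _ mgE) => z; rewrite lee_fin.
apply: ge0_le_integralT => p.
  by apply: integral_ge0 => q _; rewrite lee_fin mulr_ge0.
have mgp : measurable_fun setT (g p).
  exact: (measurableT_comp mg (measurable_pair1 p)).
have mKp : measurable_fun setT (K p.1).
  exact: (measurableT_comp mK (measurable_pair1 p.1)).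
rewrite (fubini_tonelli2 (fun q : X1 * X2 => (g p q.2 * K p.1 q.1)%:E)); last 2 first.
- apply/measurable_EFinP; apply: measurable_funM.
    exact: (measurableT_comp mgp measurable_snd).
  exact: (measurableT_comp mKp measurable_fst).
- by move=> q; rewrite lee_fin mulr_ge0.
rewrite -ge0_integralZl_EFin//; last 2 first.
- by move=> b _; rewrite lee_fin.
- exact/measurable_EFinP.
apply: ge0_le_integralT => b.
  by apply: integral_ge0 => w _; rewrite lee_fin mulr_ge0.
rewrite /fubini_G /=; under eq_integral do rewrite EFinM.
rewrite ge0_integralZl_EFin//; last 2 first.
- by move=> w _; rewrite lee_fin.
- exact/measurable_EFinP.
by rewrite muleC lee_wpmul2r// lee_fin.
Qed.

Variables (K1 : X1 -> X1 -> R) (K2 : X2 -> X2 -> R) (V1 V2 : R) (F : X1 * X2 -> R).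
Hypotheses (mK1 : measurable_fun setT (fun z : X1 * X1 => K1 z.1 z.2))
  (mK2 : measurable_fun setT (fun z : X2 * X2 => K2 z.1 z.2)) (mF : measurable_fun setT F).
Hypotheses (K1_ge0 : forall x y, 0 <= K1 x y) (K2_ge0 : forall x y, 0 <= K2 x y).
Hypotheses (K1_sym : forall x y, K1 x y = K1 y x) (K2_sym : forall x y, K2 x y = K2 y x).
Hypotheses (V1_ge0 : 0 <= V1) (V2_ge0 : 0 <= V2).
Hypotheses (K1_le : forall x, (\int[m1]_y (K1 x y)%:E <= V1%:E)%E)
  (K2_le : forall x, (\int[m2]_y (K2 x y)%:E <= V2%:E)%E).

(** Pass from (a, v) to (b, w) through (b, v), changing one coordinate at a time. With t the
    intermediate value, 2 (x - t)^2 + 2 (y - t)^2 - (x - y)^2 = (x + y - 2 t)^2 >= 0. In each of the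
    two terms one coordinate is free and is integrated out against its kernel. *)
Lemma product_energy_le :
  (kernel_energy m (fun p q => K1 p.1 q.1 * K2 p.2 q.2)%R F <=
   (2 * V2)%:E * \int[m2]_v kernel_energy m1 K1 (fun a => F (a, v)) +
   (2 * V1)%:E * \int[m1]_a kernel_energy m2 K2 (fun v => F (a, v)))%E.
Proof.
pose g1 (p : X1 * X2) b := K1 p.1 b * (F p - F (b, p.2)) ^+ 2.
pose g2 (q : X1 * X2) v := K2 q.2 v * (F q - F (q.1, v)) ^+ 2.
have g10 p b : 0 <= g1 p b by rewrite mulr_ge0// sqr_ge0.
have g20 p b : 0 <= g2 p b by rewrite mulr_ge0// sqr_ge0.
have mff d3 d4 d5 (Y1 : measurableType d3) (Y2 : measurableType d4) (Y3 : measurableType d5) :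
    measurable_fun setT (fun z : (Y1 * Y2) * Y3 => z.1.1).
  exact: (measurableT_comp measurable_fst measurable_fst).
have mfs d3 d4 d5 (Y1 : measurableType d3) (Y2 : measurableType d4) (Y3 : measurableType d5) :
    measurable_fun setT (fun z : (Y1 * Y2) * Y3 => z.1.2).
  exact: (measurableT_comp measurable_snd measurable_fst).
have mg1 : measurable_fun setT (fun z : (X1 * X2) * X1 => g1 z.1 z.2).
  apply: measurable_funM.
    apply: (measurableT_comp mK1 (g := fun z : (X1 * X2) * X1 => (z.1.1, z.2))).
    by apply: measurable_fun_pair => //; exact: mff.
  apply: measurable_funX; apply: measurable_funB.
    exact: (measurableT_comp mF measurable_fst).
  apply: (measurableT_comp mF (g := fun z : (X1 * X2) * X1 => (z.2, z.1.2))).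
  by apply: measurable_fun_pair => //; exact: mfs.
have mg2 : measurable_fun setT (fun z : (X1 * X2) * X2 => g2 z.1 z.2).
  apply: measurable_funM.
    apply: (measurableT_comp mK2 (g := fun z : (X1 * X2) * X2 => (z.1.2, z.2))).
    by apply: measurable_fun_pair => //; exact: mfs.
  apply: measurable_funX; apply: measurable_funB.
    exact: (measurableT_comp mF measurable_fst).
  apply: (measurableT_comp mF (g := fun z : (X1 * X2) * X2 => (z.1.1, z.2))).
  by apply: measurable_fun_pair => //; exact: mff.
pose M : {sigma_finite_measure set (X1 * X2)%type -> \bar R} :=
  HB.pack (m1 \x m2)%E (Measure_isSigmaFinite.Build _ _ _ (m1 \x m2)%E sigma_finite_product).
pose A (z : (X1 * X2) * (X1 * X2)) := g1 z.1 z.2.1 * K2 z.1.2 z.2.2.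
pose B (z : (X1 * X2) * (X1 * X2)) := g2 z.2 z.1.2 * K1 z.2.1 z.1.1.
pose G (z : (X1 * X2) * (X1 * X2)) :=
  K1 z.1.1 z.2.1 * K2 z.1.2 z.2.2 * (F z.1 - F z.2) ^+ 2.
have A0 z : 0 <= A z by rewrite mulr_ge0.
have B0 z : 0 <= B z by rewrite mulr_ge0.
have G0 z : 0 <= G z := mulr_ge0 (mulr_ge0 (K1_ge0 _ _) (K2_ge0 _ _)) (sqr_ge0 _).
have msf : measurable_fun setT (fun z : (X1 * X2) * (X1 * X2) => z.2.1).
  exact: (measurableT_comp measurable_fst measurable_snd).
have mss : measurable_fun setT (fun z : (X1 * X2) * (X1 * X2) => z.2.2).
  exact: (measurableT_comp measurable_snd measurable_snd).
have mK1' : measurable_fun setT (fun z : (X1 * X2) * (X1 * X2) => K1 z.1.1 z.2.1).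
  apply: (measurableT_comp mK1 (g := fun z : (X1 * X2) * (X1 * X2) => (z.1.1, z.2.1))).
  by apply: measurable_fun_pair => //; exact: mff.
have mK2' : measurable_fun setT (fun z : (X1 * X2) * (X1 * X2) => K2 z.1.2 z.2.2).
  apply: (measurableT_comp mK2 (g := fun z : (X1 * X2) * (X1 * X2) => (z.1.2, z.2.2))).
  by apply: measurable_fun_pair => //; exact: mfs.
have mA : measurable_fun setT A.
  apply: measurable_funM => //.
  apply: (measurableT_comp mg1 (g := fun z : (X1 * X2) * (X1 * X2) => (z.1, z.2.1))).
  exact: measurable_fun_pair.
have mB : measurable_fun setT B.
  rewrite (_ : B = fun z => g2 z.2 z.1.2 * K1 z.1.1 z.2.1).
    apply: measurable_funM => //.
    apply: (measurableT_comp mg2 (g := fun z : (X1 * X2) * (X1 * X2) => (z.2, z.1.2))).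
    by apply: measurable_fun_pair => //; exact: mfs.
  by apply/funext => z; rewrite /B K1_sym.
have mG : measurable_fun setT G.
  apply: measurable_funM; first exact: measurable_funM.
  apply: measurable_funX; apply: measurable_funB.
    exact: (measurableT_comp mF measurable_fst).
  exact: (measurableT_comp mF measurable_snd).
have GAB z : ((G z)%:E <= (2 * A z)%:E + (2 * B z)%:E)%E.
  rewrite -EFinD lee_fin /G /A /B /g1 /g2.
  rewrite (K1_sym z.2.1) (K2_sym z.2.2) -subr_ge0.
  set x := F z.1; set y := F z.2.
  set t := F (z.2.1, z.1.2); set k := K1 _ _; set l := K2 _ _.
  have -> : 2 * (k * (x - t) ^+ 2 * l) + 2 * (l * (y - t) ^+ 2 * k) - k * l * (x - y) ^+ 2
      = k * l * (x + y - 2 * t) ^+ 2 by ring.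
  exact: mulr_ge0 (mulr_ge0 (K1_ge0 _ _) (K2_ge0 _ _)) (sqr_ge0 _).
have intA : (\int[M \x M]_z (A z)%:E <=
    V2%:E * \int[m2]_v kernel_energy m1 K1 (fun a => F (a, v)))%E.
  rewrite (fubini_tonelli1 (m1 := M) (m2 := M) (fun z => (A z)%:E)); last 2 first.
  - exact/measurable_EFinP.
  - by move=> z; rewrite lee_fin.
  apply: le_trans (integral_slice_fst mg1 mK2 g10 K2_ge0 V2_ge0 K2_le) _.
  rewrite (fubini_tonelli2 (fun p => \int[m1]_b (g1 p b)%:E)%E) //.
  - by apply: (measurable_fun_fubini_tonelli_F (m2 := m1) (fun z => (g1 z.1 z.2)%:E));
      [exact/measurable_EFinP|move=> z; rewrite lee_fin].
  - by move=> p; apply: integral_ge0 => b _; rewrite lee_fin.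
have intB : (\int[M \x M]_z (B z)%:E <=
    V1%:E * \int[m1]_a kernel_energy m2 K2 (fun v => F (a, v)))%E.
  rewrite (fubini_tonelli2 (m1 := M) (m2 := M) (fun z => (B z)%:E)); last 2 first.
  - exact/measurable_EFinP.
  - by move=> z; rewrite lee_fin.
  apply: le_trans (integral_slice_snd mg2 mK1 g20 K1_ge0 V1_ge0 K1_le) _.
  rewrite (fubini_tonelli1 (fun p => \int[m2]_b (g2 p b)%:E)%E) //.
  - by apply: (measurable_fun_fubini_tonelli_F (m2 := m2) (fun z => (g2 z.1 z.2)%:E));
      [exact/measurable_EFinP|move=> z; rewrite lee_fin].
  - by move=> p; apply: integral_ge0 => b _; rewrite lee_fin.
rewrite /kernel_energy -(fubini_tonelli1 (m1 := M) (m2 := M) (fun z => (G z)%:E)); last 2 first.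
- exact/measurable_EFinP.
- by move=> z; rewrite lee_fin.
apply: (@le_trans _ _ (\int[M \x M]_z ((2 * A z)%:E + (2 * B z)%:E))%E).
  by apply: ge0_le_integralT => z; [rewrite lee_fin|exact: GAB].
rewrite ge0_integralD//; last 4 first.
- by move=> z _; rewrite lee_fin mulr_ge0.
- by apply/measurable_EFinP; exact: measurable_funM.
- by move=> z _; rewrite lee_fin mulr_ge0.
- by apply/measurable_EFinP; exact: measurable_funM.
under eq_integral do rewrite EFinM.
under [X in (_ + X)%E]eq_integral do rewrite EFinM.
rewrite !ge0_integralZl_EFin//; last 4 first.
- by move=> z _; rewrite lee_fin.
- exact/measurable_EFinP.
- by move=> z _; rewrite lee_fin.
- exact/measurable_EFinP.
by rewrite !EFinM -!muleA; apply: leeD; apply: lee_wpmul2l => //; rewrite lee_fin.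
Qed.

End product.
End kernel_energy.

(** * Nonlocal energy on the line *)

Section line_energy.
Context (R : realType).
Local Notation leb := (@lebesgue_measure R).
Local Notation RT := (measurableTypeR R).
Variables (f g : R -> R).
Hypotheses (f_derive : forall x : R, is_derive x 1 f (g x)) (g_cont : continuous g).

Let mg : measurable_fun setT (g : RT -> RT).
Proof. exact: continuous_measurable_fun. Qed.

Lemma increment_integral (a b : R) : a < b ->
  (\int[leb]_(t in `[a, b]) (g t)%:E = (f b - f a)%:E)%E.
Proof.
move=> ab; have fc x : {for x, continuous f}.
  by apply/differentiable_continuous/derivable1_diffP; case: (f_derive x).
rewrite EFinB; apply: continuous_FTC2 => //.
- exact: continuous_subspaceT.
- split; first by move=> x _; case: (f_derive x).
    by apply: cvg_at_right_filter; exact: fc.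
  by apply: cvg_at_left_filter; exact: fc.
- by move=> x _; rewrite derive1E; case: (f_derive x).
Qed.

(** The fundamental theorem of calculus, then Cauchy-Schwarz against the indicator of the interval;
    an infinite right-hand side is treated apart. *)
Lemma sqr_increment_le (a b : R) : a <= b ->
  (((f b - f a) ^+ 2)%:E <= (b - a)%:E * \int[leb]_(t in `[a, b]) (g t ^+ 2)%:E)%E.
Proof.
rewrite le_eqVlt => /predU1P[->|ab]; first by rewrite !subrr expr0n mul0e.
pose J : set RT := `[a, b]%classic; have mJ : measurable J := measurable_itv _.
have ba0 : 0 < b - a by rewrite subr_gt0.
have lJ : leb J = (b - a)%:E by rewrite /J lebesgue_measure_itv/= lte_fin ab EFinB.
have mi : measurable_fun setT (\1_J : RT -> R) by exact: measurable_indic.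
have sqi : sqint leb (\1_J : RT -> R) = (b - a)%:E.
  transitivity (\int[leb]_x (\1_J x)%:E)%E; last by rewrite integral_indic// setIT; exact: lJ.
  by apply: eq_integral => x _; rewrite indicE; case: (_ \in _); rewrite ?expr1n ?expr0n.
pose v0 (t : RT) : R := \1_J t * g t.
have mv : measurable_fun setT v0 by exact: measurable_funM.
have sqv : sqint leb v0 = (\int[leb]_(t in `[a, b]) (g t ^+ 2)%:E)%E.
  rewrite integral_mkcond; apply: eq_integral => x _.
  rewrite /v0 patchE indicE; case: (_ \in _); rewrite ?mul1r// mul0r expr0n//.
have [vf|] := ltP (sqint leb v0) +oo%E; last first.
  by rewrite -sqv leye_eq => /eqP ->; rewrite gt0_muley ?leey// lte_fin.
have uL : (\1_J : RT -> R) \in Lfun leb 2%:E by apply/Lfun2P; rewrite sqi ltry.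
have vL : v0 \in Lfun leb 2%:E by apply/Lfun2P.
pose u : L2 leb := Lfun_Sub (lee1n 2) uL; pose v : L2 leb := Lfun_Sub (lee1n 2) vL.
have ip : L2ip leb u v = f b - f a.
  rewrite /L2ip /Rintegral -[RHS]/(fine (f b - f a)%:E) -(increment_integral ab).
  congr fine; rewrite [RHS]integral_mkcond; apply: eq_integral => x _ /=.
  by rewrite /v0 patchE indicE; case: (_ \in _); rewrite ?mul1r ?mul0r.
rewrite -sqv -[sqint leb v0]/(sqint leb v) -L2norm_sqint -sqi.
rewrite -[sqint leb \1_J]/(sqint leb u) -L2norm_sqint -EFinM lee_fin -exprMn.
rewrite -ip -(real_normK (num_real (L2ip leb u v))).
by rewrite lerXn2r ?nnegrE ?mulr_ge0 ?L2norm_ge0// L2_CS.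
Qed.

Definition line_kernel (h : R) (x y : RT) : R := \1_[set z : RT * RT | `|z.1 - z.2| < h] (x, y).

Lemma measurable_line_kernel h : measurable_fun setT (fun z : RT * RT => line_kernel h z.1 z.2).
Proof.
rewrite (_ : (fun z => _) = \1_[set z : RT * RT | `|z.1 - z.2| < h]); last first.
  by apply/funext => -[].
apply: measurable_indic.
have mn : measurable_fun setT (fun z : RT * RT => `|z.1 - z.2|).
  by apply: (measurableT_comp (@normr_measurable R setT)); exact: measurable_funB.
rewrite (_ : [set z | _] = (fun z : RT * RT => `|z.1 - z.2|) @^-1` `]-oo, h[%classic).
  by rewrite -[X in measurable X]setTI; apply: mn => //; exact: measurable_itv.
by apply/seteqP; split => z /=; rewrite in_itv.
Qed.

Lemma line_kernel_ge0 h x y : 0 <= line_kernel h x y.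
Proof. by rewrite /line_kernel indicE ler0n. Qed.

Lemma line_kernel_sym h x y : line_kernel h x y = line_kernel h y x.
Proof.
rewrite /line_kernel !indicE; congr (nat_of_bool _)%:R.
by apply/idP/idP => /set_mem /= xy; rewrite inE /= distrC.
Qed.

Lemma integral_line_kernel h x : 0 < h -> (\int[leb]_y (line_kernel h x y)%:E = (2 * h)%:E)%E.
Proof.
move=> h0; have mI : measurable (`](x - h)%R, (x + h)%R[%classic : set RT) by exact: measurable_itv.
transitivity (leb `](x - h)%R, (x + h)%R[%classic).
  rewrite -[X in _ = leb X]setIT -(integral_indic leb measurableT mI).
  apply: eq_integral => y _; rewrite /line_kernel !indicE; congr (_%:R%:E)%E.
  congr nat_of_bool; apply/idP/idP => /set_mem /= xy; rewrite inE /=.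
    by rewrite in_itv/=; move: xy; rewrite ltr_distlC.
  by move: xy; rewrite in_itv/= ltr_distlC.
rewrite lebesgue_measure_itv/= lte_fin.
have -> : x - h < x + h by rewrite ltrBlDr -addrA ltrDl addr_gt0.
by rewrite -EFinB; congr EFin; ring.
Qed.

(** For |x - y| < h the squared increment is at most h times the integral of g^2 over |x - t| < h.
    Integration in y and exchange of x and t each give a factor 2h, in total 4 h^3. *)
Lemma line_energy_le h : 0 < h ->
  (kernel_energy leb (line_kernel h) f <= (4 * h ^+ 3)%:E * \int[leb]_t (g t ^+ 2)%:E)%E.
Proof.
move=> h0; pose K := line_kernel h; have K0 := line_kernel_ge0 h.
pose I (x : R) : \bar R := (\int[leb]_t (K x t * g t ^+ 2)%:E)%E.
have Kg0 x t : 0 <= K x t * g t ^+ 2 by rewrite mulr_ge0 ?sqr_ge0.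
have I0 x : (0 <= I x)%E by apply: integral_ge0 => t _; rewrite lee_fin.
have mK := measurable_line_kernel h.
have mKx x : measurable_fun setT (K x) := measurableT_comp mK (measurable_pair1 x).
have mg2 : measurable_fun setT (fun t : RT => g t ^+ 2) by exact: measurable_funX.
have mKg : measurable_fun setT (fun z : RT * RT => (K z.1 z.2 * g z.2 ^+ 2)%:E).
  apply/measurable_EFinP; apply: measurable_funM; first exact: mK.
  exact: (measurableT_comp mg2 measurable_snd).
have mI : measurable_fun setT I.
  by apply: (measurable_fun_fubini_tonelli_F (m2 := leb) _ mKg) => z; rewrite lee_fin.
have KI x y : ((K x y * (f x - f y) ^+ 2)%:E <= (K x y)%:E * (h%:E * I x))%E.
  rewrite EFinM /K /line_kernel indicE; case: (boolP (_ \in _)) => [/set_mem /= xy|_]; last by rewrite !mul0e.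
  rewrite !mul1e.
  have sub (a b : R) : `[a, b] `<=` [set t | `|x - t| < h] -> a <= b -> b - a <= h ->
      (((f b - f a) ^+ 2)%:E <= h%:E * I x)%E.
    move=> abx ab bah; apply: le_trans (sqr_increment_le ab) _.
    apply: lee_pmul => //; rewrite ?lee_fin ?subr_ge0//.
      by apply: integral_ge0 => t _; rewrite lee_fin sqr_ge0.
    rewrite integral_mkcond; apply: ge0_le_integralT => t.
      by rewrite patchE; case: ifP => // _; rewrite lee_fin sqr_ge0.
    rewrite patchE; case: ifPn => [/set_mem/abx tx|_]; last by rewrite lee_fin.
    by rewrite lee_fin /K /line_kernel indicE mem_set// mul1r.
  have [le_xy|/ltW le_yx] := leP x y.
    rewrite -sqrrN opprB; apply: sub => //.
      move=> t /=; rewrite in_itv/= => /andP[xt ty]; move: xy.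
      by rewrite !ler0_norm ?subr_le0//; apply: le_lt_trans; rewrite lerN2 lerB.
    by apply: ltW; move: xy; rewrite ler0_norm ?subr_le0// opprB.
  apply: sub => //.
    move=> t /=; rewrite in_itv/= => /andP[yt tx]; move: xy.
    by rewrite !ger0_norm ?subr_ge0//; apply: le_lt_trans; rewrite lerB.
  by apply: ltW; move: xy; rewrite ger0_norm ?subr_ge0.
apply: (@le_trans _ _ (\int[leb]_x ((2 * h * h)%:E * I x))%E).
  apply: ge0_le_integralT => x.
    by apply: integral_ge0 => y _; rewrite lee_fin mulr_ge0// sqr_ge0.
  apply: (@le_trans _ _ (\int[leb]_y ((K x y)%:E * (h%:E * I x)))%E).
    by apply: ge0_le_integralT => y; [rewrite lee_fin mulr_ge0// sqr_ge0|exact: KI].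
  rewrite ge0_integralZr//; last 3 first.
  - exact/measurable_EFinP.
  - by move=> y _; rewrite lee_fin.
  - by rewrite mule_ge0// lee_fin ltW.
  by rewrite integral_line_kernel// muleA -EFinM.
rewrite ge0_integralZl_EFin//; last by rewrite !mulr_ge0// ltW.
have -> : (\int[leb]_x I x = (2 * h)%:E * \int[leb]_t (g t ^+ 2)%:E)%E.
  rewrite /I (fubini_tonelli (m1 := leb) (m2 := leb) (fun z : RT * RT => (K z.1 z.2 * g z.2 ^+ 2)%:E) mKg)//; last first.
    by move=> z; rewrite lee_fin.
  rewrite -ge0_integralZl_EFin//; last 3 first.
  - by move=> t _; rewrite lee_fin sqr_ge0.
  - exact/measurable_EFinP.
  - by rewrite mulr_ge0// ltW.
  apply: eq_integral => t _; rewrite /fubini_G /=.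
  under eq_integral do rewrite EFinM.
  rewrite ge0_integralZr//; last 3 first.
  - by apply/measurable_EFinP; exact: (measurableT_comp mK (measurable_pair2 t)).
  - by move=> x _; rewrite lee_fin.
  - by rewrite lee_fin sqr_ge0.
  congr (_ * _)%E; rewrite -(integral_line_kernel t h0).
  by apply: eq_integral => x _; rewrite /K line_kernel_sym.
by rewrite muleA -EFinM le_eqVlt; apply/orP; left; apply/eqP; congr (_%:E * _)%E; ring.
Qed.

End line_energy.

(** * Nonlocal energy over cubes bounded by the gradient *)

Section gradient_energy.
Context (R : realType).
Local Notation leb := (@lebesgue_measure R).

Definition cube_kernel d (h : R) (x y : 'rV[R]_d) : R := \1_(cube x h) y.

Lemma measurable_cube_kernel d (h : R) :
  measurable_fun setT (fun z : 'rV[R]_d * 'rV[R]_d => cube_kernel h z.1 z.2).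
Proof.
rewrite (_ : (fun z => _) = \1_(cube_rel h)); first by apply: measurable_indic; exact: measurable_cube_rel.
by apply/funext => z; rewrite /cube_kernel !indicE.
Qed.

Lemma cube_kernel_ge0 d (h : R) (x y : 'rV[R]_d) : 0 <= cube_kernel h x y.
Proof. by rewrite /cube_kernel indicE ler0n. Qed.

Lemma cube_kernel_sym d (h : R) (x y : 'rV[R]_d) : cube_kernel h x y = cube_kernel h y x.
Proof.
rewrite /cube_kernel !indicE; congr (nat_of_bool _)%:R.
by apply/idP/idP => /set_mem /= xy; rewrite inE => i; rewrite distrC; exact: xy.
Qed.

Lemma cube_kernel_cons d (h : R) (p q : measurableTypeR R * 'rV[R]_d) :
  cube_kernel h (cons_rV p) (cons_rV q) = line_kernel h p.1 q.1 * cube_kernel h p.2 q.2.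
Proof.
rewrite /cube_kernel /line_kernel !indicE -natrM mulnb; congr (nat_of_bool _)%:R.
apply/idP/andP => [/set_mem pq|[/set_mem/= pq1 /set_mem pq2]].
  split; rewrite inE /=; first by have := pq ord0; rewrite !cons_rV0.
  by move=> i; have := pq (lift ord0 i); rewrite !cons_rVS.
by rewrite inE => i; case: (unliftP ord0 i) => [j ->|->];
  rewrite ?cons_rVS ?cons_rV0//; exact: pq2.
Qed.

Lemma integral_cons_rV d (F : 'rV[R]_d.+1 -> \bar R) : measurable_fun setT F ->
  (forall x, 0 <= F x)%E ->
  (\int[lebesgue_rV R d.+1]_x F x = \int[leb \x lebesgue_rV R d]_p F (cons_rV p))%E.
Proof.
move=> mF F0; rewrite -[LHS]/(\int[pushforward (leb \x lebesgue_rV R d)%E (@cons_rV R d)]_x F x)%E.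
by rewrite (ge0_integral_pushforward (@measurable_cons_rV R d))// preimage_setT.
Qed.

Lemma kernel_energy_cons d h (f : 'rV[R]_d.+1 -> R) : measurable_fun setT f ->
  (kernel_energy (lebesgue_rV R d.+1) (@cube_kernel d.+1 h) f =
   kernel_energy (leb \x lebesgue_rV R d)%E
     (fun p q => line_kernel h p.1 q.1 * cube_kernel h p.2 q.2)%R (f \o @cons_rV R d))%E.
Proof.
move=> mf; pose G (z : 'rV[R]_d.+1 * 'rV[R]_d.+1) := cube_kernel h z.1 z.2 * (f z.1 - f z.2) ^+ 2.
have G0 z : 0 <= G z := mulr_ge0 (cube_kernel_ge0 _ _ _) (sqr_ge0 _).
have mG : measurable_fun setT (fun z => (G z)%:E).
  apply/measurable_EFinP; apply: measurable_funM; first exact: measurable_cube_kernel.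
  apply: measurable_funX; apply: measurable_funB.
    exact: (measurableT_comp mf measurable_fst).
  exact: (measurableT_comp mf measurable_snd).
rewrite /kernel_energy integral_cons_rV; last 2 first.
- by apply: (measurable_fun_fubini_tonelli_F (m2 := lebesgue_rV R d.+1) _ mG) => z; rewrite lee_fin.
- by move=> x; apply: integral_ge0 => y _; rewrite lee_fin; exact: (G0 (x, y)).
apply: eq_integral => p _; rewrite integral_cons_rV; last 2 first.
- exact: (measurableT_comp mG (measurable_pair1 (cons_rV p))).
- by move=> y; rewrite lee_fin; exact: (G0 (_, y)).
by apply: eq_integral => q _; rewrite cube_kernel_cons.
Qed.

(** Regularity is required only along coordinate lines, a condition inherited by the slices used in
    the induction on the dimension. *)
Definition line_gradient d (f : 'rV[R]_d -> R) (g : 'I_d -> 'rV[R]_d -> R) :=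
  [/\ measurable_fun setT f, forall i, measurable_fun setT (g i),
      forall i x (t : R), is_derive t 1 (fun t : R => f (x + t *: delta_mx ord0 i))
        (g i (x + t *: delta_mx ord0 i)) &
      forall i x, continuous (fun t : R => g i (x + t *: delta_mx ord0 i))].

Lemma cons_rV_add0 d (a t : R) (v : 'rV[R]_d) :
  cons_rV ((a + t : R) : measurableTypeR R, v) =
  cons_rV (a : measurableTypeR R, v) + t *: delta_mx ord0 ord0.
Proof.
apply/rowP => i; rewrite [RHS]mxE [X in _ = _ + X]mxE [X in _ = _ + _ * X]mxE.
case: (unliftP ord0 i) => [j ->|->].
  by rewrite !cons_rVS eqxx /= mulr0 addr0.
by rewrite !cons_rV0 !eqxx mulr1.
Qed.

Lemma cons_rV_addS d (a t : R) (v : 'rV[R]_d) i :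
  cons_rV (a : measurableTypeR R, v + t *: delta_mx ord0 i) =
  cons_rV (a : measurableTypeR R, v) + t *: delta_mx ord0 (lift ord0 i).
Proof.
apply/rowP => k; rewrite [RHS]mxE [X in _ = _ + X]mxE [X in _ = _ + _ * X]mxE.
case: (unliftP ord0 k) => [j ->|->].
  by rewrite !cons_rVS !mxE /= (inj_eq lift_inj).
by rewrite !cons_rV0 eqxx /= mulr0 addr0.
Qed.

Lemma line_gradient_head d (f : 'rV[R]_d.+1 -> R) g (v : 'rV[R]_d) : line_gradient f g ->
  (forall a : R, is_derive a 1 (fun a : R => f (cons_rV (a : measurableTypeR R, v)))
    (g ord0 (cons_rV (a : measurableTypeR R, v)))) /\
  continuous (fun a : R => g ord0 (cons_rV (a : measurableTypeR R, v))).
Proof.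
move=> [_ _ fg gc]; pose x := cons_rV (0 : measurableTypeR R, v).
have e (a : R) : cons_rV (a : measurableTypeR R, v) = x + a *: delta_mx ord0 ord0.
  by rewrite -cons_rV_add0 add0r.
split=> [a|].
  rewrite e (_ : (fun a => _) = (fun t => f (x + t *: delta_mx ord0 ord0))); first exact: fg.
  by apply/funext => t; rewrite e.
rewrite (_ : (fun a => _) = (fun t => g ord0 (x + t *: delta_mx ord0 ord0))); first exact: gc.
by apply/funext => t; rewrite e.
Qed.

Lemma line_gradient_tail d (f : 'rV[R]_d.+1 -> R) g (a : measurableTypeR R) :
  line_gradient f g ->
  line_gradient (fun v : 'rV[R]_d => f (cons_rV (a, v)))
    (fun i v => g (lift ord0 i) (cons_rV (a, v))).
Proof.
move=> [mf mg fg gc]; have mc : measurable_fun setT (fun v : 'rV[R]_d => cons_rV (a, v)).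
  exact: (measurableT_comp (@measurable_cons_rV R d) (measurable_pair1 a)).
split=> [|i|i x t|i x].
- exact: (measurableT_comp mf mc).
- exact: (measurableT_comp (mg _) mc).
- rewrite cons_rV_addS (_ : (fun t => _) =
    (fun t => f (cons_rV (a, x) + t *: delta_mx ord0 (lift ord0 i)))); first exact: fg.
  by apply/funext => t'; rewrite cons_rV_addS.
- rewrite (_ : (fun t => _) =
    (fun t => g (lift ord0 i) (cons_rV (a, x) + t *: delta_mx ord0 (lift ord0 i)))); first exact: gc.
  by apply/funext => t'; rewrite cons_rV_addS.
Qed.

(** Split off the first coordinate with [product_energy_le]. Its contribution has the constant 2
    (2h)^d 4 h^3 <= 4^(d+2) h^(d+3); the remaining coordinates give exactly 2 (2h) 4^(d+1) h^(d+2) =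
    4^(d+2) h^(d+3). *)
Lemma gradient_energy_le d (f : 'rV[R]_d -> R) g h : line_gradient f g -> 0 < h ->
  (kernel_energy (lebesgue_rV R d) (@cube_kernel d h) f <=
   (4 ^+ d.+1 * h ^+ d.+2)%:E * \sum_(i < d) \int[lebesgue_rV R d]_x (g i x ^+ 2)%:E)%E.
Proof.
move=> + h0; elim: d f g => [|d IH] f g fg.
  rewrite big_ord0 mule0 /kernel_energy integral0_eq// => x _.
  rewrite integral0_eq// => y _.
  by rewrite (_ : x = y) ?subrr ?expr0n ?mulr0//; apply/rowP => -[].
have [mf mg _ _] := fg; have hn n : 0 <= h ^+ n by rewrite exprn_ge0// ltW.
have mgc i : measurable_fun setT (fun p : measurableTypeR R * 'rV[R]_d => (g i (cons_rV p) ^+ 2)%:E).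
  apply: measurable_EFin_sqr; exact: (measurableT_comp (mg i) (@measurable_cons_rV R d)).
have gc0 i p : (0 <= (g i (cons_rV p) ^+ 2)%:E)%E by rewrite lee_fin sqr_ge0.
have mge i : measurable_fun setT (fun x => (g i x ^+ 2)%:E) by exact: measurable_EFin_sqr.
rewrite kernel_energy_cons//.
have h2 : 0 <= 2 * h by rewrite mulr_ge0// ltW.
apply: le_trans (product_energy_le (V1 := 2 * h) (V2 := (2 * h) ^+ d) _ _ _ _ _ _ _ _ _ _ _) _ => //.
- exact: measurable_line_kernel.
- exact: measurable_cube_kernel.
- exact: (measurableT_comp mf (@measurable_cons_rV R d)).
- exact: line_kernel_sym.
- exact: cube_kernel_sym.
- by rewrite exprn_ge0.
- by move=> x; rewrite integral_line_kernel.
- move=> x; rewrite /cube_kernel integral_indic//; last exact: measurable_cube.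
  rewrite setIT -(lebesgue_cube x (ltW h0)); exact: lexx.
rewrite big_ord_recl [leRHS]ge0_muleDr; last 2 first.
- by apply: integral_ge0 => x _; rewrite lee_fin sqr_ge0.
- by apply: sume_ge0 => i _; apply: integral_ge0 => x _; rewrite lee_fin sqr_ge0.
apply: leeD.
  apply: (@le_trans _ _ ((2 * (2 * h) ^+ d)%:E *
      ((4 * h ^+ 3)%:E * \int[lebesgue_rV R d.+1]_x (g ord0 x ^+ 2)%:E))%E).
    apply: lee_wpmul2l; first by rewrite lee_fin mulr_ge0// exprn_ge0.
    rewrite integral_cons_rV//; last by move=> x; rewrite lee_fin sqr_ge0.
    rewrite (fubini_tonelli2 (fun p => (g ord0 (cons_rV p) ^+ 2)%:E))//.
    rewrite -ge0_integralZl_EFin//; last 3 first.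
    - by move=> v _; apply: integral_ge0.
    - exact: (measurable_fun_fubini_tonelli_G (m1 := leb)).
    - by rewrite mulr_ge0.
    apply: ge0_le_integralT => v.
      apply: integral_ge0 => a _; apply: integral_ge0 => b _.
      by rewrite lee_fin mulr_ge0 ?sqr_ge0 ?line_kernel_ge0.
    by have [fv gv] := line_gradient_head v fg; exact: line_energy_le.
  rewrite muleA -EFinM; apply: lee_wpmul2r.
    by apply: integral_ge0 => x _; rewrite lee_fin sqr_ge0.
  rewrite lee_fin exprMn [leLHS](_ : _ = (8 * 2 ^+ d) * h ^+ d.+3); last by rewrite !exprS; ring.
  rewrite ler_wpM2r// !exprS (_ : 4 * (4 * 4 ^+ d) = 16 * 4 ^+ d); last by ring.
  have h24 : (2 : R) ^+ d <= 4 ^+ d by rewrite lerXn2r ?nnegrE// ler_nat.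
  by apply: ler_pM => //; rewrite ler_nat.
apply: (@le_trans _ _ ((2 * (2 * h))%:E * \int[leb]_a ((4 ^+ d.+1 * h ^+ d.+2)%:E *
    \sum_(i < d) \int[lebesgue_rV R d]_v (g (lift ord0 i) (cons_rV (a, v)) ^+ 2)%:E))%E).
  apply: lee_wpmul2l; first by rewrite lee_fin mulr_ge0.
  apply: ge0_le_integralT => a.
    apply: integral_ge0 => v _; apply: integral_ge0 => w _.
    by rewrite lee_fin mulr_ge0 ?sqr_ge0 ?cube_kernel_ge0.
  exact: IH (line_gradient_tail a fg).
have mF i : measurable_fun setT (fun a : measurableTypeR R =>
    \int[lebesgue_rV R d]_v (g (lift ord0 i) (cons_rV (a, v)) ^+ 2)%:E)%E.
  by apply: (measurable_fun_fubini_tonelli_F (m2 := lebesgue_rV R d)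
    (fun p => (g (lift ord0 i) (cons_rV p) ^+ 2)%:E)).
have F0 i (a : measurableTypeR R) :
    (0 <= \int[lebesgue_rV R d]_v (g (lift ord0 i) (cons_rV (a, v)) ^+ 2)%:E)%E.
  by apply: integral_ge0 => v _.
rewrite ge0_integralZl_EFin//; last 3 first.
- by move=> a _; apply: sume_ge0.
- exact: emeasurable_sum.
- by rewrite mulr_ge0// exprn_ge0.
rewrite ge0_integral_sum// muleA -EFinM.
rewrite (_ : 2 * (2 * h) * (4 ^+ d.+1 * h ^+ d.+2) = 4 ^+ d.+2 * h ^+ d.+3); last first.
  by rewrite !exprS; ring.
apply: lee_wpmul2l; first by rewrite lee_fin mulr_ge0// exprn_ge0.
apply: lee_sum => i _; rewrite integral_cons_rV//; last by move=> x; rewrite lee_fin sqr_ge0.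
by rewrite (fubini_tonelli1 (fun p => (g (lift ord0 i) (cons_rV p) ^+ 2)%:E)).
Qed.

End gradient_energy.

(** * Test functions and their square integrability *)

Section test_functions.
Context (R : realType) (d : nat) (Omega : lipschitz_domain R d).
Local Notation X := 'rV[R]_d.
Local Notation nu := (lebesgue_rV R d).
Local Notation D := (dom_measure Omega).

Lemma continuous_measurable_rV (f : X -> R) : continuous f ->
  measurable_fun setT (f : X -> measurableTypeR R).
Proof.
move=> cf; apply: (measurability _ (RGenOpens.measurableE R)) => _ [_ [a [b ->]] <-].
rewrite setTI; apply: open_measurable_rV; move/continuousP : cf; apply.
exact: interval_open.
Qed.

Lemma test_fun_off (f : X -> R) x : test_fun Omega f -> ~ dom Omega x ->
  \forall y \near x, f y = 0.
Proof.
move=> [_ _ fO] Ox; have : nbhs x (~` closure [set x | f x != 0]).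
  apply: open_nbhs_nbhs; split; first by apply: closed_openC; exact: closed_closure.
  by move=> /fO.
apply: filterS => y yf; apply: contrapT => /eqP fy; apply: yf; exact: subset_closure.
Qed.

Lemma test_fun_out (f : X -> R) x : test_fun Omega f -> ~ dom Omega x -> f x = 0.
Proof. by move=> tf Ox; exact: nbhs_singleton (test_fun_off tf Ox). Qed.

Lemma partial_out (f : X -> R) i x : test_fun Omega f -> ~ dom Omega x -> partial i f x = 0.
Proof.
move=> tf Ox; rewrite /partial (near_eq_derive (g := cst 0)) ?derive_cst//.
exact: test_fun_off tf Ox.
Qed.

Lemma test_fun_line_gradient (f : X -> R) : test_fun Omega f ->
  line_gradient f (fun i => partial i f).
Proof.
move=> [sf _ _]; split.
- by apply: continuous_measurable_rV; case: (sf [::]).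
- by move=> i; apply: continuous_measurable_rV; case: (sf [:: i]).
- move=> i x t; have [_ /(_ i (x + t *: delta_mx ord0 i))] := sf [::].
  rewrite /partial /derivable /derive /=.
  have -> : (fun h : R => h^-1 *: (f (h *: (delta_mx ord0 i : X) + (x + t *: delta_mx ord0 i))
      - f (x + t *: delta_mx ord0 i))) =
      (fun h : R => h^-1 *: (f (x + (h *: 1 + t) *: delta_mx ord0 i)
      - f (x + t *: delta_mx ord0 i))).
    apply/funext => h; congr (_ *: (f _ - _)).
    by rewrite scalerDl addrCA [h *: 1]mulr1.
  by move=> cf; split.
move=> i x t; apply: (@continuous_comp R X R (fun t : R => x + t *: delta_mx ord0 i)).
  have c1 : (fun t : R => x + t *: (delta_mx ord0 i : X)) t' @[t' --> t] --> x + t *: (delta_mx ord0 i : X).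
    by apply: cvgD; [exact: cvg_cst|apply: cvgZr_tmp; exact: cvg_id].
  exact: c1.
by case: (sf [:: i]) => /(_ (x + t *: delta_mx ord0 i)).
Qed.

Lemma continuous_dom_bounded (f : X -> R) (K : set X) : continuous f -> compact K ->
  exists2 M, 0 <= M & forall x, K x -> `|f x| <= M.
Proof.
move=> cf cK; have : compact (f @` K) by apply: continuous_compact => //; exact: continuous_subspaceT.
move=> /compact_bounded[M [Mr MP]]; exists (`|M| + 1) => [|x Kx]; first by rewrite addr_ge0.
have M1 : M < `|M| + 1 by rewrite (le_lt_trans (ler_norm M))// ltrDl.
by apply: (MP _ M1); exists x.
Qed.

Lemma bounded_dom_Lfun2 (f : X -> R) M : measurable_fun setT f -> 0 <= M ->
  (forall x, `|f x| <= M) -> (forall x, ~ dom Omega x -> f x = 0) -> f \in Lfun nu 2%:E.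
Proof.
move=> mf M0 fM fO; apply/Lfun2P; split => //.
have mO := measurable_dom Omega.
apply: (@le_lt_trans _ _ (\int[nu]_x ((M ^+ 2)%:E * (\1_Omega x)%:E))%E).
  apply: ge0_le_integralT => x; first by rewrite lee_fin sqr_ge0.
  rewrite -EFinM lee_fin indicE; case: (boolP (x \in (Omega : set X))) => [_|xO].
    rewrite mulr1 -(real_normK (num_real (f x))).
    by rewrite lerXn2r ?nnegrE.
  by rewrite fO ?mulr0 ?expr0n// => Ox; move/negP: xO; apply; rewrite inE.
rewrite ge0_integralZl_EFin ?sqr_ge0//; last by apply/measurable_EFinP; exact: measurable_indic.
rewrite integral_indic// setIT lte_mul_pinfty ?lee_fin ?sqr_ge0//.
exact: lebesgue_rV_dom_lty.
Qed.

Lemma test_fun_Lfun2 (f : X -> R) : test_fun Omega f -> f \in Lfun nu 2%:E.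
Proof.
move=> tf; have [sf cK _] := tf; have [cf _] := sf [::].
have [M M0 fM] := continuous_dom_bounded cf cK.
apply: (bounded_dom_Lfun2 (M := M)) => // [|x|x]; last exact: test_fun_out.
  exact: continuous_measurable_rV.
have [/fM//|fx] := pselect (closure [set x | f x != 0] x).
have [->|/eqP f0] := eqVneq (f x) 0; first by rewrite normr0.
by case: fx; apply: subset_closure => /=; apply/eqP.
Qed.

Lemma partial_Lfun2 (f : X -> R) i : test_fun Omega f -> partial i f \in Lfun nu 2%:E.
Proof.
move=> tf; have [sf cK _] := tf; have [cf _] := sf [:: i].
have [M M0 fM] := continuous_dom_bounded cf cK.
apply: (bounded_dom_Lfun2 (M := M)) => // [|x|x]; last exact: partial_out.
  exact: continuous_measurable_rV.
have [/fM//|fx] := pselect (closure [set x | f x != 0] x).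
rewrite /partial (near_eq_derive (g := cst 0)) ?derive_cst ?normr0//.
have : nbhs x (~` closure [set x | f x != 0]).
  by apply: open_nbhs_nbhs; split => //; apply: closed_openC; exact: closed_closure.
apply: filterS => y yf; apply: contrapT => /eqP fy; apply: yf; exact: subset_closure.
Qed.

Lemma smooth_lin a (f g : X -> R) : smooth f -> smooth g -> smooth (fun x => a * f x + g x).
Proof.
move=> sf sg; have e s : foldr (@partial R d) (fun x => a * f x + g x) s =
    (fun x => a * foldr (@partial R d) f s x + foldr (@partial R d) g s x).
  elim: s => [//|i s /= ->]; apply/funext => x; rewrite /partial.
  have [_ /(_ i x) df] := sf s; have [_ /(_ i x) dg] := sg s.
  rewrite -[RHS]/(a *: 'D_(delta_mx ord0 i) (foldr (@partial R d) f s) x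
    + 'D_(delta_mx ord0 i) (foldr (@partial R d) g s) x).
  by rewrite -(deriveZ a df) -(deriveD (derivableZ (k := a) df) dg).
move=> s; have [cf df] := sf s; have [cg dg] := sg s; rewrite e; split=> [x|i x].
  apply: (@continuousD R R X (fun y => a * foldr (@partial R d) f s y) (foldr (@partial R d) g s)) => //.
    exact: (@continuousM R X (cst a) (foldr (@partial R d) f s) x (@cst_continuous X R a x) (cf x)).
  exact: cg.
exact: (derivableD (derivableZ (k := a) (df i x)) (dg i x)).
Qed.

(** The support of the combination is contained in the union of the two supports, so it is closed
    and lies in the bounded set Omega, hence compact. *)
Lemma test_fun_lin a (f g : X -> R) : test_fun Omega f -> test_fun Omega g ->
  test_fun Omega (fun x => a * f x + g x).
Proof.
move=> [sf _ fO] [sg _ gO].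
have sub : closure [set x | a * f x + g x != 0] `<=` Omega.
  apply: (@subset_trans _ (closure ([set x | f x != 0] `|` [set x | g x != 0]))).
    apply: closureS => x /=; apply: contra_neqP.
    by move=> /not_orP[/negP/negPn/eqP -> /negP/negPn/eqP ->]; rewrite mulr0 addr0.
  by rewrite closureU => x [/fO|/gO].
split => //; first exact: smooth_lin.
apply: bounded_closed_compact; last exact: closed_closure.
have [M [Mr MP]] := dom_bounded Omega.
by exists M; split => // N MN x /sub; exact: MP.
Qed.

Lemma test_fun0 : test_fun Omega (cst 0).
Proof.
have e s : foldr (@partial R d) (cst 0 : X -> R) s = cst 0.
  by elim: s => [//|i s /= ->]; apply/funext => x; rewrite /partial derive_cst.
have s0 : [set x : X | cst (0 : R) x != 0] = set0.
  by apply/seteqP; split => [x /eqP|x].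
split => [s| |].
- rewrite e; split=> [|i x]; first exact: cst_continuous.
  exact: derivable_cst.
- by rewrite s0 closure0; exact: compact0.
- by rewrite s0 closure0.
Qed.

End test_functions.

(** * Test functions have finite Gagliardo energy *)

Section test_functions_in_Hs.
Context (R : realType) (d : nat) (Omega : lipschitz_domain R d).
Local Notation X := 'rV[R]_d.
Local Notation nu := (lebesgue_rV R d).
Local Notation D := (dom_measure Omega).

Lemma test_fun_energy (f : X -> R) : test_fun Omega f -> exists2 A : R, 0 <= A &
  forall h, 0 < h -> (kernel_energy nu (@cube_kernel R d h) f <= (A * h ^+ d.+2)%:E)%E.
Proof.
move=> tf; pose E := (\sum_(i < d) sqint nu (partial i f))%E.
have E0 : (0 <= E)%E by apply: sume_ge0 => i _; exact: sqint_ge0.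
have Efin : (E < +oo)%E.
  by apply: lte_sum_pinfty => i _; have /Lfun2P[] := partial_Lfun2 i tf.
exists (4 ^+ d.+1 * fine E) => [|h h0]; first by rewrite mulr_ge0 ?exprn_ge0 ?fine_ge0.
apply: le_trans (gradient_energy_le (test_fun_line_gradient tf) h0) _.
rewrite -[X in (_ * X)%E]/E -(@fineK _ E) ?ge0_fin_numE// -EFinM lee_fin.
by rewrite le_eqVlt; apply/orP; left; apply/eqP; rewrite fineK ?ge0_fin_numE//; ring.
Qed.

Variables (s : R).
Hypotheses (s_gt0 : 0 < s) (s_lt1 : s < 1).

(** Pairs at distance above 1 are covered by a single cube energy. For the others, on the shell near
    2^-k the kernel is of order 2^(k(d+2s)) and the energy of order 2^(-k(d+2)), so the shells sum
    like powers of 2^(2s-2) < 1. *)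
Lemma test_fun_Hs (w : L2 D) : test_fun Omega w -> hcar (Hs Omega s) w.
Proof.
move=> tw; have [A A0 energy] := test_fun_energy tw; have mw : measurable_fun setT (w : X -> R) by [].
pose f : X -> R := w; pose al := d%:R + 2 * s.
have al0 : 0 <= al by rewrite addr_ge0// mulr_ge0// ltW.
pose H x y := `|f x - f y| ^+ 2 / enorm (x - y) `^ al.
have H0 x y : 0 <= H x y by rewrite divr_ge0 ?sqr_ge0 ?powR_ge0.
have mH : measurable_fun setT (fun z : X * X => H z.1 z.2) := measurable_gagliardo s mw.
(* Coordinates of points of Omega differ by at most 2B, so one cube of half-width 2B + 1 contains
   every far pair. *)
have [B B0 OB] := dom_bounded_coord Omega; pose h0 := 2 * B + 1.
have h00 : 0 < h0 by rewrite ltr_wpDl// mulr_ge0// ltW.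
pose G (z : X * X) := (f z.1 - f z.2) ^+ 2.
have G0 z : 0 <= G z by exact: sqr_ge0.
have mG : measurable_fun setT G.
  apply: measurable_funX; apply: measurable_funB.
    exact: (measurableT_comp mw measurable_fst).
  exact: (measurableT_comp mw measurable_snd).
pose near : set (X * X) := [set z | enorm (z.1 - z.2) <= 1].
have mn : measurable near.
  rewrite (_ : near = (fun z : X * X => enorm (z.1 - z.2)) @^-1` `]-oo, 1]%classic).
    rewrite -[X in measurable X]setTI; apply: measurable_enorm_sub => //; exact: measurable_itv.
  by apply/seteqP; split => z /=; rewrite in_itv.
pose F z := \1_near z * H z.1 z.2; pose C z := cube_kernel h0 z.1 z.2 * G z.
have F0 z : 0 <= F z by rewrite mulr_ge0// indicE ler0n.
have C0 z : 0 <= C z by rewrite mulr_ge0// cube_kernel_ge0.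
have mF : measurable_fun setT F by apply: measurable_funM => //; exact: measurable_indic.
have mC : measurable_fun setT C by apply: measurable_funM => //; exact: measurable_cube_kernel.
rewrite /= /gagliardo_finite -/al.
apply: le_lt_trans (@dom_dom_le _ _ Omega H (fun x y => F (x, y) + C (x, y)) _ _ _ _) _ => //.
- by move=> x y; rewrite addr_ge0.
- move=> x y Ox Oy; have [e1|e1] := leP (enorm (x - y)) 1.
    by rewrite /F indicE mem_set//= mul1r lerDl.
  rewrite ler_wpDl// /C /cube_kernel indicE mem_set ?mul1r.
    rewrite /H /G real_normK ?num_real// ler_piMr ?sqr_ge0//.
    rewrite invf_le1 ?powR_gt0 ?(lt_trans ltr01)//.
    by rewrite -(powRr0 (enorm (x - y))) ler_powR// ltW.
  move=> i; apply: (@le_lt_trans _ _ (2 * B)); last by rewrite ltrDl.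
  by rewrite (le_trans (ler_normB _ _))// mulrDl !mul1r lerD// OB.
rewrite -(fubini_tonelli1 (m1 := nu) (m2 := nu) (fun z => (F z + C z)%:E)); last 2 first.
- by apply/measurable_EFinP; exact: measurable_funD.
- by move=> z; rewrite lee_fin addr_ge0.
under eq_integral do rewrite EFinD.
rewrite ge0_integralD//; last 4 first.
- by move=> z _; rewrite lee_fin.
- exact/measurable_EFinP.
- by move=> z _; rewrite lee_fin.
- exact/measurable_EFinP.
apply: lte_add_pinfty; last first.
  rewrite (fubini_tonelli1 (m1 := nu) (m2 := nu) (fun z => (C z)%:E)); last 2 first.
  - exact/measurable_EFinP.
  - by move=> z; rewrite lee_fin.
  exact: le_lt_trans (energy h0 h00) (ltry _).
pose q : R := 2 `^ (2 * s - 2).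
have q0 : 0 <= q := powR_ge0 _ _.
have q1 : q < 1.
  have s2 : 0 < 2 - 2 * s by rewrite subr_gt0 gtr_pMr.
  rewrite /q (_ : 2 * s - 2 = - (2 - 2 * s)); last by ring.
  rewrite powRN invf_lt1 ?powR_gt0//.
  have : (1 : R) `^ (2 - 2 * s) < 2 `^ (2 - 2 * s) by rewrite gt0_ltr_powR ?nnegrE// ltr1n.
  by rewrite powR1.
pose c : R := 2 `^ al * A * 2 ^+ d.+2.
have c0 : 0 <= c := mulr_ge0 (mulr_ge0 (powR_ge0 _ _) A0) (ltW (exprn_gt0 _ (ltr0n _ 2))).
apply: le_lt_trans (geometric_nneseries_lty c0 q0 q1).
have p2 n : 0 < (2 : R) ^+ n by rewrite exprn_gt0.
(* The half-width 2 2^-k is twice the shell radius, because the cubes are open. *)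
apply: (@dyadic_integral_lty _ _ _ (nu \x nu)%E (fun z => enorm (z.1 - z.2)) F G c q
  (fun k => (2 ^+ k.+1) `^ al) (fun k => A * (2 * (2 ^+ k)^-1) ^+ d.+2)) => //.
- exact: measurable_enorm_sub.
- move=> z Fz; apply/andP; split.
    rewrite lt_neqAle eq_sym enorm_ge0 andbT; apply: contra_neq Fz => e0.
    by rewrite /F /H (enorm_eq0 e0) subrr normr0 expr0n /= mul0r mulr0.
  rewrite leNgt; apply/negP => z1; move/eqP: Fz; apply.
  by rewrite /F indicE memNset ?mul0r// /near /= leNgt z1.
- move=> k z /andP[kz zk]; have z0 : 0 < enorm (z.1 - z.2).
    by apply: lt_trans kz; rewrite invr_gt0.
  apply: (@le_trans _ _ (H z.1 z.2)).
    by rewrite /F indicE ler_piMl//; case: (_ \in _).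
  rewrite /H real_normK ?num_real// -/(G z) mulrC ler_wpM2r//.
  rewrite -[leLHS]mul1r ler_pdivrMr ?powR_gt0// -powRM ?(ltW z0) ?(ltW (p2 _))//.
  have pe : 1 <= 2 ^+ k.+1 * enorm (z.1 - z.2).
    by rewrite -ler_pdivrMl ?p2// mulr1 ltW.
  have n1 : (1 : R) \is Num.nneg by rewrite nnegrE.
  have n2 : 2 ^+ k.+1 * enorm (z.1 - z.2) \is Num.nneg by rewrite nnegrE (le_trans _ pe).
  by have := ge0_ler_powR al0 n1 n2 pe; rewrite powR1.
- move=> k; have h1 : 0 < 2 * (2 ^+ k)^-1 :> R by rewrite mulr_gt0// invr_gt0.
  apply: le_trans (energy _ h1).
  rewrite /kernel_energy -(fubini_tonelli1 (m1 := nu) (m2 := nu)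
    (fun z => (cube_kernel (2 * (2 ^+ k)^-1) z.1 z.2 * G z)%:E)); last 2 first.
  - by apply/measurable_EFinP; apply: measurable_funM => //; exact: measurable_cube_kernel.
  - by move=> z; rewrite lee_fin mulr_ge0// cube_kernel_ge0.
  apply: ge0_le_integralT => z; rewrite lee_fin; first by rewrite mulr_ge0// indicE ler0n.
  rewrite ler_wpM2r// indicE; case: (boolP (_ \in _)) => [/set_mem /= /andP[_ zk]|_]; last exact: cube_kernel_ge0.
  rewrite /cube_kernel indicE mem_set// => i; have := ler_coord_enorm (z.1 - z.2) i.
  rewrite !mxE => zi; apply: le_lt_trans zi _; apply: le_lt_trans zk _.
  by rewrite ltr_pMl ?invr_gt0// ltr1n.
- move=> k; rewrite le_eqVlt; apply/orP; left; apply/eqP.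
  have P0 : 0 < (2 : R) ^+ k := p2 k.
  rewrite exprS powRM ?(ltW P0)// exprMn /c.
  have -> : q ^+ k = (2 ^+ k) `^ al * (2 ^+ k)^-1 ^+ d.+2.
    have -> : q ^+ k = (2 ^+ k) `^ (2 * s - 2).
      by rewrite -powR_mulrn ?powR_ge0// /q powRAC powR_mulrn.
    have -> : 2 * s - 2 = al + - d.+2%:R by rewrite /al -!natr1; ring.
    by rewrite powRD ?(gt_eqF P0) ?implybT// powRN powR_mulrn ?(ltW P0)// exprVn.
  by ring.
Qed.


End test_functions_in_Hs.

(** * Closures of subspaces and the space of zero boundary values *)

Section closure_subspace.
Context (R : realType) (V : lmodType R) (H : hspace V) (P : set V).
Hypothesis pH : prehilbert H.
Hypotheses (P0 : P 0) (P_lin : forall a x y, P x -> P y -> P (a *: x + y))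
  (P_sub : P `<=` hcar H).

Definition closure_hspace : hspace V :=
  @HSpace R V [set w | hcar H w /\ forall e : R, 0 < e ->
    exists2 rho, P rho & hnorm H (w - rho) < e] (hip H).

Lemma closure_prehilbert : prehilbert closure_hspace.
Proof.
split.
- split; first exact: ph0 pH.
  by move=> e e0; exists 0 => //; rewrite subr0 /hnorm (ph0l pH (ph0 pH)) sqrtr0.
- move=> a x y [cx xP] [cy yP]; split; first exact: (ph_lin pH).
  move=> e e0; have a1 : 0 < `|a| + 1 by rewrite ltr_wpDl.
  have [r1 t1 n1] := xP (e / 2 / (`|a| + 1)) ltac:(by rewrite !divr_gt0).
  have [r2 t2 n2] := yP (e / 2) ltac:(by rewrite divr_gt0).
  exists (a *: r1 + r2); first exact: P_lin.
  have -> : a *: x + y - (a *: r1 + r2) = a *: (x - r1) + (y - r2).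
    by rewrite scalerBr opprD addrACA.
  have c1 : hcar H (x - r1) := phB pH cx (P_sub t1).
  have c2 : hcar H (y - r2) := phB pH cy (P_sub t2).
  apply: le_lt_trans (ph_normD pH (phZ pH a c1) c2) _.
  rewrite (ph_normZ pH) // (splitr e) ler_ltD//.
  apply: le_trans (_ : (`|a| + 1) * hnorm H (x - r1) <= _).
    by rewrite ler_wpM2r ?ph_norm_ge0// lerDl.
  by rewrite -ler_pdivlMl// mulrC ltW.
- by move=> x y [cx _] [cy _]; exact: (phC pH).
- by move=> a x y z [cx _] [cy _] [cz _]; exact: (ph_linl pH).
- by move=> x [cx _]; exact: (ph_ge0 pH).
Qed.

Lemma closure_closed (w_ : nat -> V) w : (forall n, hcar closure_hspace (w_ n)) -> hcar H w ->
  hnorm H (w_ n - w) @[n --> \oo] --> (0 : R) -> hcar closure_hspace w.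
Proof.
move=> cw cW wW; split => // e e0; have e2 : 0 < e / 2 by rewrite divr_gt0.
move/cvgr0Pnorm_lt : wW => /(_ _ e2)[N _ /(_ N (leqnn _))].
rewrite /= ger0_norm ?ph_norm_ge0// => wN; have [cN /(_ _ e2)[r tr rN]] := cw N.
exists r => //; have -> : w - r = (w - w_ N) + (w_ N - r) by rewrite addrA subrK.
apply: le_lt_trans (ph_normD pH (phB pH cW cN) (phB pH cN (P_sub tr))) _.
by rewrite (splitr e) ltrD// (ph_norm_distC pH).
Qed.

(** A functional bounded on the whole space restricts to one bounded on the closure. *)
Lemma closure_weak_cvg (w_ : nat -> V) w : weak_cvg closure_hspace w_ w -> weak_cvg H w_ w.
Proof.
move=> ww l [lin [K lK]]; apply: ww; split=> [a x y [cx _] [cy _]|]; first exact: lin.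
by exists K => x [cx _]; exact: lK.
Qed.

End closure_subspace.

Section Hs0_space.
Context (R : realType) (d : nat) (Omega : lipschitz_domain R d).
Local Notation D := (dom_measure Omega).
Variables (s : R).
Hypotheses (s_gt0 : 0 < s) (s_lt1 : s < 1).
Local Notation H := (Hs Omega s).
Let P : set (L2 D) := [set w : L2 D | test_fun Omega w].

Let P_lin a (x y : L2 D) : P x -> P y -> P (a *: x + y).
Proof. exact: test_fun_lin. Qed.

Let P_sub : P `<=` hcar H.
Proof. by move=> w; exact: test_fun_Hs. Qed.

Lemma good_Hs0 : good_space (Hs0 Omega s).
Proof.
have [pH [c c0 emb] compl compa] := good_Hs Omega s_gt0 s_lt1.
have P0 : P 0 := test_fun0 Omega.
split.
- exact: (closure_prehilbert pH P0 P_lin P_sub).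
- by exists c => // w [cw _]; exact: emb.
- move=> w_ w cw cauchy ww.
  have [cW wW] := compl w_ w (fun n => (cw n).1) cauchy ww.
  split; last exact: wW.
  exact: (closure_closed pH P_sub cw cW wW).
- move=> w_ w M cw_ cw wM ww; apply: compa (fun n => (cw_ n).1) cw.1 wM _.
  exact: (@closure_weak_cvg _ _ H P w_ w ww).
Qed.

End Hs0_space.

(** * Energy, positivity and growth of Dirichlet eigenvalues *)

Section eigenfunctions.
Context (R : realType) (d : nat) (Omega : lipschitz_domain R d).
Local Notation X := 'rV[R]_d.
Local Notation nu := (lebesgue_rV R d).
Local Notation D := (dom_measure Omega).
Local Notation energy h f := (kernel_energy nu (@cube_kernel R d h) f).

Lemma sqint_partial (f : X -> R) i : test_fun Omega f ->
  sqint nu (partial i f) = sqint D (partial i f).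
Proof.
move=> tf; have mp := Lfun2_measurable (partial_Lfun2 i tf).
rewrite -sqint_zero_ext//; congr sqint; apply/funext => x.
have [Ox|Ox] := pselect (dom Omega x); first by rewrite zero_extE.
by rewrite zero_ext_out// (partial_out i tf Ox).
Qed.

Lemma kernel_energy_cvg (f_ : nat -> X -> R) (f : X -> R) h (c_ : nat -> R) c :
  (forall n, measurable_fun setT (f_ n)) -> measurable_fun setT f ->
  {ae nu, forall x, f_ n x @[n --> \oo] --> f x} ->
  (forall n, (energy h (f_ n) <= (c_ n)%:E)%E) -> c_ n @[n --> \oo] --> c ->
  (energy h f <= c%:E)%E.
Proof.
move=> mf_ mf ff fc cc.
pose F (g : X -> R) (z : X * X) := cube_kernel h z.1 z.2 * (g z.1 - g z.2) ^+ 2.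
have F0 g z : 0 <= F g z := mulr_ge0 (cube_kernel_ge0 _ _ _) (sqr_ge0 _).
have mF g : measurable_fun setT g -> measurable_fun setT (F g).
  move=> mg; apply: measurable_funM; first exact: measurable_cube_kernel.
  apply: measurable_funX; apply: measurable_funB.
    exact: (measurableT_comp mg measurable_fst).
  exact: (measurableT_comp mg measurable_snd).
have eF g : measurable_fun setT g -> (energy h g = \int[nu \x nu]_z (F g z)%:E)%E.
  move=> mg; rewrite (fubini_tonelli1 (m1 := nu) (m2 := nu) (fun z => (F g z)%:E))//.
    by apply/measurable_EFinP; exact: mF.
  by move=> z; rewrite lee_fin.
rewrite eF//; apply: (fatou_cvg (F := fun n => F (f_ n)) (c_ := c_)) => //.
- by move=> n; exact: mF.
- exact: mF.
- apply: filterS (filterI (ae_prod_fst ff) (ae_prod_snd ff)) => z [f1 f2].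
  by apply: cvgMl_tmp; rewrite expr2; under eq_fun do rewrite expr2; apply: cvgM; exact: cvgB.
- by move=> n; rewrite -eF.
Qed.

(** Approximate by test functions, for which the gradient bound holds, and pass to the limit with
    Fatou's lemma. *)
Lemma H10_energy_le (w : L2 D) (g : 'I_d -> L2 D) h : H10_gradient w g -> 0 < h ->
  (energy h (zero_ext Omega w) <=
   (4 ^+ d.+1 * h ^+ d.+2 * \sum_(i < d) L2norm D (g i) ^+ 2)%:E)%E.
Proof.
move=> wg h0; pose e k : R := k.+1%:R^-1.
have e0 k : 0 < e k by rewrite invr_gt0.
have e1 k : e k <= 1 by rewrite invf_le1// ler1n.
have ecvg : e k @[k --> \oo] --> (0 : R).
  apply/cvgr0Pnorm_le => x x0; have [N _ NP] := near_infty_natSinv_lt (PosNum x0).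
  by exists N => // n /= Nn; rewrite ger0_norm ?(ltW (e0 _))// ltW// NP.
have /choice[rho rhoP] : forall k, exists rho : X -> R, test_fun Omega rho /\
    L2norm D (rho \- w) < e k /\ forall i, L2norm D (partial i rho \- g i) < e k.
  by move=> k; have [r tr rP] := wg _ (e0 k); exists r.
have trho k : test_fun Omega (rho k) by case: (rhoP k).
have rL k := @restrict_Lfun2 R d Omega _ (test_fun_Lfun2 (trho k)).
pose r k : L2 D := Lfun_Sub (lee1n 2) (rL k).
have rw : L2norm D (r k - w) @[k --> \oo] --> (0 : R).
  apply: (cvg0_le (g := e)) => // k; rewrite ger0_norm ?L2norm_ge0//.
  by apply: ltW; case: (rhoP k) => _ [].
have [sg hsg sgP] := L2_cvg_ae_subseq rw.
pose G i := L2norm D (g i); have G0 i : 0 <= G i by exact: L2norm_ge0.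
pose C : R := 4 ^+ d.+1 * h ^+ d.+2.
have C0 : 0 <= C by rewrite mulr_ge0 ?exprn_ge0// ltW.
(* As e k <= 1, the square of G i + e k is at most G i^2 + e k (2 G i + 1); summed over i this is S
   + e k T. *)
pose S : R := \sum_(i < d) G i ^+ 2; pose T : R := \sum_(i < d) (2 * G i + 1).
apply: (@kernel_energy_cvg (fun k => rho (sg k)) _ h (fun k => C * (S + e (sg k) * T))).
- by move=> k; exact: Lfun2_measurable (test_fun_Lfun2 (trho _)).
- by apply: measurable_zero_ext.
- apply: filterS (zero_ext_ae sgP) => x zx.
  rewrite (_ : (fun k => _) = (fun k => zero_ext Omega (r (sg k)) x)); first exact: zx.
  apply/funext => k; have [Ox|Ox] := pselect (dom Omega x); first by rewrite zero_extE.
  by rewrite zero_ext_out// (test_fun_out (trho _) Ox).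
- move=> k; apply: le_trans (gradient_energy_le (test_fun_line_gradient (trho (sg k))) h0) _.
  rewrite -/C [leRHS]EFinM; apply: lee_wpmul2l; first by rewrite lee_fin.
  rewrite mulr_sumr -big_split /= -sumEFin; apply: lee_sum => i _.
  have pL := @restrict_Lfun2 R d Omega _ (partial_Lfun2 i (trho (sg k))).
  pose p : L2 D := Lfun_Sub (lee1n 2) pL.
  rewrite -[X in (X <= _)%E]/(sqint nu (partial i (rho (sg k)))) sqint_partial//.
  rewrite -[X in (X <= _)%E]/(sqint D p) -L2norm_sqint lee_fin.
  have pg : L2norm D p <= G i + e (sg k).
    have -> : p = g i + (p - g i) by rewrite addrC subrK.
    apply: le_trans (L2normD _ _) _; rewrite lerD2l ltW//.
    by case: (rhoP (sg k)) => _ [_ /(_ i)].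
  apply: (@le_trans _ _ ((G i + e (sg k)) ^+ 2)).
    by rewrite lerXn2r ?nnegrE ?L2norm_ge0// addr_ge0// ltW.
  rewrite sqrrD -addrA lerD2l mulrDr mulr1 (_ : e (sg k) * (2 * G i) = G i * e (sg k) *+ 2); last first.
    by rewrite -mulr_natl; ring.
  by rewrite lerD2l expr2 ler_piMr// ltW.
have -> : C * \sum_(i < d) L2norm D (g i) ^+ 2 = C * (S + 0 * T) by rewrite mul0r addr0.
apply: cvgMl_tmp; apply: cvgD; first exact: cvg_cst.
by apply: cvgMr_tmp; exact: cvg_subseq hsg ecvg.
Qed.

Section eigensystem.
Variables (phi : nat -> L2 D) (lam : nat -> R).
Hypothesis eig : dirichlet_eigensystem phi lam.

Lemma eigen_norm n : L2norm D (phi n) ^+ 2 = 1.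
Proof. by have [_ o _] := eig; rewrite L2norm_sqr o eqxx. Qed.

(** The eigenvalue equation tested with the eigenfunction itself identifies the Dirichlet energy
    with lam n. *)
Lemma eigen_energy_le n h : 0 < h ->
  (energy h (zero_ext Omega (phi n)) <= (4 ^+ d.+1 * h ^+ d.+2 * lam n)%:E)%E.
Proof.
move=> h0; have [ep o _] := eig; have [g Hg gP] := ep n.
apply: le_trans (H10_energy_le Hg h0) _.
have -> // : \sum_(i < d) L2norm D (g i) ^+ 2 = lam n.
rewrite (eq_bigr (fun i => L2ip D (g i) (g i))) => [|i _]; last by rewrite L2norm_sqr.
by rewrite (gP _ _ Hg) o eqxx mulr1.
Qed.

Lemma bessel (w : L2 D) n :
  L2norm D (w - \sum_(i < n) L2ip D w (phi i) *: phi i) ^+ 2 =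
  L2norm D w ^+ 2 - \sum_(i < n) L2ip D w (phi i) ^+ 2.
Proof.
have [_ o _] := eig; pose S k : L2 D := \sum_(i < k) L2ip D w (phi i) *: phi i.
have So k m : (k <= m)%N -> L2ip D (S k) (phi m) = 0.
  elim: k => [|k IH] km.
    rewrite /S big_ord0; have := L2ipBl (phi m) (phi m) (phi m).
    by rewrite !subrr.
  rewrite /S big_ord_recr -/(S k) L2ipDl L2ipZl IH 1?ltnW// o.
  by rewrite (ltn_eqF km) mulr0 addr0.
rewrite -/(S n); elim: n => [|n IH]; first by rewrite /S !big_ord0 !subr0.
have e : w - S n.+1 = (w - S n) - L2ip D w (phi n) *: phi n.
  by rewrite /S big_ord_recr opprD addrA.
pose c := L2ip D w (phi n).
have e2 : L2ip D (w - S n) (c *: phi n) = c * c by rewrite L2ipZr L2ipBl So// subr0.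
have e3 : L2ip D (c *: phi n) (c *: phi n) = c * c.
  by rewrite L2ipZl L2ipZr -L2norm_sqr eigen_norm mulr1.
rewrite e L2norm_sqr L2_sqrB e2 e3 -L2norm_sqr IH big_ord_recr -/c.
set t := \sum_(i < n) _; rewrite -[X in _ = _ - X]/(t + c ^+ 2); ring.
Qed.

Lemma parseval (w : L2 D) :
  \sum_(i < n) L2ip D w (phi i) ^+ 2 @[n --> \oo] --> L2norm D w ^+ 2.
Proof.
have [_ _ c] := eig.
have h : L2norm D w ^+ 2 - L2norm D (w - \sum_(i < n) L2ip D w (phi i) *: phi i) ^+ 2
    @[n --> \oo] --> L2norm D w ^+ 2 - 0 ^+ 2.
  by apply: cvgB; [exact: cvg_cst|rewrite expr2; under eq_fun do rewrite expr2; apply: cvgM; exact: c].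
rewrite -[X in _ --> X]subr0 -[X in _ - X](expr0n R 2).
rewrite (_ : (fun n => _) = (fun n => L2norm D w ^+ 2 -
  L2norm D (w - \sum_(i < n) L2ip D w (phi i) *: phi i) ^+ 2)); first exact: h.
by apply/funext => n; rewrite bessel subKr.
Qed.

Lemma coef_cvg0 (w : L2 D) : L2ip D w (phi n) @[n --> \oo] --> (0 : R).
Proof.
apply: sqr_cvg0; apply: (cvg_series_cvg_0 (u_ := fun n => L2ip D w (phi n) ^+ 2)).
apply/cvg_ex; exists (L2norm D w ^+ 2).
rewrite (_ : series _ = (fun n => \sum_(i < n) L2ip D w (phi i) ^+ 2)); first exact: parseval.
by apply/funext => n; rewrite /series /= big_mkord.
Qed.

(** A Poincare inequality: a large cube around any point of Omega has volume at least V outside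
    Omega, where the extension vanishes, so the nonlocal energy is at least V times the squared
    norm. *)
Lemma eigenvalue_gt0 : (0 < d)%N -> exists2 c0 : R, 0 < c0 & forall n, c0 <= lam n.
Proof.
move=> d0; have [B B0 OB] := dom_bounded_coord Omega; pose b := B + 1.
have b0 : 0 < b by rewrite ltr_wpDl// ltW.
pose h := 2 * b; have h0 : 0 < h by rewrite mulr_gt0.
have mO := measurable_dom Omega.
have Ocube : dom Omega `<=` cube (0 : X) b.
  move=> x Ox i; rewrite mxE sub0r normrN; apply: le_lt_trans (OB _ Ox i) _.
  by rewrite ltrDl.
(* Omega fits in a cube of half-width b and h = 2b; the difference of volumes is positive because d
   > 0. *)
pose V : R := (2 * h) ^+ d - (2 * b) ^+ d.
have V0 : 0 < V.
  rewrite subr_gt0 ltr_pXn2r ?nnegrE ?mulr_ge0 ?(ltW h0) ?(ltW b0)//.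
  by rewrite ltr_pM2l// ltr_pMl// ltr1n.
have nuO : (nu Omega <= ((2 * b) ^+ d)%:E)%E.
  rewrite -(lebesgue_cube (0 : X) (ltW b0)); apply: le_measure => //; rewrite inE//.
  exact: measurable_cube.
have nuC x : (V%:E <= nu (cube x h `\` Omega))%E.
  have mC := measurable_cube x h.
  have ne : (nu (cube x h) <= nu (cube x h `\` Omega) + nu Omega)%E.
    rewrite -[X in (nu X <= _)%E](setDUK (_ : cube x h `&` Omega `<=` cube x h)); last exact: subIsetl.
    rewrite setDIr setDv set0U; apply: le_trans (measureU2 _ _ _) _ => //; first exact: measurableI.
      exact: measurableD.
    by rewrite addeC leeD2l// le_measure ?inE//; exact: measurableI.
  have e := lebesgue_cube x (ltW h0).
  have -> : V%:E = (((2 * h) ^+ d)%:E - ((2 * b) ^+ d)%:E)%E by [].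
  rewrite leeBlDr// -e; apply: le_trans ne _; exact: leeD2l.
pose C : R := 4 ^+ d.+1 * h ^+ d.+2.
have C0 : 0 < C by rewrite mulr_gt0 ?exprn_gt0.
exists (V / C) => [|n]; first by rewrite divr_gt0.
pose z := zero_ext Omega (phi n).
rewrite ler_pdivrMr// mulrC -lee_fin; apply: le_trans (eigen_energy_le n h0).
have -> : V%:E = (V%:E * sqint nu z)%E.
  by rewrite sqint_zero_ext// -L2norm_sqint eigen_norm mule1.
have mz : measurable_fun setT z by exact: measurable_zero_ext.
rewrite /sqint -ge0_integralZl_EFin ?(ltW V0)//; last 2 first.
- by move=> x _; rewrite lee_fin sqr_ge0.
- exact: measurable_EFin_sqr.
apply: ge0_le_integralT => x; first by rewrite mule_ge0 ?lee_fin ?sqr_ge0 ?(ltW V0).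
have [Ox|Ox] := pselect (dom Omega x); last first.
  rewrite /z zero_ext_out// expr0n mule0; apply: integral_ge0 => y _.
  by rewrite lee_fin mulr_ge0 ?sqr_ge0 ?cube_kernel_ge0.
have mCO : measurable (cube x h `\` Omega) by apply: measurableD => //; exact: measurable_cube.
apply: (@le_trans _ _ (\int[nu]_y ((z x ^+ 2)%:E * (\1_(cube x h `\` Omega) y)%:E))%E).
  rewrite ge0_integralZl_EFin ?sqr_ge0//; last by apply/measurable_EFinP; exact: measurable_indic.
  rewrite integral_indic// setIT muleC; apply: lee_wpmul2l; last exact: nuC.
  by rewrite lee_fin sqr_ge0.
apply: ge0_le_integralT => y; first by rewrite mule_ge0 ?lee_fin ?sqr_ge0 ?indicE ?ler0n.
rewrite -EFinM lee_fin indicE; case: (boolP (_ \in _)) => [/set_mem[xy Oy]|_]; last first.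
  by rewrite mulr0 mulr_ge0 ?sqr_ge0 ?cube_kernel_ge0.
by rewrite /cube_kernel indicE mem_set// mulr1 mul1r /z (zero_ext_out _ Oy) subr0.
Qed.

(** Otherwise infinitely many eigenfunctions have bounded energy. Being orthonormal, they tend
    weakly to zero by Parseval, and [local_cvg] on all of Omega would make their norms small,
    although they equal 1. The extensions by zero have their energy bounded on the whole space, so
    inner sets can be avoided. *)
Lemma eigenvalue_unbounded (M : R) : exists N, forall n, (N <= n)%N -> M < lam n.
Proof.
apply: contrapT => /forallNP nN.
have hN N : exists n, (N <= n)%N /\ lam n <= M.
  have /existsNP[n /not_implyP[Nn /negP]] := nN N.
  by rewrite -leNgt => h; exists n.
have /choice[t tP] := hN; pose sg := fix sg k := if k is k'.+1 then t (sg k').+1 else t 0%N.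
have hsg : {homo sg : m n / (m < n)%N}.
  apply: homo_ltn => [|k]; first exact: ltn_trans.
  by case: (tP (sg k).+1).
have sgM k : lam (sg k) <= M by case: k => [|k]; [case: (tP 0%N)|case: (tP (sg k).+1)].
pose g k := zero_ext Omega (phi (sg k)).
have gL k : g k \in Lfun nu 2%:E := zero_ext_Lfun2 _.
have g1 k : sqint nu (g k) = 1%E.
  by rewrite sqint_zero_ext// -L2norm_sqint eigen_norm.
have gM k : (sqint nu (g k) <= 1%:E)%E by rewrite g1.
have g_weak (f : X -> R) : f \in Lfun nu 2%:E -> L2ip nu f (g k) @[k --> \oo] --> (0 : R).
  move=> fL; pose fD : L2 D := Lfun_Sub (lee1n 2) (@restrict_Lfun2 R d Omega _ fL).
  rewrite (_ : (fun k => _) = (fun k => L2ip D fD (phi (sg k)))).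
    exact: cvg_subseq hsg (coef_cvg0 fD).
  by apply/funext => k; rewrite /g L2ip_zero_ext//; exact: Lfun2_measurable fL.
pose C : R := 4 ^+ d.+1 * `|M|; have C0 : 0 <= C by rewrite mulr_ge0 ?exprn_ge0.
have osc dl : 0 < dl -> exists2 h, 0 < h & forall k,
    (oscillation Omega h (g k) <= (dl * (2 * h) ^+ d)%:E)%E.
  move=> dl0; pose h := Num.min 1 (dl / (C + 1)).
  have C1 : 0 < C + 1 by rewrite ltr_wpDl.
  have h0 : 0 < h by rewrite lt_min ltr01 divr_gt0.
  have h1 : h <= 1 by rewrite ge_min lexx.
  have hC : C * h <= dl.
    apply: (@le_trans _ _ ((C + 1) * h)); first by rewrite ler_wpM2r ?(ltW h0)// lerDl.
    by rewrite -ler_pdivlMl// mulrC ge_min lexx orbT.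
  exists h => // k; apply: le_trans (_ : energy h (g k) <= _)%E.
    apply: ge0_le_integralT => x.
      by rewrite mule_ge0 ?lee_fin ?indicE ?ler0n//; apply: integral_ge0 => y _;
        rewrite lee_fin mulr_ge0 ?sqr_ge0 ?ler0n.
    have i0 : (0 <= \int[nu]_y (\1_(cube x h) y * (g k x - g k y) ^+ 2)%:E)%E.
      by apply: integral_ge0 => y _; rewrite lee_fin mulr_ge0 ?sqr_ge0 ?indicE ?ler0n.
    by rewrite indicE; case: (_ \in _); rewrite ?mul1e ?mul0e.
  apply: le_trans (eigen_energy_le (sg k) h0) _; rewrite lee_fin.
  have hd : 0 <= h ^+ d by rewrite exprn_ge0// ltW.
  apply: (@le_trans _ _ (C * h * h ^+ d)).
    rewrite !exprS; apply: (@le_trans _ _ (4 * 4 ^+ d * (h * (h * h ^+ d)) * `|M|)).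
      rewrite ler_wpM2l//; last by rewrite (le_trans (sgM k))// ler_norm.
      by rewrite !mulr_ge0// ?exprn_ge0// ltW.
    have -> : 4 * 4 ^+ d * (h * (h * h ^+ d)) * `|M| = (C * h * h ^+ d) * h.
      by rewrite /C exprS; ring.
    by rewrite ler_piMr// !mulr_ge0// ltW.
  apply: (@le_trans _ _ (dl * h ^+ d)); first by rewrite ler_wpM2r.
  rewrite exprMn mulrCA ler_peMl ?mulr_ge0 ?(ltW dl0)//.
  by rewrite exprn_ege1// ler1n.
have Oo : (nu Omega < +oo)%E := lebesgue_rV_dom_lty Omega.
have [N NP] := local_cvg (measurable_dom Omega) Oo gL gM g_weak osc (divr_gt0 ltr01 (ltr0n R 2)).
have := NP N (leqnn N); rewrite (_ : (fun x => _) = g N).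
  by rewrite g1 lee_fin leNgt ltr_pdivrMr// mul1r ltr1n.
apply/funext => x; rewrite indicE; case: (boolP (x \in _)) => [_|xO]; first by rewrite mulr1.
rewrite mulr0 /g zero_ext_out// => Ox; by rewrite mem_set in xO.
Qed.

End eigensystem.
End eigenfunctions.

(** * The spectral fractional space *)

Section spectral_space.
Context (R : realType) (d : nat) (Omega : lipschitz_domain R d).
Local Notation D := (dom_measure Omega).
Variables (phi : nat -> L2 D) (lam : nat -> R) (s : R).
Hypotheses (d_gt0 : (0 < d)%N) (s_gt0 : 0 < s) (eig : dirichlet_eigensystem phi lam).
Local Notation H := (Hs_spectral phi lam s).
Local Notation kappa := (@counting nat R).
Let coef (w : L2 D) n := L2ip D w (phi n).
(** Weighted coefficients: the spectral norm becomes an L2 norm for the counting measure, and the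
    energy-space lemmas apply with a0 = 0 and c = 1. *)
Let B (w : L2 D) n : R := Num.sqrt (lam n `^ s) * coef w n.

Let B_sqr w n : B w n ^+ 2 = lam n `^ s * coef w n ^+ 2.
Proof. by rewrite exprMn sqr_sqrtr ?powR_ge0. Qed.

Let sqint_B w : sqint kappa (B w) = (\sum_(0 <= n <oo) (B w n ^+ 2)%:E)%E.
Proof. by rewrite /sqint ge0_integral_count// => n; rewrite lee_fin sqr_ge0. Qed.

Let H_car w : hcar H w <-> (sqint kappa (B w) < +oo)%E.
Proof.
rewrite sqint_B (eq_eseriesr (g := fun n => (lam n `^ s * coef w n ^+ 2)%:E))//.
by move=> n _; rewrite B_sqr.
Qed.

Let B_lin a x y n : B (a *: x + y) n = a * B x n + B y n.
Proof. by rewrite /B /coef L2ipDl L2ipZl; ring. Qed.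

Let B_meas w : measurable_fun setT (B w).
Proof. by []. Qed.

(** The inner product is a limit of partial sums; it agrees with the integral for the counting
    measure because the product of two square-summable sequences is absolutely summable. *)
Let H_ip x y : hcar H x -> hcar H y ->
  hip H x y = 0 * L2ip D x y + 1 * L2ip kappa (B x) (B y).
Proof.
move=> /H_car fx /H_car fy; rewrite mul0r add0r mul1r.
have BL w : (sqint kappa (B w) < +oo)%E -> B w \in Lfun kappa 2%:E.
  by move=> fw; apply/Lfun2P.
pose a n := B x n * B y n; have ia := Lfun2M_integrable (BL x fx) (BL y fy).
have afin : (\sum_(0 <= n <oo) (`|a n|)%:E < +oo)%E.
  move: ia => /integrableP[_]; rewrite ge0_integral_count//.
have sa : summable setT (fun n => (a n)%:E).
  by rewrite /summable -nneseries_esumT.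
have ca : cvgn (series a).
  apply: normed_cvg; apply: nondecreasing_is_cvgn.
    by apply: nondecreasing_series => n _ _; exact: normr_ge0.
  exists (fine (\sum_(0 <= n <oo) (`|a n|)%:E)%E) => _ [n _ <-].
  rewrite -lee_fin fineK ?ge0_fin_numE//; last by apply: nneseries_ge0.
  rewrite /series /= -sumEFin; apply: nneseries_lim_ge => k _ _; by rewrite lee_fin.
have -> : hip H x y = limn (series a).
  rewrite /=; congr (limn (series _)); apply/funext => n.
  rewrite /a /B -[LHS]mulrA mulrACA -expr2 sqr_sqrtr ?powR_ge0//.
rewrite /L2ip /Rintegral (integral_count sa).
rewrite -[LHS]/(fine (limn (series a))%:E) -EFin_lim//; congr fine; congr (limn _).
by apply/funext => n; rewrite /= /series /= sumEFin.
Qed.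

Let B_ae (u_ : nat -> L2 D) (u : L2 D) :
  L2norm D (u_ n - u) @[n --> \oo] --> (0 : R) ->
  {ae D, forall x, u_ n x @[n --> \oo] --> u x} ->
  {ae kappa, forall n, B (u_ k) n @[k --> \oo] --> B u n}.
Proof.
move=> uu _; apply: aeW => n.
have h := L2_strong_weak uu (h := phi n).
exact: (cvgM (cvg_cst (Num.sqrt (lam n `^ s))) h).
Qed.

Let pH : prehilbert H := energy_prehilbert (lexx 0) ler01 B_lin B_meas H_car H_ip.

Let norm_sqr w : hcar H w -> hnorm H w ^+ 2 = fine (sqint kappa (B w)).
Proof.
by move=> cw; rewrite (energy_norm (lexx 0) ler01 B_lin B_meas H_car H_ip cw) mul0r add0r mul1r.
Qed.

(** Parseval, with the coefficients from N on bounded by the weighted ones divided by L. *)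
Lemma spectral_tail w N L : 0 < L -> (forall n, (N <= n)%N -> L <= lam n `^ s) -> hcar H w ->
  L2norm D w ^+ 2 <= \sum_(i < N) L2ip D w (phi i) ^+ 2 + L^-1 * hnorm H w ^+ 2.
Proof.
move=> L0 NL cw; have fw : (sqint kappa (B w) < +oo)%E by exact/H_car.
apply: (cvgr_to_le (parseval eig (w := w))); near=> n.
have Nn : (N <= n)%N by near: n; exact: nbhs_infty_ge.
rewrite -(big_mkord xpredT (fun i => L2ip D w (phi i) ^+ 2)).
rewrite -(big_mkord xpredT (fun i => L2ip D w (phi i) ^+ 2)).
rewrite (big_cat_nat (n := N))//= lerD2l ler_pdivlMl// norm_sqr// mulr_sumr.
apply: (@le_trans _ _ (\sum_(0 <= i < n) B w i ^+ 2)).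
  rewrite [leRHS](big_cat_nat (n := N))//= ler_wpDl//.
    by apply: sumr_ge0 => i _; rewrite sqr_ge0.
  rewrite !big_seq; apply: ler_sum => i; rewrite mem_index_iota => /andP[Ni _].
  by rewrite B_sqr ler_wpM2r ?sqr_ge0// NL.
rewrite -lee_fin fineK ?ge0_fin_numE ?sqint_ge0// sqint_B -sumEFin.
by apply: nneseries_lim_ge => k _ _; rewrite lee_fin sqr_ge0.
Unshelve. all: by end_near. Qed.

(** The lower bound on the eigenvalues gives the embedding, through [spectral_tail] with empty head.
    For compactness, weak convergence kills each coefficient and eigenvalue growth makes the tails
    uniformly small, so convergence is even strong in L2. *)
Lemma good_spectral : good_space H.
Proof.
have [c0 c00 lam0] := eigenvalue_gt0 eig d_gt0.
have s0 := ltW s_gt0.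
have lamP (M : R) n : 0 <= M -> M <= lam n -> M `^ s <= lam n `^ s.
  move=> M0 Mn; have n1 : M \is Num.nneg by rewrite nnegrE.
  have n2 : lam n \is Num.nneg by rewrite nnegrE (le_trans M0).
  exact: (ge0_ler_powR s0 n1 n2 Mn).
pose L := c0 `^ s; have L0 : 0 < L by rewrite powR_gt0.
pose c := Num.sqrt L^-1; have cge0 : 0 <= c by exact: sqrtr_ge0.
have c2 : c ^+ 2 = L^-1 by rewrite sqr_sqrtr// invr_ge0 ltW.
have embed w : hcar H w -> L2norm D w <= c * hnorm H w.
  move=> cw; rewrite -ler_sqr ?nnegrE ?L2norm_ge0 ?mulr_ge0 ?ph_norm_ge0//.
  rewrite exprMn c2; have := spectral_tail (N := 0) L0 (fun n _ => lamP _ _ (ltW c00) (lam0 n)) cw.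
  by rewrite big_ord0 add0r.
split => //; first by exists c.
  by move=> w_ w cw cauchy ww; exact: (energy_complete (lexx 0) ler01 ler01 B_lin B_meas H_car
    H_ip B_ae ltr01 cw cauchy ww).
move=> w_ w M cw_ cw wM ww; apply: L2_cvg_ae_subseq; apply: sqr_cvg0.
pose v n : L2 D := w_ n - w; pose K := M + hnorm H w.
have cv n : hcar H (v n) := phB pH (cw_ n) cw.
have vK n : hnorm H (v n) <= K.
  by apply: le_trans (ph_normB pH (cw_ n) cw) _; rewrite lerD2r.
have vi i : L2ip D (v n) (phi i) @[n --> \oo] --> (0 : R).
  have h := ww _ (L2ip_in_dual embed (phi i)).
  rewrite (_ : (fun n => _) = (fun n => L2ip D (phi i) (w_ n) - L2ip D (phi i) w)).
    by apply/subr_cvg0.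
  by apply/funext => n; rewrite L2ipC L2ipBr.
have head N : \sum_(i < N) L2ip D (v n) (phi i) ^+ 2 @[n --> \oo] --> (0 : R).
  elim: N => [|N IH].
    rewrite (_ : (fun n => _) = (fun=> 0)); first exact: cvg_cst.
    by apply/funext => n; rewrite big_ord0.
  rewrite (_ : (fun n => _) = (fun n => \sum_(i < N) L2ip D (v n) (phi i) ^+ 2
    + L2ip D (v n) (phi N) * L2ip D (v n) (phi N))).
    rewrite -[X in _ --> X]addr0 -[X in _ --> _ + X](mul0r 0).
    by apply: cvgD => //; apply: cvgM; exact: vi.
  by apply/funext => n; rewrite big_ord_recr.
apply/cvgr0Pnorm_le => e e0; have e2 : 0 < e / 2 by rewrite divr_gt0.
(* Chosen so that K^2 / L1 <= e / 2, where K bounds the norms of the differences. *)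
pose L1 := K ^+ 2 / (e / 2) + 1.
have L10 : 0 < L1 by rewrite ltr_wpDl// divr_ge0 ?sqr_ge0// ltW.
have [N NP] := eigenvalue_unbounded eig (L1 `^ s^-1).
have tail n : (N <= n)%N -> L1 <= lam n `^ s.
  move=> /NP/ltW/(lamP _ _ (powR_ge0 _ _)).
  by rewrite -powRrM mulVf ?gt_eqF// powRr1// ltW.
move/cvgr0Pnorm_le : (head N) => /(_ _ e2); apply: filterS => n.
rewrite ger0_norm ?sumr_ge0// => [hn|i _]; last by rewrite sqr_ge0.
rewrite ger0_norm ?sqr_ge0// -/(v n) (splitr e).
apply: le_trans (spectral_tail L10 tail (cv n)) _; apply: lerD => //.
rewrite ler_pdivrMl//; apply: (@le_trans _ _ (K ^+ 2)).
  by rewrite lerXn2r ?nnegrE ?ph_norm_ge0// (le_trans (ph_norm_ge0 _ _) (vK n)).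
by rewrite -ler_pdivrMr// lerDl.
Qed.

End spectral_space.

Theorem theorem5p13 (R : realType) (d : nat) (d_gt0 : (0 < d)%N)
  (Omega : lipschitz_domain R d) (T : R) (T_gt0 : 0 < T)
  (s : R) (s_gt0 : 0 < s) (s_lt1 : s < 1)
  (W : hspace (L2 (dom_measure Omega))) (W_adm : admissible_space s W)
  (f : L2 (cyl_measure T Omega) -> R)
  (f' : L2 (cyl_measure T Omega) -> L2 (cyl_measure T Omega))
  (f_wlsc : weakly_lsc f) (f_below : affinely_bounded_below f)
  (f_diff : frechet_derivative f f') (f'_cont : L2_continuous f')
  (f'_cc : completely_continuous f') (f'_lip : lipschitz_on_bounded f')
  (alpha beta gamma p : R) (alpha_gt0 : 0 < alpha) (beta_gt0 : 0 < beta)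
  (gamma_gt0 : 0 < gamma) (p_gt0 : 0 < p) (p_lt1 : p < 1)
  (b L : R) (b_gt1 : 1 < b) (L_gt0 : 0 < L)
  (eps : nat -> R) (eps_gt0 : forall k, 0 < eps k)
  (eps_dec : nonincreasing_seq eps) (eps_cvg : eps n @[n --> \oo] --> (0 : R))
  (u : nat -> L2 (cyl_measure T Omega)) (w : nat -> L2 (dom_measure Omega))
  (Lk : nat -> R)
  (uwL_gen : generated W f f' alpha beta gamma p b L eps u w Lk)
  (kn : nat -> nat) (kn_incr : {homo kn : m n / (m < n)%N})
  (ubar : L2 (cyl_measure T Omega)) (wbar : L2 (dom_measure Omega))
  (wbar_W : hcar W wbar)
  (u_cvg : weak_cvg (L2_hspace (cyl_measure T Omega)) (u \o kn) ubar)
  (w_cvg : weak_cvg W (w \o kn) wbar) :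
  exists (lam : L2 (dom_measure Omega) -> R) (mu1 mu2 : L2 (cyl_measure T Omega)),
    [/\ in_dual W lam,
        forall (v : L2 (cyl_measure T Omega)) (z : L2 (dom_measure Omega)), hcar W z ->
          L2ip (cyl_measure T Omega) (f' ubar) v
          + alpha * L2ip (cyl_measure T Omega) ubar v
          + beta * hip W wbar z + gamma * lam z
          + L2ip (cyl_measure T Omega) mu1 (time_ext T z - v)
          + L2ip (cyl_measure T Omega) mu2 (time_ext T z + v) = 0,
        p * (\int[dom_measure Omega]_x (`|wbar x| `^ p))%R <= lam wbar,
        subdiff_indicator (nonneg_cone (mu := cyl_measure T Omega))
          (time_ext T wbar - ubar) mu1 &
        subdiff_indicator (nonneg_cone (mu := cyl_measure T Omega))
          (time_ext T wbar + ubar) mu2].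
Proof.
have gW : good_space W.
  case: W_adm => [->|->|->|[phi [lam [eig ->]]]].
  - exact: good_Hs.
  - exact: good_Hs0.
  - exact: good_Hs_tilde.
  - exact: good_spectral.
exact: (limit_stationary T_gt0 gW f_below f_diff f'_cc f'_lip alpha_gt0 beta_gt0 gamma_gt0
  p_gt0 p_lt1 b_gt1 L_gt0 eps_gt0 eps_dec eps_cvg uwL_gen kn_incr wbar_W u_cvg w_cvg).
Qed.
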